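(* Fix $h\ge0$, $D\in\mathbb R$. There exists $\beta_0>0$ such that for every $\beta\in(0,\beta_0)$, $$\nu(T_1^2)=A_1^2+O(N^{-3/2}),\qquad \nu(S_1^2)=B_1^2+O(N^{-3/2}),\qquad \nu(S_1T_1)=C_1^2+O(N^{-3/2}),$$ with implied constants independent of $N$.
   Context: Fix an integer $\mathcal S\ge1$ and $N\ge2$; $\Sigma_N=\{0,\pm1,\dots,\pm\mathcal S\}^N$. For $\beta>0$, $h\ge0$, $D\in\mathbb R$ and i.i.d. standard Gaussians $(g_{i,j})_{i<j}$, $H_N(\sigma)=\frac{\beta}{\sqrt N}\sum_{i<j}g_{i,j}\sigma_i\sigma_j+D\sum_i\sigma_i^2+h\sum_i\sigma_i$, Gibbs measure $G(\sigma)\propto e^{H_N(\sigma)}$ on $\Sigma_N$. Replicas are i.i.d. samples from $G$ given the disorder; $\langle\cdot\rangle$ is the product Gibbs average, $\nu(f)=\mathbb E\langle f\rangle$. $p,q$: for $\eta\sim N(0,1)$, $\langle\phi\rangle_\eta=\sum_s\phi(s)w_\eta(s)/\sum_sw_\eta(s)$, $w_\eta(s)=\exp(\beta\sqrt q\eta s+hs+(D+\frac{\beta^2}{2}(p-q))s^2)$, $s\in\{0,\pm1,\dots,\pm\mathcal S\}$; $(p,q)$ solves $q=\mathbb E\langle s\rangle_\eta^2$, $p=\mathbb E\langle s^2\rangle_\eta$ (unique at high temperature). $b_i=\langle\sigma_i\rangle$, $\tilde b_i=\langle\sigma_i^2\rangle$; $T_1=\frac1N\sum_i(\sigma^1_i-b_i)b_i$,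 $S_1=\frac1N\sum_i((\sigma_i^1)^2-\tilde b_i)$. Constants: $m_j=\langle s^j\rangle_\eta$, expectations over $\eta$: $\mathcal D=\mathbb E[m_4-m_2^2]$, $F=\mathbb E[m_2^2-m_1^2m_2]$, $G=\mathbb E[m_1^2(m_2-m_1^2)]$, $\mathcal E=\mathbb E[m_1(m_3-m_1m_2)]$; $M_1=1-\beta^2(F-3G)$, $M_2=1-\frac{\beta^2}{2}\mathcal D$, $M_3=1-\beta^2(F-G)$, $M=M_1M_2+\beta^4\mathcal E^2$; $A_1^2=\frac{GM_2+\frac{\beta^2}{2}\mathcal E^2}{NMM_3}$, $B_1^2=\frac{\mathcal DM_1-2\beta^2\mathcal E^2}{NM}$, $C_1^2=\frac{\mathcal E}{NM}$. *)

(* Defs.v *)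
From HB Require Import structures.
From mathcomp Require Import all_boot all_order all_algebra.
From mathcomp Require Import all_classical all_reals all_analysis.
From mathcomp Require Import normal_distribution.
Set Implicit Arguments. Unset Strict Implicit. Unset Printing Implicit Defensive.
Import Order.TTheory GRing.Theory Num.Theory.
Local Open Scope classical_set_scope.
Local Open Scope ring_scope.

Section SpinGlass.
Variable R : realType.

Definition spin (S : nat) (k : 'I_(2 * S + 1)) : R := k%:R - S%:R.

Definition weta (S : nat) (beta h D p q eta : R) (s : R) : R :=
  expR (beta * Num.sqrt q * eta * s + h * s
        + (D + beta ^+ 2 / 2 * (p - q)) * s ^+ 2).

Definition avg_eta (S : nat) (beta h D p q eta : R) (phi : R -> R) : R :=
  (\sum_(k < 2 * S + 1) phi (spin k) * weta S beta h D p q eta (spin k))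
  / (\sum_(k < 2 * S + 1) weta S beta h D p q eta (spin k)).

Definition mj (S : nat) (beta h D p q : R) (j : nat) (eta : R) : R :=
  avg_eta S beta h D p q eta (fun s => s ^+ j).

Definition Eeta (f : R -> R) : R :=
  Rintegral (normal_prob (0 : R) 1) setT f.

Definition fixed_point (S : nat) (beta h D p q : R) : Prop :=
  q = Eeta (fun eta => (mj S beta h D p q 1 eta) ^+ 2) /\
  p = Eeta (fun eta => mj S beta h D p q 2 eta).

Section Consts.
Variables (S : nat) (beta h D p q : R).
Let m j := mj S beta h D p q j.
Definition cD : R := Eeta (fun e => m 4 e - (m 2 e) ^+ 2).
Definition cF : R := Eeta (fun e => (m 2 e) ^+ 2 - (m 1 e) ^+ 2 * m 2 e).
Definition cG : R := Eeta (fun e => (m 1 e) ^+ 2 * (m 2 e - (m 1 e) ^+ 2)).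
Definition cE : R := Eeta (fun e => m 1 e * (m 3 e - m 1 e * m 2 e)).
Definition cM1 : R := 1 - beta ^+ 2 * (cF - 3 * cG).
Definition cM2 : R := 1 - beta ^+ 2 / 2 * cD.
Definition cM3 : R := 1 - beta ^+ 2 * (cF - cG).
Definition cM : R := cM1 * cM2 + beta ^+ 4 * cE ^+ 2.
Definition A1sq (N : nat) : R :=
  (cG * cM2 + beta ^+ 2 / 2 * cE ^+ 2) / (N%:R * cM * cM3).
Definition B1sq (N : nat) : R :=
  (cD * cM1 - 2 * beta ^+ 2 * cE ^+ 2) / (N%:R * cM).
Definition C1sq (N : nat) : R := cE / (N%:R * cM).
End Consts.

Definition config (S N : nat) := {ffun 'I_N -> 'I_(2 * S + 1)}.

Definition sv (S N : nat) (sigma : config S N) (i : 'I_N) : R := spin (sigma i).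

(** Hamiltonian for a realization gv of the disorder (gv (i,j) = g_{i,j},
    only used for i < j). *)
Definition Ham (S N : nat) (beta h D : R) (gv : 'I_N * 'I_N -> R)
  (sigma : config S N) : R :=
  beta / Num.sqrt N%:R *
    (\sum_(ij : 'I_N * 'I_N | (ij.1 < ij.2)%N)
        gv ij * sv sigma ij.1 * sv sigma ij.2)
  + D * (\sum_(i < N) (sv sigma i) ^+ 2)
  + h * (\sum_(i < N) sv sigma i).

Definition gavg (S N : nat) (beta h D : R) (gv : 'I_N * 'I_N -> R)
  (f : config S N -> R) : R :=
  (\sum_(sigma : config S N) f sigma * expR (Ham beta h D gv sigma))
  / (\sum_(sigma : config S N) expR (Ham beta h D gv sigma)).

Section Overlaps.
Variables (S N : nat) (beta h D : R) (gv : 'I_N * 'I_N -> R).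
Definition bb (i : 'I_N) : R := gavg beta h D gv (fun s : config S N => sv s i).
Definition bt (i : 'I_N) : R :=
  gavg beta h D gv (fun s : config S N => (sv s i) ^+ 2).
Definition T1 (sigma : config S N) : R :=
  N%:R^-1 * \sum_(i < N) (sv sigma i - bb i) * bb i.
Definition S1 (sigma : config S N) : R :=
  N%:R^-1 * \sum_(i < N) ((sv sigma i) ^+ 2 - bt i).
End Overlaps.

Section Disorder.
Context {d : measure_display} {Omega : measurableType d}.
Variable P : probability Omega R.

Definition std_gaussian_rv (X : Omega -> R) : Prop :=
  measurable_fun setT X /\
  forall A : set R, measurable A -> P (X @^-1` A) = normal_prob (0 : R) 1 A.

Definition iid_gaussian_disorder (N : nat) (g : 'I_N * 'I_N -> Omega -> R) : Prop :=
  (forall ij : 'I_N * 'I_N, (ij.1 < ij.2)%N -> std_gaussian_rv (g ij)) /\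
  (forall A : 'I_N * 'I_N -> set R, (forall ij, measurable (A ij)) ->
     P (\big[setI/setT]_(ij : 'I_N * 'I_N | (ij.1 < ij.2)%N) (g ij @^-1` A ij))
     = (\prod_(ij : 'I_N * 'I_N | (ij.1 < ij.2)%N) P (g ij @^-1` A ij))%E).

(** nu(f) = E < f >, where f may depend on the disorder realization. *)
Definition nu (S N : nat) (beta h D : R) (g : 'I_N * 'I_N -> Omega -> R)
  (f : ('I_N * 'I_N -> R) -> config S N -> R) : R :=
  Rintegral P setT
    (fun w => let gv := fun ij => g ij w in gavg beta h D gv (f gv)).
End Disorder.

End SpinGlass.

(* Main.v *)
(* Cavity method at every site i, with an auxiliary Gaussian eta independent of
   the disorder. Rotate by an angle th the vector (disorder touching i, eta): at
   th = pi/2 the energy is the original Hamiltonian, at th = 0 the site i is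
   decoupled from the others and feels the mean-field weight of the fixed point
   (p, q). Gaussian integration by parts gives, for the centered overlaps Q and
   a function f of m replicas, d/dth E<f> = 2 sin th cos th E<Dop f> with Dop f
   linear in Q. For small beta this first yields E<Q^k> = O(N^(-k/2)) for
   k <= 4. At second order, for a function phi of the spins at i with mean zero
   at th = 0, E<phi Q_uv> equals the diagonal contribution of size 1/N plus
   beta^2 times a linear combination of the E<Q_ll' Q_uv>, up to O(N^(-3/2)).
   Averaging over i turns phi into a difference of overlaps, and four choices of
   phi give a closed linear system whose solution is A_1^2, B_1^2, C_1^2. *)

(* The angle stands for the usual parameter t = sin^2 th. The square roots of t and 1 - t, whose
   derivatives blow up at the ends, become sin and cos, so differentiation under the expectation has
   an integrable bound everywhere, and expansions in t survive through the factor 2 sin th cos th.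
   The a priori bound is a bootstrap. By the equations for p and q, (sigma_i^u sigma_i^v - p or q)
   Q^k has mean zero at th = 0, so E<Q^(k+1)> is at most beta^2 times a moment of the same order,
   plus an error carrying a factor 1/N from removing site i; small beta absorbs the first term. Even
   orders close this way, and orders 1 and 3 follow from their neighbours. Order 4 is reached
   because the second-order remainder is cubic in Q. Each derivative brings in two new replicas. The
   test functions use at most 4 and are differentiated twice, hence the 8 replicas fixed throughout.
   With beta <= 1 imposed, all constants depend on the spin range alone. *)
Require Import Defs.
From HB Require Import structures.
From mathcomp Require Import all_boot all_order all_algebra.
From mathcomp Require Import all_classical all_reals all_analysis.
From mathcomp Require Import measurable_realfun normal_distribution.
From mathcomp Require Import fingroup perm.
From mathcomp Require Import ring lra.
Set Implicit Arguments. Unset Strict Implicit. Unset Printing Implicit Defensive.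
Import Order.TTheory GRing.Theory Num.Theory.
Import numFieldNormedType.Exports.
Local Open Scope classical_set_scope.
Local Open Scope ring_scope.

(** * Gaussian integration by parts *)

Section NormalDensity.
Context {R : realType}.
Local Notation mu := (@lebesgue_measure R).
Local Notation gam := (normal_prob (0 : R) 1).
Local Notation pdf := (normal_pdf (0 : R) 1).

(** Change of variables holds for the Radon-Nikodym derivative; it and the density have the same
    integral over every measurable set, hence agree almost everywhere. *)
Lemma ge0_integral_normal_prob (f : R -> \bar R) :
  measurable_fun setT f -> (forall x, 0 <= f x)%E ->
  (\int[gam]_x f x = \int[mu]_x (f x * (pdf x)%:E))%E.
Proof.
move=> mf f0; have dom := normal_prob_dominates (0 : R) 1.
rewrite -(Radon_Nikodym_SigmaFinite.change_of_variables dom f0)//=.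
have RNi := Radon_Nikodym_SigmaFinite.f_integrable dom.
apply: ae_eq_integral => //.
- by apply: emeasurable_funM => //; apply: (measurable_int mu).
- apply: emeasurable_funM => //=.
  by apply/measurableT_comp => //=; exact: measurable_normal_pdf.
- apply: ae_eqe_mul2l => /=; apply: integral_ae_eq => //=.
  + by apply/measurableT_comp =>//; exact: measurable_normal_pdf.
  + by move=> E _ mE; rewrite -Radon_Nikodym_SigmaFinite.f_integral.
Qed.

Lemma integrable_normal_prob (f : R -> R) : measurable_fun setT f ->
  gam.-integrable setT (EFin \o f) <->
  mu.-integrable setT (EFin \o (fun x => f x * pdf x)).
Proof.
move=> mf; have E : (\int[gam]_x `|(f x)%:E| =
    \int[mu]_x `|(f x * pdf x)%:E|)%E.
  rewrite ge0_integral_normal_prob//; last first.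
    by apply/measurable_EFinP; apply: measurableT_comp.
  apply: eq_integral => x _; rewrite -!EFinM /=; congr EFin.
  by rewrite normrM (ger0_norm (normal_pdf_ge0 _ _ _)).
have mfp : measurable_fun setT (fun x => f x * pdf x).
  by apply: measurable_funM => //; exact: measurable_normal_pdf.
split=> /integrableP[_ fi]; apply/integrableP; split.
- exact/measurable_EFinP.
- by rewrite /= -E.
- exact/measurable_EFinP.
- by rewrite /= E.
Qed.

Lemma Rintegral_normal_prob (f : R -> R) : gam.-integrable setT (EFin \o f) ->
  Rintegral gam setT f = Rintegral mu setT (fun x => f x * pdf x).
Proof.
move=> fi; have mf : measurable_fun setT f.
  by apply/measurable_EFinP; exact: (measurable_int gam).
have fi' := (integrable_normal_prob mf).1 fi.
rewrite /Rintegral; congr fine.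
rewrite integralE [RHS]integralE; congr (_ - _)%E.
- rewrite ge0_integral_normal_prob//; last by apply: measurable_funepos; apply/measurable_EFinP.
  apply: eq_integral => x _.
  rewrite !funeposE /= -!EFin_max -EFinM; congr EFin.
  by rewrite maxr_pMl ?normal_pdf_ge0// mul0r.
- rewrite ge0_integral_normal_prob//; last by apply: measurable_funeneg; apply/measurable_EFinP.
  apply: eq_integral => x _.
  rewrite !funenegE /= -!EFin_max -EFinM; congr EFin.
  by rewrite maxr_pMl ?normal_pdf_ge0// mul0r mulNr.
Qed.

Lemma normal_pdf01E x : pdf x = normal_peak (1:R) * expR (- (x ^+ 2 / 2)).
Proof.
rewrite normal_pdfE ?oner_neq0// /normal_fun subr0 expr1n mulNr.
by rewrite -mulr_natl mulr1.
Qed.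

Lemma ler_norm_expR_sqr (x : R) : `|x| <= expR (x ^+ 2 / 4).
Proof.
apply: (le_trans _ (expR_ge1Dx _)).
have := sqr_ge0 (`|x| - 2); rewrite -[x ^+ 2]real_normK ?num_real//.
by nra.
Qed.

(** Since |x| <= exp(x^2/4), the integrand |x| exp(-x^2/2) is dominated by exp(-x^2/4), the shape of
    the density of variance 2. *)
Lemma integrable_normal_id : gam.-integrable setT (EFin \o (fun x : R => x)).
Proof.
apply/integrable_normal_prob => //.
have s0 : Num.sqrt 2 != 0 :> R by rewrite sqrtr_eq0 -ltNge.
apply: (@le_integrable _ _ _ mu setT _ _
   (EFin \o (fun x => (normal_peak (1:R) / normal_peak (Num.sqrt 2)) *
              normal_pdf 0 (Num.sqrt 2) x))) => //=.
- apply/measurable_EFinP; apply: measurable_funM => //.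
  exact: measurable_normal_pdf.
- move=> x _; rewrite lee_fin normrM (ger0_norm (normal_pdf_ge0 _ _ _)).
  rewrite [leRHS]ger0_norm; last first.
    by rewrite mulr_ge0 ?normal_pdf_ge0 ?mulr_ge0 ?invr_ge0 ?normal_peak_ge0.
  rewrite normal_pdf01E normal_pdfE// (mulrA (_ / _)) divfK; last first.
    by rewrite gt_eqF// normal_peak_gt0.
  rewrite mulrCA ler_wpM2l ?normal_peak_ge0//.
  rewrite /normal_fun subr0 sqr_sqrtr//.
  apply: (le_trans (ler_wpM2r (expR_ge0 _) (ler_norm_expR_sqr x))).
  rewrite -expRD ler_expR -mulr_natr.
  by lra.
- have := integrableZl measurableT (normal_peak (1:R) / normal_peak (Num.sqrt 2))
    (integrable_normal_pdf 0 (Num.sqrt 2 : R)).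
  by apply: eq_integrable.
Qed.

(** The difference of the two integrands against the density is the derivative of [phi * pdf]. Its
    integral over [-n-1, n+1] is a boundary term that tends to 0, and dominated convergence passes
    to the whole line. *)
Lemma gauss_ibp (phi dphi : R -> R) (B : R) :
  (forall x : R, is_derive x 1 phi (dphi x)) -> continuous dphi ->
  (forall x, `|phi x| <= B) -> (forall x, `|dphi x| <= B) ->
  Rintegral gam setT (fun x => x * phi x) = Rintegral gam setT dphi.
Proof.
move=> Dphi cdphi Bphi Bdphi.
have B0 : 0 <= B := le_trans (normr_ge0 _) (Bphi 0).
have cphi : continuous phi.
  by move=> x; apply/differentiable_continuous/derivable1_diffP; case: (Dphi x).
have mphi : measurable_fun [set: R] phi by exact: continuous_measurable_fun.
have mdphi : measurable_fun [set: R] dphi by exact: continuous_measurable_fun.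
have ixphi : gam.-integrable setT (EFin \o (fun x => x * phi x)).
  apply: (@le_integrable _ _ _ gam setT measurableT _
    (EFin \o (fun x => B * x))) => //=.
  - by apply/measurable_EFinP; exact: measurable_funM.
  - by move=> x _; rewrite lee_fin !normrM mulrC ler_wpM2r// (ger0_norm B0).
  - by have := integrableZl measurableT B integrable_normal_id; apply: eq_integrable.
have idphi : gam.-integrable setT (EFin \o dphi).
  apply: (@le_integrable _ _ _ gam setT measurableT _
    (EFin \o cst B)) => //=.
  - exact/measurable_EFinP.
  - by move=> x _; rewrite lee_fin (ger0_norm B0).
  - exact: finite_measure_integrable_cst.
pose F x := phi x * pdf x.
pose w x := dphi x * pdf x - x * phi x * pdf x.
have i1 := (integrable_normal_prob mdphi).1 idphi.
have i2 := (integrable_normal_prob (measurable_funM (@measurable_id _ _ _) mphi)).1 ixphi.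
have cpdf : continuous pdf by apply: continuous_normal_pdf; rewrite oner_neq0.
have cw : continuous w.
  move=> x; apply: cvgB; first by apply: cvgM; [exact: cdphi|exact: cpdf].
  by apply: cvgM; [apply: cvgM; [exact: cvg_id|exact: cphi]|exact: cpdf].
have DF (x : R) : is_derive x 1 F (w x).
  rewrite /F; under eq_fun do rewrite normal_pdf01E.
  apply: is_derive_eq.
  rewrite /w normal_pdf01E /GRing.scale /= /cst.
  by field.
have wi : mu.-integrable setT (EFin \o w).
  by have := integrableB measurableT i1 i2; apply: eq_integrable.
have w0 : Rintegral mu setT w = 0.
  (* From exp(x^2/2) >= exp(x^2/4) >= |x|: decay like 1/n is all that the boundary term needs. *)
  have bF (n : nat) (x : R) : `|x| = n.+1%:R -> `|F x| <= B * normal_peak (1:R) * n.+1%:R^-1.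
    move=> xn; rewrite /F normrM normal_pdf01E.
    rewrite (ger0_norm (mulr_ge0 (normal_peak_ge0 _) (expR_ge0 _))).
    rewrite -mulrA; apply: ler_pM => //.
      by rewrite mulr_ge0 ?normal_peak_ge0 ?expR_ge0.
    rewrite ler_wpM2l ?normal_peak_ge0// expRN lef_pV2 ?posrE ?expR_gt0//.
    rewrite -xn (le_trans (ler_norm_expR_sqr _))// ler_expR.
    by have := sqr_ge0 x; lra.
  have Fn (n : nat) : (\int[mu]_x ((w \_ `[- n.+1%:R, n.+1%:R]) x)%:E =
      (F n.+1%:R - F (- n.+1%:R))%:E)%E.
    rewrite EFinB -(@continuous_FTC2 _ w F (- n.+1%:R) n.+1%:R).
    - by rewrite [RHS]integral_mkcond restrict_EFin.
    - by rewrite gtrN.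
    - by apply: continuous_subspaceT.
    - split.
      + by move=> x _; case: (DF x).
      + by apply: cvg_at_right_filter; apply/differentiable_continuous/derivable1_diffP; case: (DF (- n.+1%:R)).
      + by apply: cvg_at_left_filter; apply/differentiable_continuous/derivable1_diffP; case: (DF (n.+1%:R)).
    - by move=> x _; rewrite derive1E; case: (DF x).
  have lim0 : (F n.+1%:R - F (- n.+1%:R))%:E @[n --> \oo] --> (0 : \bar R).
    apply: cvg_EFin; first exact: nearW.
    apply/norm_cvg0P.
    apply: (@squeeze_cvgr _ _ _ _ (cst 0) (fun n => (B * normal_peak (1:R) * 2) * n.+1%:R^-1)).
    - apply: nearW => n; rewrite normr_ge0/= (le_trans (ler_normB _ _))//.
      have h1 := bF n n.+1%:R (normr_nat _ _).
      have h2 := bF n (- n.+1%:R).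
      rewrite normrN normr_nat in h2; apply: (le_trans (lerD h1 (h2 erefl))).
      by rewrite le_eqVlt; apply/orP; left; apply/eqP; ring.
    - exact: cvg_cst.
    - rewrite -[X in _ --> X](mulr0 (B * normal_peak (1:R) * 2)).
      apply: cvgM; first exact: cvg_cst.
      exact: cvg_harmonic.
  have limw : (\int[mu]_x ((w \_ `[- n.+1%:R, n.+1%:R]) x)%:E)%E @[n --> \oo]
     --> (\int[mu]_x (w x)%:E)%E.
    apply: (@dominated_cvg _ _ _ mu _ _
      (fun n x => ((w \_ `[- n.+1%:R, n.+1%:R]) x)%:E) _ (fun x => `|w x|%:E)) => //=.
    - move=> n; apply/measurable_EFinP.
      have mw : measurable_fun [set: R] w by exact: continuous_measurable_fun.
      have mD : measurable (`[- n.+1%:R, n.+1%:R] : set R) by exact: measurable_itv.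
      have [H _] := measurable_restrictT w mD.
      exact: (H (measurable_funTS mw)).
    - move=> x _; apply: cvg_EFin; first exact: nearW.
      apply: cvg_near_cst; near=> n => /=; rewrite patchE.
      case: ifPn => //; rewrite notin_setE /= in_itv/= => /negP; case/negP.
      rewrite -ler_norml; apply: (@le_trans _ _ n%:R); last by rewrite ler_nat.
      by apply: ltW; near: n; exact: nbhs_infty_gtr.
    - have := integrable_abse wi; apply: eq_integrable => //.
    - move=> n x _; rewrite lee_fin patchE; case: ifP => // _.
      by rewrite normr0.
  rewrite /Rintegral.
  have -> : (\int[mu]_x (w x)%:E = 0)%E.
    move: limw; under eq_fun do rewrite Fn.
    by move/cvg_unique; apply.
  by [].
rewrite !Rintegral_normal_prob//.
apply/eqP; rewrite eq_sym -subr_eq0 -RintegralB//; apply/eqP.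
exact: w0.
Unshelve. all: by end_near.
Qed.
End NormalDensity.

(** * Finite families of independent Gaussians *)

Section GaussianFamily.
Context {R : realType} {J : finType}.
Local Notation gam := (normal_prob (0 : R) 1).

Definition rect (D : pred J) (A : J -> set R) : set (J -> R) :=
  [set v | forall k, D k -> A k (v k)].

Definition rects (D : pred J) : set (set (J -> R)) :=
  [set B | exists2 A : J -> set R, (forall k, measurable (A k)) & B = rect D A].

(** The sigma-algebra of the coordinates in [D], carried by all functions on [J]: a function
    measurable on this type does not see the values off [D]. *)
Definition gvec (D : pred J) := g_sigma_algebraType (rects D).

Definition iid_gauss (D : pred J) d (Omega : measurableType d)
    (P : probability Omega R) (X : J -> Omega -> R) : Prop :=
  (forall k, D k -> measurable_fun setT (X k)) /\
  (forall A : J -> set R, (forall k, measurable (A k)) ->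
     P [set w | rect D A (X^~ w)] = (\prod_(k | D k) gam (A k))%E).

Lemma measurable_coord (D : pred J) (k : J) : D k ->
  measurable_fun setT (fun v : gvec D => v k).
Proof.
move=> Dk _ B mB; rewrite setTI; apply: sub_sigma_algebra.
exists (fun j => if j == k then B else setT).
  by move=> j; case: ifP.
apply/seteqP; split => v /=.
  by move=> Bv j Dj; case: eqP => // ->.
by move=> /(_ k Dk); rewrite eqxx.
Qed.

Lemma measurable_family (D : pred J) d (Omega : measurableType d)
    (X : J -> Omega -> R) :
  (forall k, D k -> measurable_fun setT (X k)) ->
  measurable_fun setT (fun w => (X^~ w) : gvec D).
Proof.
move=> mX; apply: (@measurability _ _ Omega (gvec D) setT _ (rects D)) => //.
move=> _ [_ [A mA ->] <-].
have -> : setT `&` (fun w => (X^~ w) : gvec D) @^-1` (rect D A) =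
   \big[setI/setT]_(k | D k) (X k @^-1` A k).
  rewrite setTI; apply/seteqP; split => w /=.
    by move=> h; elim/big_rec: _ => // k B Dk wB; split => //; exact: h.
  move=> h k Dk; move: h; rewrite (bigD1 k)//=; exact: proj1.
apply: bigsetI_measurable => k Dk.
  by rewrite -[X in measurable X]setTI; apply: mX.
Qed.

(** Rectangles are stable under intersection and generate the sigma-algebra, so the two push-forward
    laws coincide. This lets the given space be traded for a product in which one chosen coordinate
    is a separate factor. *)
Lemma iid_gauss_Rintegral (D : pred J) d d' (Omega : measurableType d)
    (Omega' : measurableType d') (P : probability Omega R)
    (P' : probability Omega' R) (X : J -> Omega -> R) (X' : J -> Omega' -> R)
    (F : gvec D -> R) :
  iid_gauss D P X -> iid_gauss D P' X' -> measurable_fun setT F ->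
  P.-integrable setT (EFin \o (fun w => F (X^~ w))) ->
  P'.-integrable setT (EFin \o (fun w => F (X'^~ w))) ->
  Rintegral P setT (fun w => F (X^~ w)) = Rintegral P' setT (fun w => F (X'^~ w)).
Proof.
move=> [mX PX] [mX' PX'] mF iF iF'; rewrite /Rintegral; congr fine.
have mfX := measurable_family mX; have mfX' := measurable_family mX'.
have mEF : measurable_fun setT (EFin \o F) by exact/measurable_EFinP.
have := integral_pushforward mfX (mu := P) (D := setT) mEF iF measurableT.
have := integral_pushforward mfX' (mu := P') (D := setT) mEF iF' measurableT.
rewrite !preimage_setT => <- <-.
apply: eq_measure_integral => A mA _.
apply: (@measure_unique _ R (gvec D) (rects D) (fun=> setT) _ _ _ _ _ _ _ _ A) => //.
- move=> _ _ [A1 mA1 ->] [A2 mA2 ->].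
  exists (fun k => A1 k `&` A2 k); first by move=> k; exact: measurableI.
  apply/seteqP; split => v /=.
    by move=> [h1 h2] k Dk; split; [exact: h1|exact: h2].
  by move=> h; split=> k Dk; case: (h k Dk).
- by move=> _; exists (fun=> setT) => //; apply/seteqP; split.
- by rewrite bigcup_const//; exists 0%N.
- by move=> _ [B mB ->]; exact: (etrans (PX B mB) (esym (PX' B mB))).
- by move=> _; rewrite /= /pushforward -[X in P X]/setT probability_setT ltry.
Qed.

Definition upd (k : J) (v : J -> R) (x : R) : J -> R :=
  fun j => if j == k then x else v j.

Lemma iid_gauss_upd (D : pred J) (k : J) d (Omega : measurableType d)
    (P : probability Omega R) (X : J -> Omega -> R) :
  D k -> iid_gauss (predD1 D k) P X ->
  iid_gauss D (P \x gam)%E (fun j z => upd k (X^~ z.1) z.2 j).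
Proof.
move=> Dk [mX PX]; split.
  move=> j Dj; rewrite /upd; case: eqP => [_|/eqP jk].
    exact: (@measurable_snd _ _ Omega R).
  have Djk : predD1 D k j by rewrite /= jk.
  exact: (measurableT_comp (mX j Djk) (@measurable_fst _ _ Omega R)).
move=> A mA.
have -> : [set w | rect D A (fun j => upd k (X^~ w.1) w.2 j)] =
    [set w | rect (predD1 D k) A (X^~ w)] `*` A k.
  apply/seteqP; split => -[w x] /=.
    move=> h; split; last by have := h k Dk; rewrite /upd eqxx.
    by move=> j /andP[jk Dj]; have := h j Dj; rewrite /upd (negbTE jk).
  move=> [h1 h2] j Dj; rewrite /upd; case: eqP => [->//|/eqP jk].
  by apply: h1; rewrite /= jk.
have mB : measurable [set w | rect (predD1 D k) A (X^~ w)].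
  rewrite -[X in measurable X]setTI.
  apply: (measurable_family mX measurableT).
  by apply: sub_sigma_algebra; exists A.
rewrite [LHS](product_measure1E P gam mB (mA k)).
rewrite [RHS](bigD1 k)//= muleC; congr (_ * _)%E.
apply: (etrans (PX A mA)).
by apply: eq_bigl => j; rewrite andbC.
Qed.

Lemma integrable_gauss (D : pred J) (k : J) d (Omega : measurableType d)
    (P : probability Omega R) (X : J -> Omega -> R) :
  D k -> iid_gauss D P X -> P.-integrable setT (EFin \o X k).
Proof.
move=> Dk [mX PX].
have E A : measurable A -> P (X k @^-1` A) = gam A.
  (* A rectangle with a single constrained side gives the marginal law. *)
  move=> mA; have := PX (fun j => if j == k then A else setT).
  rewrite (bigD1 k)//= eqxx big1 ?mule1 => [<-|j /andP[_ /negbTE ->]]; last first.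
    exact: probability_setT.
    by move=> j; case: ifP.
  congr (P _); apply/seteqP; split => w /=.
    by move=> Aw j _; case: eqP => // ->.
  by move=> /(_ k Dk); rewrite eqxx.
apply/integrableP; split; first exact/measurable_EFinP/mX.
have := integrable_normal_id (R := R) => /integrableP[_].
have mXk : @measurable_fun _ _ Omega (measurableTypeR R) setT (X k) := mX k Dk.
have mabs : @measurable_fun _ _ (measurableTypeR R) _ setT
    (fun x : R => `|x%:E|%E).
  by apply: (@measurableT_comp _ _ _ _ _ _ abse _ EFin).
have := ge0_integral_pushforward mXk P measurableT mabs.
rewrite preimage_setT => /(_ (fun _ _ => abse_ge0 _)) PE lty.
apply: le_lt_trans lty; rewrite le_eqVlt; apply/orP; left; apply/eqP.
apply: (etrans (esym PE)); apply: eq_measure_integral => A mA _.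
by apply: E.
Qed.

Lemma iid_gauss_predD1 (D : pred J) (k : J) d (Omega : measurableType d)
    (P : probability Omega R) (X : J -> Omega -> R) :
  D k -> iid_gauss D P X -> iid_gauss (predD1 D k) P X.
Proof.
move=> Dk iX.
have [mX PX] := iX; split=> [j /andP[_ Dj]|A mA]; first exact: mX.
have mA' j : measurable (if j == k then setT else A j) by case: ifP.
have := PX _ mA'; rewrite (bigD1 k)//= eqxx probability_setT mul1e.
rewrite (eq_bigr (fun j => gam (A j))) => [|j /andP[_ /negbTE ->]//].
rewrite (eq_bigl (predD1 D k)) => [<-|j]; last by rewrite andbC.
congr (P _); apply/seteqP; split => w /=.
  move=> h j Dj; case: eqP => // /eqP jk; apply: h.
  by rewrite /= jk.
by move=> h j /andP[/negbTE jk Dj]; have := h j Dj; rewrite jk.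
Qed.

(** On the product space coordinate [k] is the second factor; Fubini reduces the claim to the
    one-dimensional formula with the other coordinates frozen. *)
Lemma gauss_ibp_family (D : pred J) (k : J) d (Omega : measurableType d)
    (P : probability Omega R) (X : J -> Omega -> R) (F dF : gvec D -> R) (B : R) :
  D k -> iid_gauss D P X ->
  measurable_fun setT F -> measurable_fun setT dF ->
  (forall v (x : R), is_derive x 1 (fun y => F (upd k v y)) (dF (upd k v x))) ->
  (forall v, continuous (fun y => dF (upd k v y))) ->
  (forall v, `|F v| <= B) -> (forall v, `|dF v| <= B) ->
  Rintegral P setT (fun w => X k w * F (X^~ w)) =
  Rintegral P setT (fun w => dF (X^~ w)).
Proof.
move=> Dk iX mF mdF DF cdF BF BdF.
have iX' := iid_gauss_predD1 Dk iX.
have iXu := iid_gauss_upd Dk iX'.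
have B0 : 0 <= B := le_trans (normr_ge0 _) (BF (fun=> 0)).
have bounded d' (Om : measurableType d') (Q : probability Om R) (G : Om -> R) :
    measurable_fun setT G -> (forall w, `|G w| <= B) -> Q.-integrable setT (EFin \o G).
  move=> mG BG.
  apply: (@le_integrable _ _ _ Q setT measurableT _ (EFin \o cst B)) => //=.
  - exact/measurable_EFinP.
  - by move=> x _; rewrite lee_fin (ger0_norm B0).
  - exact: finite_measure_integrable_cst.
have xF d' (Om : measurableType d') (Q : probability Om R) (Y : J -> Om -> R) :
    iid_gauss D Q Y -> Q.-integrable setT (EFin \o (fun w => Y k w * F (Y^~ w))).
  move=> iY; have mY := measurable_family iY.1.
  apply: (@le_integrable _ _ _ Q setT measurableT _
    (EFin \o (fun x => B * Y k x))) => //=.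
  - apply/measurable_EFinP; apply: measurable_funM; first exact: iY.1.
    exact: (measurableT_comp mF mY).
  - by move=> x _; rewrite lee_fin !normrM mulrC ler_wpM2r// (ger0_norm B0).
  - by have := integrableZl measurableT B (integrable_gauss Dk iY); apply: eq_integrable.
have xdF d' (Om : measurableType d') (Q : probability Om R) (Y : J -> Om -> R) :
    iid_gauss D Q Y -> Q.-integrable setT (EFin \o (fun w => dF (Y^~ w))).
  move=> iY; have mY := measurable_family iY.1.
  by apply: bounded => //; exact: (measurableT_comp mdF mY).
have mxF : measurable_fun setT (fun v : gvec D => v k * F v).
  by apply: measurable_funM => //; exact: measurable_coord.
rewrite (iid_gauss_Rintegral (F := fun v : gvec D => v k * F v) iX iXu mxF (xF _ _ _ _ iX) (xF _ _ _ _ iXu)).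
rewrite (iid_gauss_Rintegral (F := dF) iX iXu mdF (xdF _ _ _ _ iX) (xdF _ _ _ _ iXu)).
rewrite /Rintegral; congr fine.
have H1 := integral12_prod_meas1 (xF _ _ _ _ iXu).
have H2 := integral12_prod_meas1 (xdF _ _ _ _ iXu).
apply: (etrans (esym H1)); apply: (etrans _ H2).
apply: eq_integral => w _.
set v := X^~ w.
have mFv : measurable_fun [set: R] (fun x => F (upd k v x)).
  apply: continuous_measurable_fun => x.
  by apply/differentiable_continuous/derivable1_diffP; case: (DF v x).
have mdFv : measurable_fun [set: R] (fun x => dF (upd k v x)).
  exact: continuous_measurable_fun.
have idv : gam.-integrable setT (EFin \o (fun x => dF (upd k v x))).
  exact: bounded.
have ixv : gam.-integrable setT (EFin \o (fun x => x * F (upd k v x))).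
  apply: (@le_integrable _ _ _ gam setT measurableT _
    (EFin \o (fun x => B * x))) => //=.
  - by apply/measurable_EFinP; apply: measurable_funM.
  - by move=> x _; rewrite lee_fin !normrM mulrC ler_wpM2r// (ger0_norm B0).
  - by have := integrableZl measurableT B integrable_normal_id; apply: eq_integrable.
have := gauss_ibp (DF v) (cdF v) (fun x => BF (upd k v x)) (fun x => BdF (upd k v x)).
move=> E; have := congr1 EFin E; rewrite /Rintegral !fineK ?integrable_fin_num//.
move=> E'; apply: etrans E'; apply: eq_integral => x _ /=.
by rewrite {1}/upd eqxx.
Qed.

End GaussianFamily.

(** * Replicas *)

(** Independence under a product weight, without splitting the type: [mix x y] takes one part of its
    data from [x] and the rest from [y], and the involution (x, y) -> (mix x y, mix y x) of the
    double sum exchanges the factors [b] and [d]. It serves both for replicas and for one site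
    against the others. *)
Lemma sum_exchange (R : comRingType) (A : finType) (mix : A -> A -> A)
    (a b c d : A -> R) :
  (forall x y, mix (mix x y) (mix y x) = x) ->
  (forall x y, a (mix x y) = a x) -> (forall x y, c (mix x y) = c x) ->
  (forall x y, b (mix x y) = b y) -> (forall x y, d (mix x y) = d y) ->
  (\sum_x a x * b x) * (\sum_x c x * d x) =
  (\sum_x a x * d x) * (\sum_x c x * b x).
Proof.
move=> mixK ha hc hb hd; rewrite !big_distrlr !pair_big /=.
pose h (xy : A * A) := (mix xy.1 xy.2, mix xy.2 xy.1).
have hK : involutive h by case=> x y; rewrite /h /= !mixK.
rewrite (reindex_inj (inv_inj hK)); apply: eq_bigr => -[x y] _ /=.
by rewrite ha hb hc hd; ring.
Qed.

Lemma is_derive_sumr (R : realType) (I : Type) (r : seq I) (P : pred I)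
    (F : I -> R -> R) (dF : I -> R) (x : R) :
  (forall i, P i -> is_derive x 1 (F i) (dF i)) ->
  is_derive x 1 (fun y => \sum_(i <- r | P i) F i y) (\sum_(i <- r | P i) dF i).
Proof.
move=> DF; elim: r => [|i r IH].
  rewrite big_nil; under eq_fun do rewrite big_nil.
  exact: is_derive_cst.
rewrite big_cons; under eq_fun do rewrite big_cons.
by case: ifP => // Pi; apply: is_deriveD; exact: DF.
Qed.

Section Replicas.
Context {R : realType} {T : finType} (t0 : T) {K : nat}.
Local Notation rstate := {ffun 'I_K -> T}.
Implicit Types (u : T -> R) (f g : rstate -> R) (s : rstate).

Definition rweight u s : R := \prod_l expR (u (s l)).

Definition rep u f : R := (\sum_s f s * rweight u s) / \sum_s rweight u s.

Definition depends_on (L : pred 'I_K) f := forall s s',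
  (forall l, L l -> s l = s' l) -> f s = f s'.

Lemma rweight_gt0 u s : 0 < rweight u s.
Proof. by apply: prodr_gt0 => l _; exact: expR_gt0. Qed.

Lemma sum_rweight_gt0 u : 0 < \sum_s rweight u s.
Proof.
rewrite (bigD1 [ffun=> t0])//= ltr_wpDr ?rweight_gt0//.
by apply: sumr_ge0 => s _; exact/ltW/rweight_gt0.
Qed.

Lemma repD u f g : rep u (fun s => f s + g s) = rep u f + rep u g.
Proof.
by rewrite /rep -mulrDl -big_split/=; congr (_ / _); apply: eq_bigr => s _; rewrite mulrDl.
Qed.

Lemma repZ u (c : R) f : rep u (fun s => c * f s) = c * rep u f.
Proof.
rewrite /rep mulrA big_distrr/=; congr (_ / _).
by apply: eq_bigr => s _; rewrite mulrA.
Qed.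

Lemma eq_rep u f g : f =1 g -> rep u f = rep u g.
Proof. by move=> fg; congr (_ / _); apply: eq_bigr => s _; rewrite fg. Qed.

Lemma rep_sum u (I : Type) (r : seq I) (P : pred I) (F : I -> rstate -> R) :
  rep u (fun s => \sum_(i <- r | P i) F i s) = \sum_(i <- r | P i) rep u (F i).
Proof.
rewrite /rep -mulr_suml; congr (_ / _); rewrite exchange_big/=.
by apply: eq_bigr => s _; rewrite mulr_suml.
Qed.

Lemma rep_cst u (c : R) : rep u (fun=> c) = c.
Proof.
by rewrite /rep -mulr_sumr mulfK// gt_eqF// sum_rweight_gt0.
Qed.

Lemma le_rep u f g : (forall s, f s <= g s) -> rep u f <= rep u g.
Proof.
move=> fg; rewrite ler_wpM2r ?invr_ge0 ?(ltW (sum_rweight_gt0 u))//.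
by apply: ler_sum => s _; rewrite ler_wpM2r// ltW// rweight_gt0.
Qed.

Lemma rep_bounded u f (B : R) : (forall s, `|f s| <= B) -> `|rep u f| <= B.
Proof.
move=> fB; rewrite ler_norml -{1}(rep_cst u (- B)) -{2}(rep_cst u B).
by apply/andP; split; apply: le_rep => s; have := fB s; rewrite ler_norml => /andP[].
Qed.

Lemma rep_perm u f (p : {perm 'I_K}) :
  rep u (fun s => f [ffun l => s (p l)]) = rep u f.
Proof.
rewrite /rep; congr (_ / _).
pose h s : rstate := [ffun l => s (p l)].
have hI : injective h.
  move=> s s' /ffunP E; apply/ffunP => l.
  by have := E ((p^-1)%g l); rewrite !ffunE permKV.
rewrite [RHS](reindex_inj hI); apply: eq_bigr => s _; congr (_ * _).
rewrite /rweight (reindex_inj (@perm_inj _ p)).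
by apply: eq_bigr => l _; rewrite ffunE.
Qed.

Lemma rep_prod u (F : 'I_K -> T -> R) :
  rep u (fun s => \prod_l F l (s l)) =
  \prod_l ((\sum_t F l t * expR (u t)) / \sum_t expR (u t)).
Proof.
rewrite /rep /rweight prodf_div; congr (_ / _); last first.
  by rewrite -(bigA_distr_bigA (fun=> expR \o u)).
rewrite (bigA_distr_bigA (fun l t => F l t * expR (u t))).
by apply: eq_bigr => s _; rewrite big_split.
Qed.

Lemma rep_indep u f g (L : pred 'I_K) :
  depends_on L f -> depends_on (predC L) g ->
  rep u (fun s => f s * g s) = rep u f * rep u g.
Proof.
move=> fL gL.
pose mix s s' : rstate := [ffun l => if L l then s l else s' l].
pose W (M : pred 'I_K) s := \prod_(l | M l) expR (u (s l)).
have WE s : rweight u s = W L s * W (predC L) s by rewrite /rweight (bigID L).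
have mixL s s' l : L l -> mix s s' l = s l by rewrite ffunE => ->.
have mixN s s' l : predC L l -> mix s s' l = s' l by rewrite ffunE => /negbTE ->.
have E := @sum_exchange _ _ mix (fun s => f s * W L s) (fun s => g s * W (predC L) s)
   (W L) (W (predC L)).
have {}E : (\sum_s f s * g s * rweight u s) * (\sum_s rweight u s) =
    (\sum_s f s * rweight u s) * (\sum_s g s * rweight u s).
  transitivity ((\sum_s f s * W L s * (g s * W (predC L) s)) *
     (\sum_s W L s * W (predC L) s)).
    congr (_ * _); apply: eq_bigr => s _; rewrite WE.
      exact: mulrACA.
    by [].
  rewrite E.
  - congr (_ * _); apply: eq_bigr => s _; rewrite WE.
      by rewrite mulrA.
    by rewrite mulrCA.
  - by move=> s s'; apply/ffunP => l; rewrite !ffunE; case: (L l).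
  - move=> s s'; congr (_ * _); first by apply: fL => l; exact: mixL.
    by apply: eq_bigr => l Ll; rewrite mixL.
  - by move=> s s'; apply: eq_bigr => l Ll; rewrite mixL.
  - move=> s s'; congr (_ * _); first by apply: gL => l; exact: mixN.
    by apply: eq_bigr => l Ll; rewrite mixN.
  - by move=> s s'; apply: eq_bigr => l Ll; rewrite mixN.
have Z0 := lt0r_neq0 (sum_rweight_gt0 u).
rewrite /rep mulrACA -E -mulrA; congr (_ * _).
by rewrite mulrA divff// mul1r.
Qed.

(* The derivative of an average over m replicas adds a fresh replica of index m
   with weight - m. *)
Definition kap (m : nat) (l : 'I_K) : R :=
  if (l < m)%N then 1 else if l == m :> nat then - m%:R else 0.

(** Replicas beyond those of [f] are independent of it and contribute no covariance. For each of the
    first [m], the product <f><h> equals <f h> with [h] read on the fresh replica [m], which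
    therefore collects the weight -m. *)
Lemma rep_kap u f (h : T -> R) (m : nat) : (m < K)%N ->
  depends_on (fun l => (l < m)%N) f ->
  rep u (fun s => f s * \sum_l kap m l * h (s l)) =
  rep u (fun s => f s * \sum_l h (s l)) - rep u f * rep u (fun s => \sum_l h (s l)).
Proof.
move=> mK fm.
transitivity (\sum_l (rep u (fun s => f s * h (s l)) - rep u f * rep u (fun s => h (s l)))); last first.
  rewrite sumrB -mulr_sumr -!rep_sum; congr (_ - _).
  by apply: eq_rep => s; rewrite mulr_sumr.
pose lm := Ordinal mK.
have hind (l : 'I_K) : (m <= l)%N -> rep u (fun s => f s * h (s l)) = rep u f * rep u (fun s => h (s l)).
  move=> ml; apply: rep_indep fm _ => s s' E.
  by rewrite E// /predC /= -leqNgt.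
have hsame (l l' : 'I_K) : rep u (fun s => h (s l)) = rep u (fun s => h (s l')).
  rewrite -(rep_perm _ _ (tperm l l')); apply: eq_rep => s.
  by rewrite ffunE tpermL.
transitivity (rep u (fun s => \sum_l kap m l * (f s * h (s l)))).
  by apply: eq_rep => s; rewrite mulr_sumr; apply: eq_bigr => l _; ring.
rewrite rep_sum (bigID (fun l : 'I_K => (l < m)%N))/= [RHS](bigID (fun l : 'I_K => (l < m)%N))/=.
rewrite [X in _ = _ + X]big1 ?addr0; last first.
  by move=> l; rewrite -leqNgt => ml; rewrite hind// subrr.
rewrite [X in _ + X = _](bigD1 lm) ?ltnn//= [X in _ + (_ + X)]big1 ?addr0; last first.
  move=> l /andP[]; rewrite -leqNgt => ml llm.
  rewrite /kap ltnNge ml /= ifN ?repZ ?mul0r//.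
rewrite sumrB; congr (_ + _).
  by apply: eq_bigr => l lm'; rewrite repZ /kap lm' mul1r.
rewrite repZ hind//= /kap ltnn eqxx mulNr; congr (- _).
rewrite (eq_bigr (fun=> rep u f * rep u (fun s => h (s lm)))); last first.
  by move=> l _; rewrite (hsame l lm).
rewrite sumr_const mulr_natl; congr (_ *+ _).
transitivity (\sum_(i < m) 1)%N; first by rewrite sum_nat_const card_ord muln1.
by rewrite (big_ord_widen _ (fun=> 1%N) (ltnW mK)) sum1_card.
Qed.

Lemma is_derive_rep_cov (u : R -> T -> R) (du : T -> R) f (x : R) :
  (forall t, is_derive x 1 (fun y => u y t) (du t)) ->
  is_derive x 1 (fun y => rep (u y) f)
    (rep (u x) (fun s => f s * \sum_l du (s l)) -
     rep (u x) f * rep (u x) (fun s => \sum_l du (s l))).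
Proof.
move=> Du.
pose dS s := \sum_l du (s l).
have Dw s : is_derive x 1 (fun y => rweight (u y) s) (dS s * rweight (u x) s).
  have -> : (fun y => rweight (u y) s) = expR \o (fun y => \sum_l u y (s l)).
    by apply/funext => y; rewrite /rweight /= expR_sum.
  rewrite mulrC /rweight -expR_sum.
  apply: is_derive1_comp; apply: is_derive_sumr => l _; exact: Du.
have DZ : is_derive x 1 (fun y => \sum_s rweight (u y) s) (\sum_s dS s * rweight (u x) s).
  exact: is_derive_sumr.
have DN : is_derive x 1 (fun y => \sum_s f s * rweight (u y) s)
   (\sum_s f s * (dS s * rweight (u x) s)).
  apply: is_derive_sumr => s _; exact: is_deriveZ.
have Z0 := lt0r_neq0 (sum_rweight_gt0 (u x)).
apply: is_derive_eq.
rewrite /rep /GRing.scale /=.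
rewrite [X in _ + _ * X](eq_bigr (fun s => f s * dS s * rweight (u x) s)) => [|s _]; last first.
  by rewrite mulrA.
by rewrite -/dS; field.
Qed.

Lemma is_derive_rep (u : R -> T -> R) (du : T -> R) f (x : R) (m : nat) :
  (m < K)%N -> depends_on (fun l => (l < m)%N) f ->
  (forall t, is_derive x 1 (fun y => u y t) (du t)) ->
  is_derive x 1 (fun y => rep (u y) f)
    (rep (u x) (fun s => f s * \sum_l kap m l * du (s l))).
Proof. by move=> mK fm Du; rewrite rep_kap//; exact: is_derive_rep_cov. Qed.

End Replicas.

(** * Interpolating Gaussian energies *)

Section Interpolation.
Context {R : realType} {T : finType} (t0 : T) {K : nat} {J : finType}.
Variables (act : pred J) (c : J -> R -> R) (dc : J -> R -> R) (cb : J -> R).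
Variables (alpha : J -> T -> R) (e de : R -> T -> R) (eb : T -> R).
Local Notation rstate := {ffun 'I_K -> T}.
Hypothesis Dc : forall k (x : R), is_derive x 1 (c k) (dc k x).
Hypothesis De : forall t (x : R), is_derive x 1 (e ^~ t) (de x t).
Hypothesis dcb : forall k x, `|dc k x| <= cb k.
Hypothesis deb : forall t x, `|de x t| <= eb t.

Definition genergy (th : R) (v : J -> R) (t : T) : R :=
  \sum_(k | act k) c k th * v k * alpha k t + e th t.

Definition dgenergy (th : R) (v : J -> R) (t : T) : R :=
  \sum_(k | act k) dc k th * v k * alpha k t + de th t.

Lemma measurable_rep_genergy th (f : rstate -> R) :
  measurable_fun setT (fun v : gvec act => rep (genergy th v) f).
Proof.
have mg t : measurable_fun setT (fun v : gvec act => genergy th v t).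
  rewrite (_ : (fun v => _) = (fun v : gvec act =>
      \sum_k (if act k then c k th * v k * alpha k t else 0) + e th t)); last first.
    by apply/funext => v; rewrite /genergy big_mkcond.
  apply: measurable_funD => //; apply: measurable_sum => k.
  case ak : (act k) => //; apply: measurable_funM => //; apply: measurable_funM => //.
  exact: measurable_coord.
have mw (s : rstate) : measurable_fun setT (fun v : gvec act => rweight (genergy th v) s).
  apply: measurable_prod => l _.
  by apply: measurableT_comp => //; exact: mg.
have mZ : measurable_fun setT (fun v : gvec act => \sum_(s : rstate) rweight (genergy th v) s).
  exact: measurable_sum.
apply: measurable_funM.
  apply: measurable_sum => s.
  by apply: measurable_funM => //; exact: mw.
(* The inverse of the positive partition function is written through exp and ln, so its
   measurability is that of a composition. *)
rewrite (_ : (fun v => _) = (fun v : gvec act => expR (- ln (\sum_(s : rstate) rweight (genergy th v) s)))); last first.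
  by apply/funext => v; rewrite expRN lnK// posrE (sum_rweight_gt0 t0).
apply: measurableT_comp => //; apply: measurableT_comp => //.
exact: measurableT_comp.
Qed.

Lemma is_derive_rep_genergy (th : R) v (f : rstate -> R) (m : nat) : (m < K)%N ->
  depends_on (fun l => (l < m)%N) f ->
  is_derive th 1 (fun y => rep (genergy y v) f)
    (rep (genergy th v) (fun s => f s * \sum_l kap m l * dgenergy th v (s l))).
Proof.
move=> mK fm; apply: is_derive_rep => // t.
rewrite /genergy /dgenergy; apply: is_deriveD; apply: is_derive_sumr => k _.
rewrite (_ : (fun y => _) = (fun y => (v k * alpha k t) * c k y)); last first.
  by apply/funext => y; ring.
rewrite (_ : dc k th * _ * _ = (v k * alpha k t) *: dc k th); last by rewrite /GRing.scale /=; ring.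
exact: is_deriveZ.
Qed.

Lemma is_derive_genergy_coord th v t (k : J) (x : R) : act k ->
  is_derive x 1 (fun y => genergy th (upd k v y) t) (c k th * alpha k t).
Proof.
move=> ak.
rewrite /genergy; under eq_fun do rewrite (bigD1 k)//= {1}/upd eqxx -addrA.
rewrite -[X in is_derive _ _ _ X]addr0; apply: is_deriveD.
  rewrite (_ : (fun y => _) = (fun y => (c k th * alpha k t) * y)); last first.
    by apply/funext => y; ring.
  by apply: is_derive_eq; rewrite /GRing.scale /= mulr1.
rewrite (_ : (fun y => _) = cst (\sum_(i | act i && (i != k)) c i th * v i * alpha i t + e th t)).
  exact: is_derive_cst.
apply/funext => y /=; congr (_ + _); apply: eq_bigr => j /andP[_ /negbTE jk].
by rewrite /upd jk.
Qed.

Lemma is_derive_rep_coord th v (f : rstate -> R) (m : nat) (k : J) (x : R) :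
  act k -> (m < K)%N -> depends_on (fun l => (l < m)%N) f ->
  is_derive x 1 (fun y => rep (genergy th (upd k v y)) f)
    (rep (genergy th (upd k v x)) (fun s => f s * \sum_l kap m l * (c k th * alpha k (s l)))).
Proof.
move=> ak mK fm.
apply: (is_derive_rep t0 (u := fun y => genergy th (upd k v y))
  (du := fun t => c k th * alpha k t) mK fm) => t.
exact: is_derive_genergy_coord.
Qed.

Lemma continuous_rep_coord th v (f : rstate -> R) (k : J) : act k ->
  continuous (fun y : R => rep (genergy th (upd k v y)) f).
Proof.
move=> ak x; apply/differentiable_continuous/derivable1_diffP.
by have [] := is_derive_rep_cov t0 f (fun t => is_derive_genergy_coord th v t x ak).
Qed.

Context d (Omega : measurableType d) (Q : probability Omega R) (X : J -> Omega -> R).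
Hypothesis iX : iid_gauss act Q X.

Implicit Types (f g : rstate -> R).

Definition Erep (th : R) (f : rstate -> R) : R :=
  Rintegral Q setT (fun w => rep (genergy th (X^~ w)) f).

Lemma measurable_rep_family th f :
  measurable_fun setT (fun w => rep (genergy th (X^~ w)) f).
Proof.
exact: (measurableT_comp (measurable_rep_genergy th f) (measurable_family iX.1)).
Qed.

Lemma le_sum_norm (f : rstate -> R) s : `|f s| <= \sum_s `|f s|.
Proof. by rewrite (bigD1 s)//= lerDl sumr_ge0. Qed.

Lemma integrable_rep th f :
  Q.-integrable setT (EFin \o (fun w => rep (genergy th (X^~ w)) f)).
Proof.
apply: (@le_integrable _ _ _ Q setT measurableT _
    (EFin \o cst (\sum_s `|f s|))) => //=.
- exact/measurable_EFinP/measurable_rep_family.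
- move=> w _; rewrite lee_fin [leRHS]ger0_norm ?sumr_ge0//.
  exact: rep_bounded (le_sum_norm f).
- exact: finite_measure_integrable_cst.
Qed.

Lemma ErepD th f g : Erep th (fun s => f s + g s) = Erep th f + Erep th g.
Proof.
rewrite /Erep; under eq_Rintegral do rewrite repD.
by rewrite RintegralD//; exact: integrable_rep.
Qed.

Lemma ErepZ th a f : Erep th (fun s => a * f s) = a * Erep th f.
Proof.
rewrite /Erep; under eq_Rintegral do rewrite repZ.
by rewrite RintegralZl//; exact: integrable_rep.
Qed.

Lemma eq_Erep th f g : f =1 g -> Erep th f = Erep th g.
Proof. by move=> /funext ->. Qed.

Lemma Erep_cst th a : Erep th (fun=> a) = a.
Proof.
rewrite /Erep; under eq_Rintegral do rewrite (rep_cst t0).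
rewrite Rintegral_cst// -[RHS]mulr1; congr (_ * _).
exact: (congr1 fine (probability_setT Q)).
Qed.

Lemma Erep_sum th (I : Type) (r : seq I) (P : pred I) (F : I -> rstate -> R) :
  Erep th (fun s => \sum_(i <- r | P i) F i s) = \sum_(i <- r | P i) Erep th (F i).
Proof.
elim: r => [|i r IH].
  by rewrite big_nil -[RHS](Erep_cst th 0); apply: eq_Erep => s; rewrite big_nil.
rewrite big_cons -IH; case Pi : (P i).
  by rewrite -ErepD; apply: eq_Erep => s; rewrite big_cons Pi.
by apply: eq_Erep => s; rewrite big_cons Pi.
Qed.

Lemma le_Erep th f g : (forall s, f s <= g s) -> Erep th f <= Erep th g.
Proof.
move=> fg; apply: le_Rintegral => //; [exact: integrable_rep..|].
by move=> w _; apply: le_rep.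
Qed.

Lemma Erep_perm th f (p : {perm 'I_K}) :
  Erep th (fun s => f [ffun l => s (p l)]) = Erep th f.
Proof. by rewrite /Erep; under eq_Rintegral do rewrite rep_perm. Qed.

Lemma Erep_ibp th (k : J) (f : rstate -> R) (m : nat) : act k -> (m < K)%N ->
  depends_on (fun l => (l < m)%N) f ->
  Rintegral Q setT (fun w => X k w * rep (genergy th (X^~ w)) f) =
  c k th * Erep th (fun s => f s * \sum_l kap m l * alpha k (s l)).
Proof.
move=> ak mK fm.
pose f' (s : rstate) := f s * \sum_l kap m l * (c k th * alpha k (s l)).
have bf (g : rstate -> R) v : \sum_s `|g s| <= Num.max (\sum_s `|f s|) (\sum_s `|f' s|) ->
    `|rep (genergy th v) g| <= Num.max (\sum_s `|f s|) (\sum_s `|f' s|).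
  by apply: le_trans; apply: rep_bounded => // s; exact: le_sum_norm.
rewrite (gauss_ibp_family ak iX (measurable_rep_genergy th f)
  (measurable_rep_genergy th f') (fun v x => is_derive_rep_coord th v x ak mK fm)
  (fun v => @continuous_rep_coord th v f' k ak)
  (fun v => bf f v _) (fun v => bf f' v _)) ?le_max ?lexx ?orbT//.
rewrite -ErepZ; apply: eq_Erep => s; rewrite /f' mulrCA; congr (_ * _).
by rewrite mulr_sumr; apply: eq_bigr => l _; ring.
Qed.

Lemma integrable_sumr (I : Type) (r : seq I) (P : pred I) (h : I -> Omega -> R) :
  (forall i, P i -> Q.-integrable setT (EFin \o h i)) ->
  Q.-integrable setT (EFin \o (fun w => \sum_(i <- r | P i) h i w)).
Proof.
move=> ih; have := integrable_sum measurableT r ih.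
by apply: eq_integrable => // w _; rewrite /= sumEFin.
Qed.

Lemma Rintegral_sumr (I : Type) (r : seq I) (P : pred I) (h : I -> Omega -> R) :
  (forall i, P i -> Q.-integrable setT (EFin \o h i)) ->
  Rintegral Q setT (fun w => \sum_(i <- r | P i) h i w) =
  \sum_(i <- r | P i) Rintegral Q setT (h i).
Proof.
move=> ih; elim: r => [|i r IH].
  under eq_Rintegral do rewrite big_nil.
  by rewrite big_nil Rintegral_cst// mul0r.
under eq_Rintegral do rewrite big_cons.
rewrite big_cons -IH; case Pi : (P i) => //.
rewrite -RintegralD//; first exact: ih.
exact: integrable_sumr.
Qed.

Lemma integrableZr (a : R) (h : Omega -> R) :
  Q.-integrable setT (EFin \o h) -> Q.-integrable setT (EFin \o (fun w => a * h w)).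
Proof.
by move=> ih; have := integrableZl measurableT a ih; apply: eq_integrable.
Qed.

Lemma integrable_coord_rep th (k : J) f : act k ->
  Q.-integrable setT (EFin \o (fun w => X k w * rep (genergy th (X^~ w)) f)).
Proof.
move=> ak; have iXk := integrable_gauss ak iX.
apply: (@le_integrable _ _ _ Q setT measurableT _
    (EFin \o (fun w => (\sum_s `|f s|) * X k w))) => //=.
- apply/measurable_EFinP; apply: measurable_funM; first exact: iX.1.
  exact: measurable_rep_family.
- move=> w _; rewrite lee_fin [leLHS]normrM [leRHS]normrM mulrC ler_wpM2r//.
  rewrite [leRHS]ger0_norm ?sumr_ge0//.
  by apply: rep_bounded => // s; exact: le_sum_norm.
- exact: integrableZr.
Qed.

Lemma rep_dgenergy th v f m :
  rep (genergy th v) (fun s => f s * \sum_l kap m l * dgenergy th v (s l)) =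
  \sum_(k | act k) dc k th * (v k * rep (genergy th v) (fun s => f s * \sum_l kap m l * alpha k (s l)))
  + rep (genergy th v) (fun s => f s * \sum_l kap m l * de th (s l)).
Proof.
transitivity (rep (genergy th v) (fun s =>
   (\sum_(k | act k) (dc k th * v k) * (f s * \sum_l kap m l * alpha k (s l)))
   + f s * \sum_l kap m l * de th (s l))).
  apply: eq_rep => s; rewrite /dgenergy.
  under eq_bigr do rewrite mulrDr.
  rewrite big_split mulrDr/=; congr (_ + _).
  rewrite (eq_bigr (fun l => \sum_(k | act k) kap m l * (dc k th * v k * alpha k (s l)))); last first.
    by move=> l _; rewrite mulr_sumr.
  rewrite exchange_big mulr_sumr; apply: eq_bigr => k _.
  rewrite mulrCA; congr (_ * _); rewrite mulr_sumr; apply: eq_bigr => l _; ring.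
rewrite repD rep_sum; congr (_ + _); apply: eq_bigr => k _.
by rewrite repZ mulrA.
Qed.

Lemma is_derive_Erep (th : R) f (m : nat) : (m < K)%N ->
  depends_on (fun l => (l < m)%N) f ->
  is_derive th 1 (Erep ^~ f)
    (Rintegral Q setT (fun w => rep (genergy th (X^~ w))
        (fun s => f s * \sum_l kap m l * dgenergy th (X^~ w) (s l)))).
Proof.
move=> mK fm.
(* Dominating function, uniform in the angle: it is affine in the |X k|, which are integrable. *)
pose G (v : J -> R) := \sum_s `|f s| * \sum_l `|kap m l| *
   (\sum_(k | act k) cb k * `|alpha k (s l)| * `|v k| + eb (s l)).
have Ith : (`]th - 1, th + 1[%classic : set R) th by rewrite /= in_itv/=; apply/andP; split; lra.
have part x w : partial1of2 (fun y w => rep (genergy y (X^~ w)) f) x w =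
    rep (genergy x (X^~ w)) (fun s => f s * \sum_l kap m l * dgenergy x (X^~ w) (s l)).
  rewrite partial1of2E; have Dr := is_derive_rep_genergy x (X^~ w) mK fm.
  by case: Dr.
have cb0 k : 0 <= cb k := le_trans (normr_ge0 _) (dcb k 0).
have eb0 t : 0 <= eb t := le_trans (normr_ge0 _) (deb t 0).
have intf x : (`]th - 1, th + 1[%classic : set R) x ->
    Q.-integrable setT (EFin \o (fun w => rep (genergy x (X^~ w)) f)).
  by move=> _; exact: integrable_rep.
have derf x w : (`]th - 1, th + 1[%classic : set R) x -> [set: Omega] w ->
    derivable (fun y => rep (genergy y (X^~ w)) f) x 1.
  by move=> _ _; have [] := is_derive_rep_genergy x (X^~ w) mK fm.
have G0 w : 0 <= G (X^~ w).
  apply: sumr_ge0 => s _; rewrite mulr_ge0 ?sumr_ge0// => l _; rewrite mulr_ge0//.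
  by rewrite addr_ge0// sumr_ge0// => k _; rewrite !mulr_ge0.
have iG : Q.-integrable setT (EFin \o (fun w => G (X^~ w))).
  apply: integrable_sumr => s _; apply: integrableZr.
  apply: integrable_sumr => l _; apply: integrableZr.
  have := integrableD measurableT (f := EFin \o (fun w => \sum_(k | act k) cb k * `|alpha k (s l)| * `|X k w|))
    (g := EFin \o cst (eb (s l))).
  apply; last exact: finite_measure_integrable_cst.
  apply: integrable_sumr => k ak; apply: integrableZr.
  by have := integrable_abse (integrable_gauss ak iX); apply: eq_integrable.
have Gub x w : (`]th - 1, th + 1[%classic : set R) x -> [set: Omega] w ->
    `|partial1of2 (fun y w => rep (genergy y (X^~ w)) f) x w| <= G (X^~ w).
  move=> _ _; rewrite part.
  apply: (le_trans (rep_bounded t0 _ (le_sum_norm _))).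
  apply: ler_sum => s _; rewrite normrM ler_wpM2l//.
  apply: (le_trans (ler_norm_sum _ _ _)); apply: ler_sum => l _.
  rewrite normrM ler_wpM2l//.
  apply: (le_trans (ler_normD _ _)); apply: lerD => //.
  apply: (le_trans (ler_norm_sum _ _ _)); apply: ler_sum => k _.
  by rewrite !normrM mulrAC ler_wpM2r// ler_wpM2r.
have D1 := derivable_under_integral measurableT Ith intf derf G0 iG Gub.
have D2 := differentiation_under_integral measurableT Ith intf derf G0 iG Gub.
apply: DeriveDef; first exact: D1.
rewrite -derive1E; apply: (etrans D2); apply: eq_Rintegral => w _.
exact: part.
Qed.

(** The derivative in the angle brings [kap m] and one fresh replica. The Gaussian variables left in
    it are removed by parts, acting on a function of [m.+1] replicas, which brings [kap m.+1]. *)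
Lemma is_derive_Erep_ibp (th : R) f (m : nat) : (m.+1 < K)%N ->
  depends_on (fun l => (l < m)%N) f ->
  is_derive th 1 (Erep ^~ f) (Erep th (fun s => f s *
    (\sum_l \sum_l' kap m l * kap m.+1 l' *
       (\sum_(k | act k) c k th * dc k th * alpha k (s l) * alpha k (s l')) +
     \sum_l kap m l * de th (s l)))).
Proof.
move=> mK fm; have Df := is_derive_Erep th (ltnW mK) fm.
apply: (is_derive_eq Df); under eq_Rintegral do rewrite rep_dgenergy.
rewrite RintegralD//; last 2 first.
- apply: integrable_sumr => k ak; apply: integrableZr; exact: integrable_coord_rep.
- exact: integrable_rep.
rewrite Rintegral_sumr; last first.
  by move=> k ak; apply: integrableZr; exact: integrable_coord_rep.
have f'm k : depends_on (fun l : 'I_K => (l < m.+1)%N) (fun s => f s * \sum_l kap m l * alpha k (s l)).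
  move=> s s' E; congr (_ * _); first by apply: fm => l lm; apply: E; exact: ltnW.
  apply: eq_bigr => l _; have [lm|ml] := leqP l m; first by rewrite E.
  by rewrite /kap ltnNge (ltnW ml) /= gtn_eqF// !mul0r.
transitivity (\sum_(k | act k) c k th * dc k th * Erep th (fun s => (f s *
     \sum_l kap m l * alpha k (s l)) * \sum_l' kap m.+1 l' * alpha k (s l'))
   + Erep th (fun s => f s * \sum_l kap m l * de th (s l))).
  congr (_ + _); apply: eq_bigr => k ak.
  rewrite RintegralZl//; last exact: integrable_coord_rep.
  by rewrite (Erep_ibp th ak mK (f'm k)); ring.
transitivity (Erep th (fun s => (\sum_(k | act k) c k th * dc k th * ((f s *
     \sum_l kap m l * alpha k (s l)) * \sum_l' kap m.+1 l' * alpha k (s l')))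
   + f s * \sum_l kap m l * de th (s l))).
  rewrite ErepD Erep_sum; congr (_ + _); apply: eq_bigr => k _.
  by rewrite ErepZ.
apply: eq_Erep => s; rewrite mulrDr; congr (_ + _).
transitivity (f s * \sum_(k | act k) c k th * dc k th *
   ((\sum_l kap m l * alpha k (s l)) * (\sum_l' kap m.+1 l' * alpha k (s l')))).
  by rewrite mulr_sumr; apply: eq_bigr => k _; ring.
congr (_ * _); under eq_bigr do rewrite big_distrlr mulr_sumr.
rewrite exchange_big; apply: eq_bigr => l _ /=.
under eq_bigr do rewrite mulr_sumr.
rewrite exchange_big; apply: eq_bigr => l' _ /=.
by rewrite mulr_sumr; apply: eq_bigr => k _; ring.
Qed.

End Interpolation.

(** * The cavity interpolation *)

Section CavityModel.
Context {R : realType} {S N : nat}.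
Variables (beta h D p q : R).
Local Notation cfg := (config S N).
Local Notation sg := (@sv R S N).
Local Notation rstate := {ffun 'I_8 -> cfg}.

(* [None] is the auxiliary Gaussian. *)
Definition disorder_index := option ('I_N * 'I_N).

Definition active : pred disorder_index :=
  fun k => if k is Some ij then (ij.1 < ij.2)%N else true.

Definition touches (i : 'I_N) (ij : 'I_N * 'I_N) := (ij.1 == i) || (ij.2 == i).

Definition cav_coef (i : 'I_N) (k : disorder_index) (th : R) : R :=
  match k with
  | None => beta * Num.sqrt q * cos th
  | Some ij => beta / Num.sqrt N%:R * (if touches i ij then sin th else 1)
  end.

Definition dcav_coef (i : 'I_N) (k : disorder_index) (th : R) : R :=
  match k with
  | None => beta * Num.sqrt q * - sin th
  | Some ij => beta / Num.sqrt N%:R * (if touches i ij then cos th else 0)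
  end.

Definition cav_alpha (i : 'I_N) (k : disorder_index) (t : cfg) : R :=
  match k with
  | None => sg t i
  | Some ij => sg t ij.1 * sg t ij.2
  end.

(** The last term adds p - q on the diagonal of the mean-field covariance, so that self-overlaps end
    up compared with [p] and not with [q]. *)
Definition cav_field (i : 'I_N) (th : R) (t : cfg) : R :=
  D * (\sum_j sg t j ^+ 2) + h * (\sum_j sg t j)
  + cos th ^+ 2 * (beta ^+ 2 / 2 * (p - q) * sg t i ^+ 2).

Definition dcav_field (i : 'I_N) (th : R) (t : cfg) : R :=
  - (2 * (sin th * cos th)) * (beta ^+ 2 / 2 * (p - q) * sg t i ^+ 2).

Definition cav_energy (i : 'I_N) : R -> (disorder_index -> R) -> cfg -> R :=
  genergy active (cav_coef i) (cav_alpha i) (cav_field i).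

Definition ov (s : rstate) (l l' : 'I_8) : R :=
  N%:R^-1 * \sum_j sg (s l) j * sg (s l') j.

Definition Qc (l l' : 'I_8) (s : rstate) : R :=
  ov s l l' - (if l == l' then p else q).

(** With site [i] left out of the sum, this is independent of the spins at [i] at angle 0. *)
Definition Qm (i : 'I_N) (l l' : 'I_8) (s : rstate) : R :=
  Qc l l' s - N%:R^-1 * (sg (s l) i * sg (s l') i).

(** The derivative in the variable sin^2 th, hence without the factor 2 sin th cos th. *)
Definition Dop (i : 'I_N) (m : nat) (f : rstate -> R) (s : rstate) : R :=
  beta ^+ 2 / 2 * f s * \sum_l \sum_l' kap m l * kap m.+1 l' *
    (sg (s l) i * sg (s l') i * Qm i l l' s).

Lemma cfg0 : cfg.
Proof. exact: [ffun=> Ordinal (leq_trans (ltn0Sn _) (eq_leq (esym (addn1 (2 * S)))))]. Qed.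

Lemma is_derive_cav_coef i k (x : R) : is_derive x 1 (cav_coef i k) (dcav_coef i k x).
Proof.
rewrite /cav_coef /dcav_coef; case: k => [ij|]; last first.
  by apply: is_derive_eq; rewrite /GRing.scale /=; ring.
by case: ifP => _; apply: is_derive_eq; rewrite /GRing.scale /=; ring.
Qed.

Lemma is_derive_cav_field i t (x : R) :
  is_derive x 1 (cav_field i ^~ t) (dcav_field i x t).
Proof.
rewrite /cav_field /dcav_field.
by apply: is_derive_eq; rewrite /GRing.scale /=; ring.
Qed.

Definition cav_coef_bound (k : disorder_index) : R :=
  match k with
  | None => `|beta * Num.sqrt q|
  | Some ij => `|beta / Num.sqrt N%:R|
  end.

Lemma dcav_coef_le i k x : `|dcav_coef i k x| <= cav_coef_bound k.
Proof.
case: k => [ij|] /=; rewrite normrM ler_piMr//.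
  by case: ifP => _; rewrite ?normr0// ler_norml cos_geN1 cos_le1.
by rewrite normrN ler_norml sin_geN1 sin_le1.
Qed.

Lemma dcav_field_le i t x : `|dcav_field i x t| <= `|2 * (beta ^+ 2 / 2 * (p - q) * sg t i ^+ 2)|.
Proof.
have -> : dcav_field i x t =
    (2 * (beta ^+ 2 / 2 * (p - q) * sg t i ^+ 2)) * - (sin x * cos x).
  by rewrite /dcav_field; ring.
rewrite normrM ler_piMr// normrN normrM mulr_ile1//.
  by rewrite ler_norml sin_geN1 sin_le1.
by rewrite ler_norml cos_geN1 cos_le1.
Qed.

(** A pair containing [i] is determined by its other end j; the cases j > i and j < i together give
    every j other than [i]. *)
Lemma sum_touches (i : 'I_N) (F : 'I_N -> R) :
  \sum_(ij : 'I_N * 'I_N | (ij.1 < ij.2)%N && touches i ij) F ij.1 * F ij.2 =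
  F i * \sum_(j | j != i) F j.
Proof.
rewrite (bigID (fun ij => ij.1 == i))/=.
rewrite (bigID (fun j : 'I_N => (i < j)%N))/= mulrDr; congr (_ + _).
  rewrite mulr_sumr (reindex_onto (fun j => (i, j)) snd)/=; last first.
    by move=> [a b] /= /andP[_ /eqP ->].
  apply: eq_bigl => j; rewrite /touches /= eqxx /= !eqxx !andbT.
  have [ij|ij|/ord_inj ->] := ltngtP i j; rewrite ?andbF ?andbT ?eqxx//.
  by apply/esym/negP => /eqP E; rewrite E ltnn in ij.
rewrite mulr_sumr (reindex_onto (fun j => (j, i)) fst)/=; last first.
  move=> [a b] /= /andP[/andP[_ t] na]; move: t.
  by rewrite /touches /= (negbTE na) => /eqP ->.
apply: eq_big => [j|j _]; last exact: mulrC.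
rewrite /touches /= !eqxx orbT !andbT.
have [ij|ij|/ord_inj ->] := ltngtP i j; rewrite ?andbF ?andbT ?eqxx//.
Qed.

(** Bonds at [i] contribute sin cos times the overlap of the other sites, the auxiliary Gaussian
    contributes -sin cos times [q], and bonds away from [i] have constant coefficients. The opposite
    signs are what centers the overlap. *)
Lemma cav_covariance (i : 'I_N) (th : R) (s : rstate) (l l' : 'I_8) :
  0 <= q -> (0 < N)%N ->
  \sum_(k | active k) cav_coef i k th * dcav_coef i k th *
     cav_alpha i k (s l) * cav_alpha i k (s l') =
  sin th * cos th * beta ^+ 2 * (sg (s l) i * sg (s l') i) *
   (ov s l l' - N%:R^-1 * (sg (s l) i * sg (s l') i) - q).
Proof.
move=> q0 N0; have NR : N%:R != 0 :> R by rewrite pnatr_eq0 -lt0n.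
have sN : (Num.sqrt N%:R)^-1 ^+ 2 = N%:R^-1 :> R by rewrite exprVn sqr_sqrtr.
rewrite (bigD1 None)//= (reindex_omap Some id)/=; last by case.
pose F j := sg (s l) j * sg (s l') j.
rewrite (eq_bigl (fun ij : 'I_N * 'I_N => (ij.1 < ij.2)%N)); last first.
  by move=> ij /=; rewrite eqxx !andbT.
transitivity (- (sin th * cos th * beta ^+ 2 * q * F i) +
   sin th * cos th * beta ^+ 2 * N%:R^-1 *
   \sum_(ij : 'I_N * 'I_N | (ij.1 < ij.2)%N && touches i ij) F ij.1 * F ij.2).
  congr (_ + _).
    by rewrite -{3}(sqr_sqrtr q0) /F; ring.
  rewrite big_mkcondr mulr_sumr; apply: eq_bigr => ij _.
  case: ifP => _; last by rewrite !mulr0 !mul0r.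
  by rewrite -sN /F; ring.
rewrite sum_touches /ov [in RHS](bigD1 i)//= -/(F i).
set A := \sum_(j < N | _) _.
by field.
Qed.

End CavityModel.

Section CavityMeasure.
Context {R : realType} {S N : nat}.
Variables (beta h D p q : R).
Local Notation cfg := (config S N).
Local Notation sg := (@sv R S N).
Local Notation rstate := {ffun 'I_8 -> cfg}.
Hypothesis (q_ge0 : 0 <= q) (N_gt0 : (0 < N)%N).
Context {d} {Omega : measurableType d} (Q : probability Omega R)
  (X : @disorder_index N -> Omega -> R).
Hypothesis iX : iid_gauss active Q X.
Implicit Types (f g : rstate -> R) (th : R) (i : 'I_N).

Definition cav i th f : R :=
  Erep active (cav_coef beta q i) (cav_alpha i) (cav_field beta h D p q i) Q X th f.

Lemma cavD i th f g : cav i th (fun s => f s + g s) = cav i th f + cav i th g.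
Proof. exact: (ErepD cfg0 _ _ _ iX). Qed.

Lemma cavZ i th a f : cav i th (fun s => a * f s) = a * cav i th f.
Proof. exact: (ErepZ cfg0 _ _ _ iX). Qed.

Lemma cav_cst i th a : cav i th (fun=> a) = a.
Proof. by apply: Erep_cst; exact: cfg0. Qed.

Lemma cav_sum i th (I : Type) (r : seq I) (P : pred I) (F : I -> rstate -> R) :
  cav i th (fun s => \sum_(k <- r | P k) F k s) = \sum_(k <- r | P k) cav i th (F k).
Proof. exact: (Erep_sum cfg0 _ _ _ iX). Qed.

Lemma le_cav i th f g : (forall s, f s <= g s) -> cav i th f <= cav i th g.
Proof. exact: (le_Erep cfg0 _ _ _ iX). Qed.

Lemma cav_perm i th f (pi : {perm 'I_8}) :
  cav i th (fun s => f [ffun l => s (pi l)]) = cav i th f.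
Proof. exact: Erep_perm. Qed.

Lemma eq_cav i th f g : f =1 g -> cav i th f = cav i th g.
Proof. by move=> /funext ->. Qed.

Lemma is_derive_cav i (th : R) f m : (m.+1 < 8)%N ->
  depends_on (fun l => (l < m)%N) f ->
  is_derive th 1 (cav i ^~ f)
    (2 * (sin th * cos th) * cav i th (Dop beta p q i m f)).
Proof.
move=> mK fm.
have De := @is_derive_cav_field R S N beta h D p q i.
have Dc := @is_derive_cav_coef R N beta q i.
have dcb := @dcav_coef_le R N beta q i.
have deb t x := @dcav_field_le R S N beta p q i t x.
have := is_derive_Erep_ibp (@cfg0 S N) (@cav_alpha R S N i) Dc De dcb deb iX th mK fm.
move=> H; apply: (is_derive_eq H) => {H Dc De dcb deb}.
rewrite -cavZ; apply: eq_cav => s.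
rewrite /Dop !mulrA [_ * f s]mulrC -!mulrA; congr (_ * _).
(* For l <= m one has kap m.+1 l = 1, and beyond [m] the factor kap m l vanishes, so the field term
   is the diagonal of the double sum; there it turns the centering [q] into [p]. *)
have -> : \sum_l kap m l * dcav_field beta p q i th (s l) =
  \sum_l \sum_(l' | l' == l) - (2 * (sin th * cos th) * (beta ^+ 2 / 2)) *
    (kap m l * kap m.+1 l' * (sg (s l) i * sg (s l') i * (p - q))).
  apply: eq_bigr => l _; rewrite big_pred1_eq /dcav_field /kap.
  have [lm|ml|->] := ltngtP l m.
  - by rewrite ltnS (ltnW lm); ring.
  - by ring.
  - by rewrite ltnSn; ring.
rewrite -big_split/= !mulr_sumr; apply: eq_bigr => l _.
rewrite [X in _ + X = _]big_mkcond -big_split/= !mulr_sumr; apply: eq_bigr => l' _.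
rewrite cav_covariance// /Qm /Qc [l' == l]eq_sym.
by case: (l == l'); field; rewrite pnatr_eq0 -lt0n.
Qed.

End CavityMeasure.

(** * Factorization at angle zero *)

Section Independence.
Context {R : realType} {J : finType}.
Local Notation gam := (normal_prob (0 : R) 1).

Lemma integrable_bounded d (Om : measurableType d) (Q : probability Om R)
    (G : Om -> R) (B : R) :
  measurable_fun setT G -> (forall w, `|G w| <= B) ->
  Q.-integrable setT (EFin \o G).
Proof.
move=> mG BG.
apply: (@le_integrable _ _ _ Q setT measurableT _ (EFin \o cst B)) => //=.
- exact/measurable_EFinP.
- by move=> x _; rewrite lee_fin (le_trans (BG x))// ler_norm.
- exact: finite_measure_integrable_cst.
Qed.

(** In the product representation [A] is constant along the factor carrying coordinate [k], so the
    inner integral is [A] times the mean of [B]. *)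
Lemma Rintegral_indep (D : pred J) (k : J) d (Omega : measurableType d)
    (Q : probability Omega R) (X : J -> Omega -> R) (A : gvec D -> R)
    (B : R -> R) (cA cB : R) :
  D k -> iid_gauss D Q X ->
  measurable_fun setT A -> measurable_fun [set: R] B ->
  (forall v, `|A v| <= cA) -> (forall x, `|B x| <= cB) ->
  (forall v x, A (upd k v x) = A v) ->
  Rintegral Q setT (fun w => A (X^~ w) * B (X k w)) =
  Rintegral Q setT (fun w => A (X^~ w)) * Rintegral gam setT B.
Proof.
move=> Dk iX mA mB bA bB AE.
have iX' : iid_gauss (predD1 D k) Q X by exact: iid_gauss_predD1.
have iXu := iid_gauss_upd Dk iX'.
pose F (v : gvec D) := A v * B (v k).
have mF : measurable_fun setT F.
  apply: measurable_funM => //.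
  exact: (measurableT_comp mB (measurable_coord Dk)).
have bF v : `|F v| <= cA * cB by rewrite normrM ler_pM.
have iF d' (Om : measurableType d') (P : probability Om R) (Y : J -> Om -> R) :
    iid_gauss D P Y -> P.-integrable setT (EFin \o (fun w => F (Y^~ w))).
  move=> iY; apply: (integrable_bounded _ (B := cA * cB)) => //.
  exact: (measurableT_comp mF (measurable_family iY.1)).
rewrite (iid_gauss_Rintegral iX iXu mF (iF _ _ _ _ iX) (iF _ _ _ _ iXu)).
have iA : Q.-integrable setT (EFin \o (fun w => A (X^~ w))).
  apply: (integrable_bounded _ (B := cA)) => //.
  exact: (measurableT_comp mA (measurable_family iX.1)).
have iB : gam.-integrable setT (EFin \o B) by apply: (integrable_bounded _ (B := cB)).
rewrite -RintegralZr// /Rintegral; congr fine.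
apply: (etrans (esym (integral12_prod_meas1 (iF _ _ _ _ iXu)))).
apply: eq_integral => w _.
rewrite /fubini_F /F /=.
transitivity (\int[gam]_x ((A (X^~ w))%:E * (B x)%:E))%E.
  by apply: eq_integral => x _; rewrite AE {1}/upd eqxx EFinM.
rewrite integralZl// EFinM fineK//.
exact: integrable_fin_num.
Qed.
End Independence.

Section Decoupling.
Context {R : realType} {S N : nat}.
Variables (beta h D p q : R).
Local Notation cfg := (config S N).
Local Notation sg := (@sv R S N).
Local Notation rstate := {ffun 'I_8 -> cfg}.
Local Notation gam := (normal_prob (0 : R) 1).
Context {d} {Omega : measurableType d} (Q : probability Omega R)
  (X : @disorder_index N -> Omega -> R).
Hypothesis iX : iid_gauss active Q X.
Implicit Types (f g phi : rstate -> R) (th : R) (i : 'I_N).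
Local Notation cav := (cav beta h D p q Q X).
Local Notation cav_energy := (@cav_energy R S N beta h D p q).

Definition site_mix i (t t' : cfg) : cfg := [ffun j => if j == i then t' j else t j].

Definition rsite_mix i (s s' : rstate) : rstate := [ffun l => site_mix i (s l) (s' l)].

(** Dependence on the spins away from [i] only, phrased as an invariance so that it fits the
    hypotheses of [sum_exchange]. *)
Definition off_site i f := forall s s', f (rsite_mix i s s') = f s.
Definition on_site i f := forall s s', f (rsite_mix i s s') = f s'.

Definition off_energy i (v : disorder_index -> R) (t : cfg) : R :=
  \sum_(ij : 'I_N * 'I_N | (ij.1 < ij.2)%N && ~~ touches i ij)
    beta / Num.sqrt N%:R * v (Some ij) * (sg t ij.1 * sg t ij.2)
  + D * (\sum_(j | j != i) sg t j ^+ 2) + h * (\sum_(j | j != i) sg t j).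

Definition on_energy (x : R) (r : R) : R :=
  beta * Num.sqrt q * x * r + h * r + (D + beta ^+ 2 / 2 * (p - q)) * r ^+ 2.

Lemma cav_energy0 i v t :
  cav_energy i 0 v t = off_energy i v t + on_energy (v None) (sg t i).
Proof.
rewrite /cav_energy /genergy (bigD1 None)//= (reindex_omap Some id)/=; last by case.
rewrite (eq_bigl (fun ij : 'I_N * 'I_N => (ij.1 < ij.2)%N)); last first.
  by move=> ij /=; rewrite eqxx !andbT.
rewrite (bigID (touches i))/= big1 ?add0r; last first.
  by move=> ij /andP[_ ->]; rewrite sin0 mulr0 !mul0r.
rewrite /off_energy /on_energy /cav_field cos0.
rewrite [in LHS](bigD1 i)//= [X in _ + (_ + h * X + _)](bigD1 i)//=.
rewrite (eq_bigr (fun ij => beta / Num.sqrt N%:R * v (Some ij) * (sg t ij.1 * sg t ij.2))); last first.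
  by move=> ij /andP[_ /negbTE ->]; rewrite mulr1.
by ring.
Qed.

Lemma site_mixK i (t t' : cfg) : site_mix i (site_mix i t t') (site_mix i t' t) = t.
Proof. by apply/ffunP => j; rewrite !ffunE; case: (j == i). Qed.

Lemma rsite_mixK i (s s' : rstate) : rsite_mix i (rsite_mix i s s') (rsite_mix i s' s) = s.
Proof. by apply/ffunP => l; rewrite !ffunE site_mixK. Qed.

Lemma sv_site_mix i t t' j : sg (site_mix i t t') j = if j == i then sg t' j else sg t j.
Proof. by rewrite /sv ffunE; case: (j == i). Qed.

Lemma off_energy_mix i v t t' : off_energy i v (site_mix i t t') = off_energy i v t.
Proof.
rewrite /off_energy; congr (_ + _ * _ + _ * _).
- apply: eq_bigr => ij /andP[_]; rewrite /touches negb_or => /andP[/negbTE e1 /negbTE e2].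
  by rewrite !sv_site_mix e1 e2.
- by apply: eq_bigr => j /negbTE ji; rewrite sv_site_mix ji.
- by apply: eq_bigr => j /negbTE ji; rewrite sv_site_mix ji.
Qed.

Let Woff i v (s : rstate) := \prod_(l < 8) expR (off_energy i v (s l)).
Let Won i x (s : rstate) := \prod_(l < 8) expR (on_energy x (sg (s l) i)).

Let rweight0 i v (s : rstate) : rweight (cav_energy i 0 v) s = Woff i v s * Won i (v None) s.
Proof.
rewrite /rweight /Woff /Won -big_split; apply: eq_bigr => l _.
by rewrite cav_energy0 expRD.
Qed.

Let Woff_mix i v : off_site i (Woff i v).
Proof. by move=> s s'; apply: eq_bigr => l _; rewrite ffunE off_energy_mix. Qed.

Let Won_mix i x : on_site i (Won i x).
Proof. by move=> s s'; apply: eq_bigr => l _; rewrite ffunE sv_site_mix eqxx. Qed.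

Let frac_eq (a b c e : R) : b != 0 -> e != 0 -> a * e = c * b -> a / b = c / e.
Proof. by move=> b0 e0 E; apply/eqP; rewrite eqr_div// E. Qed.

(** The weight at site [i] can be exchanged between the two disorders by [sum_exchange]; the ratio
    that remains depends on the bonds away from [i]. *)
Lemma rep0_off i v v' f : (forall ij, v (Some ij) = v' (Some ij)) ->
  off_site i f -> rep (cav_energy i 0 v) f = rep (cav_energy i 0 v') f.
Proof.
move=> vv' fi; rewrite /rep; apply: frac_eq; rewrite ?gt_eqF ?(sum_rweight_gt0 cfg0)//.
have WE s : Woff i v s = Woff i v' s.
  apply: eq_bigr => l _; congr expR; rewrite /off_energy; congr (_ + _ + _).
  by apply: eq_bigr => ij _; rewrite vv'.
have := @sum_exchange _ _ (rsite_mix i) (fun s => f s * Woff i v s) (Won i (v None))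
  (Woff i v) (Won i (v' None)).
move=> /(_ (rsite_mixK i)) E.
have {}E := E _ (Woff_mix i v) (Won_mix i (v None)) (Won_mix i (v' None)).
transitivity ((\sum_s f s * Woff i v s * Won i (v None) s) *
   (\sum_s Woff i v s * Won i (v' None) s)).
  by congr (_ * _); apply: eq_bigr => s _; rewrite rweight0 ?WE ?mulrA.
rewrite E; last by move=> s s'; rewrite fi Woff_mix.
by congr (_ * _); apply: eq_bigr => s _; rewrite rweight0 ?WE ?mulrA.
Qed.

Lemma rep0_on i v v' phi : v None = v' None ->
  on_site i phi -> rep (cav_energy i 0 v) phi = rep (cav_energy i 0 v') phi.
Proof.
move=> vv' fi; rewrite /rep; apply: frac_eq; rewrite ?gt_eqF ?(sum_rweight_gt0 cfg0)//.
have := @sum_exchange _ _ (rsite_mix i) (Woff i v) (fun s => phi s * Won i (v None) s)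
  (Woff i v') (Won i (v None)).
move=> /(_ (rsite_mixK i) (Woff_mix i v) (Woff_mix i v')) E.
transitivity ((\sum_s Woff i v s * (phi s * Won i (v None) s)) *
   (\sum_s Woff i v' s * Won i (v None) s)).
  by congr (_ * _); apply: eq_bigr => s _; rewrite rweight0 -?vv'// mulrCA.
rewrite E; [|by move=> s s'; rewrite fi Won_mix|exact: Won_mix].
rewrite mulrC; congr (_ * _); apply: eq_bigr => s _; rewrite rweight0 -?vv'//.
by rewrite mulrCA.
Qed.

Lemma rep0_mul i v f phi : off_site i f -> on_site i phi ->
  rep (cav_energy i 0 v) (fun s => f s * phi s) =
  rep (cav_energy i 0 v) f * rep (cav_energy i 0 v) phi.
Proof.
move=> fi pi.
have Z0 := lt0r_neq0 (sum_rweight_gt0 (K := 8) cfg0 (cav_energy i 0 v)).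
rewrite /rep mulf_div; apply: frac_eq; rewrite ?mulf_neq0//.
have := @sum_exchange _ _ (rsite_mix i) (fun s => f s * Woff i v s) (fun s => phi s * Won i (v None) s)
  (Woff i v) (Won i (v None)).
move=> /(_ (rsite_mixK i)) E.
rewrite mulrA; congr (_ * _).
transitivity ((\sum_s f s * Woff i v s * (phi s * Won i (v None) s)) *
   (\sum_s Woff i v s * Won i (v None) s)).
  by congr (_ * _); apply: eq_bigr => s _; rewrite rweight0// mulrACA.
rewrite E; last first.
- exact: Won_mix.
- by move=> s s'; rewrite pi Won_mix.
- exact: Woff_mix.
- by move=> s s'; rewrite fi Woff_mix.
congr (_ * _); apply: eq_bigr => s _; rewrite rweight0.
  by rewrite mulrA.
by rewrite mulrCA.
Qed.

Let B i phi (x : R) := rep (cav_energy i 0 (upd None (fun=> 0) x)) phi.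

(** Two independences combine: for fixed disorder the Gibbs weight is a product over site [i] and
    the rest, and the two averages read disjoint coordinates, the auxiliary Gaussian for [phi] and
    the bonds for [f]. *)
Lemma cav0_mul i f phi : off_site i f -> on_site i phi ->
  cav i 0 (fun s => f s * phi s) = cav i 0 f * Rintegral gam setT (B i phi).
Proof.
move=> fi pi; rewrite /cav /Erep.
rewrite -(@Rintegral_indep _ _ active None _ _ Q X (fun v => rep (cav_energy i 0 v) f) (B i phi)
  (\sum_s `|f s|) (\sum_s `|phi s|))//.
- apply: eq_Rintegral => w _; rewrite rep0_mul//; congr (_ * _).
  by apply: rep0_on.
- exact: (@measurable_rep_genergy _ _ cfg0 _ _ active _ _ _ 0 f).
- apply: continuous_measurable_fun.
  exact: (@continuous_rep_coord _ _ cfg0 _ _ active _ _ _ 0 (fun=> 0) phi None).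
- by move=> v; apply: (rep_bounded cfg0) => s; exact: le_sum_norm.
- by move=> x; apply: (rep_bounded cfg0) => s; exact: le_sum_norm.
- by move=> v x; apply: rep0_off.
Qed.

Lemma cav0_on i phi : on_site i phi -> cav i 0 phi = Rintegral gam setT (B i phi).
Proof.
move=> pi; have := @cav0_mul i (fun=> 1) phi (fun _ _ => erefl) pi.
rewrite cav_cst mul1r => <-.
by apply: eq_cav => s; rewrite mul1r.
Qed.

Lemma cav0_indep i f phi : off_site i f -> on_site i phi ->
  cav i 0 (fun s => f s * phi s) = cav i 0 f * cav i 0 phi.
Proof. by move=> fi pi; rewrite cav0_mul// (cav0_on pi). Qed.

(** The constant counts the configurations of the other sites; it cancels in every Gibbs ratio. *)
Lemma sum_site i : exists2 c : R, 0 < c &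
  forall G : 'I_(2 * S + 1) -> R, \sum_(t : cfg) G (t i) = (\sum_k G k) * c.
Proof.
exists (\prod_(j < N | j != i) \sum_(k < 2 * S + 1) 1).
  by apply: prodr_gt0 => j _; rewrite sumr_const card_ord pmulrn_lgt0// addn1.
move=> G; pose H (j : 'I_N) k := if j == i then G k else 1.
transitivity (\sum_(t : cfg) \prod_j H j (t j)).
  apply: eq_bigr => t _; rewrite (bigD1 i)//= {1}/H eqxx big1 ?mulr1// => j /negbTE ji.
  by rewrite /H ji.
rewrite -(bigA_distr_bigA H) (bigD1 i)//=; congr (_ * _).
  by apply: eq_bigr => k _; rewrite /H eqxx.
by apply: eq_bigr => j /negbTE ji; apply: eq_bigr => k _; rewrite /H ji.
Qed.

Lemma gibbs_site i v (psi : R -> R) :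
  (\sum_(t : cfg) psi (sg t i) * expR (cav_energy i 0 v t)) /
  (\sum_(t : cfg) expR (cav_energy i 0 v t)) =
  avg_eta S beta h D p q (v None) psi.
Proof.
have [c c0 sumE] := sum_site i.
pose on t := expR (on_energy (v None) (sg t i)).
pose off t := expR (off_energy i v t).
have onE t : expR (cav_energy i 0 v t) = off t * on t by rewrite cav_energy0 expRD.
have on_mix t t' : on (site_mix i t t') = on t' by rewrite /on sv_site_mix eqxx.
have off_mix t t' : off (site_mix i t t') = off t by rewrite /off off_energy_mix.
(* Exchanging [off] with the constant weight 1 removes the other sites from the ratio. *)
have E := @sum_exchange _ _ (site_mix i) off (fun t => psi (sg t i) * on t) (fun=> 1) on
  (site_mixK i) off_mix (fun _ _ => erefl) _ on_mix.
have {}E : (\sum_t off t * (psi (sg t i) * on t)) * (\sum_(t : cfg) on t) =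
   (\sum_(t : cfg) psi (sg t i) * on t) * (\sum_(t : cfg) off t * on t).
  transitivity ((\sum_t off t * (psi (sg t i) * on t)) * (\sum_(t : cfg) 1 * on t)).
    by congr (_ * _); apply: eq_bigr => t _; rewrite mul1r.
  rewrite E => [|t t']; last by rewrite on_mix sv_site_mix eqxx.
  by rewrite mulrC; congr (_ * _); apply: eq_bigr => t _; rewrite mul1r.
have Eon := sumE (fun k => expR (on_energy (v None) (spin R k))).
have Epsi := sumE (fun k => psi (spin R k) * expR (on_energy (v None) (spin R k))).
have Z1 : 0 < \sum_(t : cfg) off t * on t.
  rewrite (bigD1 cfg0)//= ltr_wpDr ?mulr_gt0 ?expR_gt0//.
  by apply: sumr_ge0 => t _; rewrite mulr_ge0 ?expR_ge0.
have k0 : 'I_(2 * S + 1) := cfg0 i.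
have Z2 : 0 < \sum_(k < 2 * S + 1) expR (on_energy (v None) (spin R k)).
  rewrite (bigD1 k0)//= ltr_wpDr ?expR_gt0//.
  by apply: sumr_ge0 => t _; rewrite expR_ge0.
rewrite /avg_eta.
transitivity ((\sum_t off t * (psi (sg t i) * on t)) / (\sum_(t : cfg) off t * on t)).
  by congr (_ / _); apply: eq_bigr => t _; rewrite onE// mulrCA.
apply: frac_eq; rewrite ?gt_eqF//.
apply: (mulIf (lt0r_neq0 c0)).
by rewrite -mulrA -Eon E Epsi mulrAC.
Qed.

Lemma cav0_monomial i (e : 'I_8 -> nat) :
  cav i 0 (fun s => \prod_l sg (s l) i ^+ e l) =
  Eeta (fun x => \prod_l mj S beta h D p q (e l) x).
Proof.
rewrite cav0_on; last first.
  by move=> s s'; apply: eq_bigr => l _; rewrite ffunE sv_site_mix eqxx.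
rewrite /Eeta; apply: eq_Rintegral => x _; rewrite /B.
rewrite (rep_prod _ (fun l t => sg t i ^+ e l)); apply: eq_bigr => l _.
by rewrite (gibbs_site i _ (fun r => r ^+ e l)) /mj /upd eqxx.
Qed.

(** A weighted list of words stays under one expectation because [cD], [cF], [cG] and [cE] are
    expectations of differences: linearity is then used on the [cav] side, where integrability is
    already available. *)
Lemma cav0_words i (ws : seq (R * seq 'I_8)) :
  cav i 0 (fun s => \sum_(cw <- ws) cw.1 * \prod_(j <- cw.2) sg (s j) i) =
  Eeta (fun x => \sum_(cw <- ws) cw.1 * \prod_(l < 8) mj S beta h D p q (count_mem l cw.2) x).
Proof.
have wordE (w : seq 'I_8) (F : 'I_8 -> R) : \prod_(j <- w) F j = \prod_l F l ^+ count_mem l w.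
  elim: w => [|j w IH]; first by rewrite big_nil big1.
  rewrite big_cons IH (bigD1 j)//= [in RHS](bigD1 j)//= eqxx exprS mulrA; congr (_ * _).
  by apply: eq_bigr => l /negbTE lj; rewrite eq_sym lj.
rewrite cav0_on; last first.
  move=> s s'; apply: eq_bigr => cw _; congr (_ * _); apply: eq_bigr => l _.
  by rewrite ffunE sv_site_mix eqxx.
rewrite /Eeta; apply: eq_Rintegral => x _; rewrite /B rep_sum; apply: eq_bigr => cw _.
rewrite repZ; congr (_ * _).
rewrite (_ : (fun s => _) = (fun s : rstate => \prod_l sg (s l) i ^+ count_mem l cw.2)); last first.
  by apply/funext => s; exact: wordE.
rewrite (rep_prod _ (fun l t => sg t i ^+ count_mem l cw.2)); apply: eq_bigr => l _.
by rewrite (gibbs_site i _ (fun r => r ^+ count_mem l cw.2)) /mj /upd eqxx.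
Qed.

Lemma cav_energy_pihalf i (x : disorder_index -> R) :
  cav_energy i (pi / 2) x = @Ham R S N beta h D (fun ij => x (Some ij)).
Proof.
apply/funext => t.
rewrite /cav_energy /genergy (bigD1 None)//= (reindex_omap Some id)/=; last by case.
rewrite (eq_bigl (fun ij : 'I_N * 'I_N => (ij.1 < ij.2)%N)); last first.
  by move=> ij /=; rewrite eqxx !andbT.
rewrite /cav_field cos_pihalf sin_pihalf /Ham expr0n /= !mulr0 !mul0r add0r addr0.
rewrite addrA; congr (_ + _ + _); rewrite mulr_sumr; apply: eq_bigr => ij _.
by rewrite if_same mulr1; ring.
Qed.

Lemma cav_pihalf i f :
  cav i (pi / 2) f = Rintegral Q setT (fun w =>
    rep (@Ham R S N beta h D (fun ij => X (Some ij) w)) f).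
Proof. by apply: eq_Rintegral => w _; rewrite -(cav_energy_pihalf i (X^~ w)). Qed.

End Decoupling.

(** * A priori estimates *)

Section RealLemmas.
Context {R : realType}.

Lemma is_derive_continuous (u du : R -> R) : (forall x : R, is_derive x 1 u (du x)) ->
  continuous u.
Proof.
move=> Du x; apply/differentiable_continuous/derivable1_diffP.
by case: (Du x).
Qed.

Lemma is_derive_MVT (u du : R -> R) (x y : R) : x <= y ->
  (forall z : R, is_derive z 1 u (du z)) ->
  exists2 z, x <= z <= y & u y - u x = du z * (y - x).
Proof.
move=> xy Du; have [z zxy E] := @MVT_segment R u du x y xy (fun z _ => Du z)
   (continuous_subspaceT (is_derive_continuous Du)).
by exists z => //; move: zxy; rewrite in_itv.
Qed.

Lemma le_of_derive_ge0 (u du : R -> R) (x y : R) : x <= y ->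
  (forall z : R, is_derive z 1 u (du z)) ->
  (forall z, x <= z <= y -> 0 <= du z) -> u x <= u y.
Proof.
move=> xy Du du0; have [z zxy E] := is_derive_MVT xy Du.
by rewrite -subr_ge0 E mulr_ge0 ?subr_ge0// du0.
Qed.

Lemma norm_le_of_derive (u du : R -> R) (x y M : R) : x <= y ->
  (forall z : R, is_derive z 1 u (du z)) ->
  (forall z, x <= z <= y -> `|du z| <= M) -> `|u y - u x| <= M * (y - x).
Proof.
move=> xy Du duM; have [z zxy ->] := is_derive_MVT xy Du.
by rewrite normrM (ger0_norm (_ : 0 <= y - x)) ?subr_ge0// ler_wpM2r ?subr_ge0// duM.
Qed.

Lemma norm_sincos_le1 (x : R) : `|sin x * cos x| <= 1.
Proof.
rewrite normrM mulr_ile1// ler_norml; first by rewrite sin_geN1 sin_le1.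
by rewrite cos_geN1 cos_le1.
Qed.

End RealLemmas.

Lemma mj0 {R : realType} (S : nat) (beta h D p q x : R) : mj S beta h D p q 0 x = 1.
Proof.
rewrite /mj /avg_eta; under eq_bigr do rewrite expr0 mul1r.
rewrite divff// gt_eqF//.
have k0 : 'I_(2 * S + 1) := Ordinal (leq_trans (ltn0Sn _) (eq_leq (esym (addn1 (2 * S))))).
rewrite (bigD1 k0)//= ltr_wpDr ?expR_gt0//.
by apply: sumr_ge0 => t _; rewrite expR_ge0.
Qed.

(** Common bound for products of two spins, for overlaps, and for [p] and [q]. *)
Definition spin2 {R : realType} (S : nat) : R := S%:R ^+ 2.

Lemma spin2_ge0 {R : realType} (S : nat) : 0 <= spin2 S :> R.
Proof. exact: sqr_ge0. Qed.

Section CavityBounds.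
Context {R : realType} {S N : nat}.
Variables (beta h D p q : R).
Local Notation cfg := (config S N).
Local Notation sg := (@sv R S N).
Local Notation rstate := {ffun 'I_8 -> cfg}.
Context {d} {Omega : measurableType d} (Q : probability Omega R)
  (X : @disorder_index N -> Omega -> R).
Hypothesis iX : iid_gauss active Q X.
Local Notation a := (@spin2 R S).
Hypotheses (beta_ge0 : 0 <= beta) (beta_le1 : beta <= 1) (N_gt0 : (0 < N)%N).
Hypotheses (q_ge0 : 0 <= q) (q_le : q <= a) (p_ge0 : 0 <= p) (p_le : p <= a).
Implicit Types (f g phi : rstate -> R) (th : R) (i : 'I_N) (s : rstate) (t : cfg).
Local Notation cav := (cav beta h D p q Q X).
Local Notation Dop := (Dop beta p q).
Local Notation Qm := (Qm p q).
Local Notation Qc := (Qc p q).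

Lemma norm_sv t j : `|sg t j| <= S%:R.
Proof.
have tj : (t j <= 2 * S)%N by have := ltn_ord (t j); move: (nat_of_ord (t j)) => k; rewrite addn1 ltnS.
rewrite /sv /spin.
rewrite ler_norml; apply/andP; split.
  by rewrite lerBrDl subrr.
by rewrite lerBlDr -natrD addnn -mul2n ler_nat.
Qed.

Lemma norm_sv2 t j t' j' : `|sg t j * sg t' j'| <= a.
Proof. by rewrite normrM /spin2 expr2 ler_pM// norm_sv. Qed.

Lemma norm_ov s l l' : `|@ov R S N s l l'| <= a.
Proof.
rewrite /ov normrM ger0_norm ?invr_ge0// -[leRHS](@mulKf _ N%:R).
  rewrite ler_wpM2l ?invr_ge0//; apply: (le_trans (ler_norm_sum _ _ _)).
  apply: (le_trans (ler_sum _ (fun j _ => norm_sv2 _ j _ j))).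
  by rewrite sumr_const card_ord mulr_natl.
by rewrite pnatr_eq0 -lt0n.
Qed.

Lemma norm_Qc l l' s : `|Qc l l' s| <= 2 * a.
Proof.
have := norm_ov s l l'; rewrite /Qc !ler_norml => /andP[h1 h2].
move: p_ge0 q_ge0 p_le q_le => p0 q0 pa qa.
by case: ifP => _; apply/andP; split; lra.
Qed.

Lemma norm_self i s l l' : `|N%:R^-1 * (sg (s l) i * sg (s l') i)| <= a / N%:R.
Proof.
by rewrite normrM ger0_norm ?invr_ge0// mulrC ler_wpM2r ?invr_ge0// norm_sv2.
Qed.

Lemma Qm_Qc i l l' s : `|Qm i l l' s - Qc l l' s| <= a / N%:R.
Proof. by rewrite /Qm addrAC subrr add0r normrN norm_self. Qed.

Lemma norm_Qm i l l' s : `|Qm i l l' s| <= 3 * a.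
Proof.
have aN : a / N%:R <= a.
  by rewrite ler_piMr ?spin2_ge0// invf_le1 ?ltr0n// ler1n.
have := Qm_Qc i l l' s; have := norm_Qc l l' s.
rewrite !ler_norml => /andP[h1 h2] /andP[h3 h4].
by apply/andP; split; lra.
Qed.

Lemma norm_kap (m : nat) (l : 'I_8) : (m <= 8)%N -> `|kap (R := R) m l| <= 8.
Proof.
move=> m8; rewrite /kap; case: ifP => _; first by rewrite normr1; lra.
by case: ifP => _; rewrite ?normrN ?normr_nat ?normr0 ?(ler_nat R m 8).
Qed.

(** A single envelope for all overlaps: remainders are then controlled by its moments alone. *)
Definition sumQ i s : R := \sum_l \sum_l' `|Qm i l l' s|.

Lemma sumQ_ge0 i s : 0 <= sumQ i s.
Proof. by apply: sumr_ge0 => l _; apply: sumr_ge0. Qed.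

Lemma norm_Dop i m f s : (m.+1 <= 8)%N ->
  `|Dop i m f s| <= 32 * a * beta ^+ 2 * (`|f s| * sumQ i s).
Proof.
move=> m8; rewrite /Dop normrM (normrM (_ / _)) (normrM (_ ^+ 2)).
(* The two [kap] weights are at most 8 each, and the 1/2 in [Dop] turns 64 into 32. *)
have -> : 32 * a * beta ^+ 2 * (`|f s| * sumQ i s) =
   `|beta ^+ 2| * `|2^-1| * `|f s| * (64 * a * sumQ i s).
  by rewrite (ger0_norm (sqr_ge0 beta)) (ger0_norm (_ : 0 <= 2^-1 :> R))//; field.
rewrite ler_wpM2l ?mulr_ge0//.
apply: (le_trans (ler_norm_sum _ _ _)); rewrite /sumQ mulr_sumr; apply: ler_sum => l _.
apply: (le_trans (ler_norm_sum _ _ _)); rewrite mulr_sumr; apply: ler_sum => l' _.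
rewrite normrM [X in _ * X]normrM mulrA; apply: ler_wpM2r => //.
apply: ler_pM => //; last exact: norm_sv2.
rewrite normrM (_ : 64 = 8 * 8); last by ring.
by apply: ler_pM => //; apply: norm_kap => //; exact: ltnW.
Qed.

(** [norm_Dop] with beta <= 1 and [sumQ] bounded by 64 terms of size 3a. *)
Definition growth : R := 32 * a * (192 * a).

Lemma growth_ge0 : 0 <= growth.
Proof. by rewrite /growth !mulr_ge0 ?sqr_ge0. Qed.

Lemma norm_Dop_growth i m f s : (m.+1 <= 8)%N -> `|Dop i m f s| <= growth * `|f s|.
Proof.
move=> m8; apply: (le_trans (norm_Dop _ _ _ m8)).
have sQ : sumQ i s <= 192 * a.
  apply: (le_trans (ler_sum _ (fun l _ => ler_sum _ (fun l' _ => norm_Qm i l l' s)))).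
  rewrite !sumr_const card_ord -mulrnA -[X in X <= _]mulr_natl (_ : (8 * 8)%N = 64%N)//; lra.
have b1 : beta ^+ 2 <= 1 by rewrite expr_le1.
have -> : growth * `|f s| = 32 * a * 1 * (`|f s| * (192 * a)) by rewrite /growth; ring.
apply: ler_pM; rewrite ?mulr_ge0 ?sqr_ge0 ?spin2_ge0 ?sumQ_ge0//.
  by apply: ler_wpM2l => //; rewrite mulr_ge0 ?spin2_ge0.
by apply: ler_wpM2l.
Qed.

Lemma cav_ge0 i th f : (forall s, 0 <= f s) -> 0 <= cav i th f.
Proof. by move=> f0; rewrite -[leLHS](@cav_cst R S N beta h D p q _ _ Q X i th 0); apply: le_cav. Qed.

Lemma norm_cav i th f : `|cav i th f| <= cav i th (fun s => `|f s|).
Proof.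
rewrite ler_norml; apply/andP; split.
  rewrite lerNl -mulN1r -cavZ//; apply: le_cav => // s.
  by rewrite mulN1r -normrN ler_norm.
by apply: le_cav => // s; exact: ler_norm.
Qed.

Lemma norm_dcav i th f m : (m.+1 <= 8)%N ->
  `|2 * (sin th * cos th) * cav i th (Dop i m f)| <=
  2 * cav i th (fun s => `|Dop i m f s|).
Proof.
move=> m8; rewrite normrM ler_pM// ?norm_cav//.
by rewrite normrM ger0_norm// ler_piMr// norm_sincos_le1.
Qed.

Definition expgrowth : R := expR (4 * growth).

(** For f >= 0 the derivative of [cav] is at most 2 * growth times [cav] in absolute value, so cav *
    exp(2 * growth * th) is nondecreasing. Moments at every angle are thus controlled by the
    original model; pi/2 < 2 gives the exponent 4 * growth. *)
Lemma cav_gronwall i th f m : (m.+1 < 8)%N -> depends_on (fun l => (l < m)%N) f ->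
  (forall s, 0 <= f s) -> 0 <= th <= pi / 2 ->
  cav i th f <= expgrowth * cav i (pi / 2) f.
Proof.
move=> m8 fm f0 /andP[th0 thpi].
pose u x := cav i x f * expR (2 * growth * x).
pose du x := (2 * (sin x * cos x) * cav i x (Dop i m f) + 2 * growth * cav i x f)
   * expR (2 * growth * x).
have Du (x : R) : is_derive x 1 u (du x).
  have Df := is_derive_cav beta h D p q_ge0 N_gt0 iX i x m8 fm.
  rewrite /u /du; apply: is_derive_eq; rewrite /GRing.scale /=; ring.
have cg0 x : 0 <= cav i x f by exact: cav_ge0.
have : u th <= u (pi / 2).
  apply: (le_of_derive_ge0 thpi Du) => z _; rewrite mulr_ge0 ?expR_ge0//.
  have := norm_dcav i z f (ltnW m8); rewrite ler_norml => /andP[h1 _].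
  have : cav i z (fun s => `|Dop i m f s|) <= growth * cav i z f.
    rewrite -cavZ//; apply: le_cav => // s.
    by rewrite -[X in _ * X](ger0_norm (f0 s)); apply: norm_Dop_growth; exact: ltnW.
  move: (cg0 z) => h3 h2; lra.
rewrite /u => E; apply: (le_trans _ (le_trans E _)).
  rewrite ler_peMr// -expR0 ler_expR !mulr_ge0// growth_ge0//.
rewrite mulrC ler_wpM2r// ler_expR.
have := pihalf_lt2 R; have := growth_ge0; nra.
Qed.

Lemma cav_first_order i th f m M : (m.+1 < 8)%N ->
  depends_on (fun l => (l < m)%N) f -> 0 <= th <= pi / 2 ->
  (forall x, 0 <= x <= pi / 2 -> cav i x (fun s => `|Dop i m f s|) <= M) ->
  `|cav i th f - cav i 0 f| <= 4 * M.
Proof.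
move=> m8 fm /andP[th0 thpi] DM.
have M0 : 0 <= M.
  apply: le_trans (DM 0 _); first exact: cav_ge0.
  by rewrite lexx (le_trans th0).
have := norm_le_of_derive th0 (fun x => is_derive_cav beta h D p q_ge0 N_gt0 iX i x m8 fm)
  (M := 2 * M).
move=> /(_ _)/le_trans; apply.
  move=> z /andP[z0 zth]; apply: (le_trans (norm_dcav _ _ _ (ltnW m8))).
  by rewrite ler_wpM2l// DM// z0 (le_trans zth).
have := pihalf_lt2 R; nra.
Qed.

Lemma Dop_depends i m f : depends_on (fun l => (l < m)%N) f ->
  depends_on (fun l => (l < m.+2)%N) (Dop i m f).
Proof.
move=> fm s s' E; rewrite /Dop; congr (_ * _ * _).
  by apply: fm => l lm; apply: E; rewrite (leq_trans lm)// -addn2 leq_addr.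
apply: eq_bigr => l _; apply: eq_bigr => l' _.
have [lm|ml] := leqP l m; last first.
  by rewrite /kap ltnNge (ltnW ml) /= gtn_eqF// !mul0r.
have [lm'|ml'] := leqP l' m.+1; last first.
  by rewrite {2 4}/kap ltnNge (ltnW ml') /= gtn_eqF// mulr0 !mul0r.
by congr (_ * _); rewrite /Qm /Qc /ov !E// ltnS (leq_trans lm).
Qed.

(** Taylor's formula in sin^2 th: subtracting sin^2 x times the slope at 0 leaves a function whose
    derivative carries cav x (Dop f) - cav 0 (Dop f), to which [cav_first_order] applies. The
    constant is 2 * 4 * 2, the last factor bounding pi/2. *)
Lemma cav_second_order i f m M : (m.+3 < 8)%N ->
  depends_on (fun l => (l < m)%N) f ->
  (forall x, 0 <= x <= pi / 2 ->
     cav i x (fun s => `|Dop i m.+2 (Dop i m f) s|) <= M) ->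
  `|cav i (pi / 2) f - cav i 0 f - cav i 0 (Dop i m f)| <= 16 * M.
Proof.
move=> m8 fm DM.
have pi0 : 0 <= pi / 2 :> R by rewrite divr_ge0 ?pi_ge0.
have M0 : 0 <= M.
  apply: le_trans (DM 0 _); first exact: cav_ge0.
  by rewrite lexx pi0.
pose u x := cav i x f - sin x ^+ 2 * cav i 0 (Dop i m f).
pose du x := 2 * (sin x * cos x) * (cav i x (Dop i m f) - cav i 0 (Dop i m f)).
have Du (x : R) : is_derive x 1 u (du x).
  have Df := is_derive_cav beta h D p q_ge0 N_gt0 iX i x (ltn_trans (ltn_trans (ltnSn _) (ltnSn _)) m8) fm.
  rewrite /u /du; apply: is_derive_eq; rewrite /GRing.scale /=; ring.
have := norm_le_of_derive pi0 Du (M := 8 * M).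
rewrite /u sin0 sin_pihalf expr1n mul1r expr0n mul0r !subr0 addrAC => H.
apply: (le_trans (H _)).
  move=> z zpi; rewrite /du normrM.
  have -> : 8 * M = 2 * (4 * M) by ring.
  apply: ler_pM => //.
    by rewrite normrM ger0_norm// ler_piMr// norm_sincos_le1.
  exact: (cav_first_order m8 (@Dop_depends i _ _ fm) zpi DM).
have := pihalf_lt2 R; nra.
Qed.

End CavityBounds.

(** * Moments of the centered overlaps and the second-order expansion *)

Section PowerLemmas.
Context {R : realType}.

Lemma exprD_le (x y : R) k : 0 <= x -> 0 <= y ->
  (x + y) ^+ k <= 2 ^+ k * (x ^+ k + y ^+ k).
Proof.
move=> x0 y0; wlog xy : x y x0 y0 / x <= y.
  by move=> H; case/orP: (le_total x y) => ?; [|rewrite addrC [x ^+ k + _]addrC]; apply: H.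
apply: (@le_trans _ _ ((2 * y) ^+ k)).
  by rewrite lerXn2r ?nnegrE ?addr_ge0 ?mulr_ge0//; lra.
by rewrite exprMn ler_wpM2l ?exprn_ge0// lerDr exprn_ge0.
Qed.

Lemma expr_sum_le (I : finType) (x : I -> R) k : (forall i, 0 <= x i) ->
  (\sum_i x i) ^+ k.+1 <= #|I|%:R ^+ k.+1 * \sum_i x i ^+ k.+1.
Proof.
move=> x0; have [i0 _|I0] := pickP (@predT I); last first.
  rewrite !big1 ?expr0n ?mulr0// => i _; by have := I0 i.
have [j _ jmax] := arg_maxP x (erefl : predT i0).
apply: (@le_trans _ _ ((#|I|%:R * x j) ^+ k.+1)).
  rewrite lerXn2r ?nnegrE ?sumr_ge0 ?mulr_ge0//.
  apply: (le_trans (ler_sum _ (fun i _ => jmax i isT))).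
  by rewrite sumr_const mulr_natl.
rewrite exprMn ler_wpM2l ?exprn_ge0// (bigD1 j)//= lerDl.
by apply: sumr_ge0 => i _; rewrite exprn_ge0.
Qed.

End PowerLemmas.

Section Moments.
Context {R : realType} {S N : nat}.
Variables (beta h D p q : R).
Local Notation cfg := (config S N).
Local Notation sg := (@sv R S N).
Local Notation rstate := {ffun 'I_8 -> cfg}.
Context {d} {Omega : measurableType d} (Q : probability Omega R)
  (X : @disorder_index N -> Omega -> R).
Hypothesis iX : iid_gauss active Q X.
Local Notation a := (@spin2 R S).
Hypotheses (beta_ge0 : 0 <= beta) (beta_le1 : beta <= 1) (N_gt0 : (0 < N)%N).
Hypotheses (q_ge0 : 0 <= q) (q_le : q <= a) (p_ge0 : 0 <= p) (p_le : p <= a).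
Hypothesis fix_pq : fixed_point S beta h D p q.
Implicit Types (f g phi : rstate -> R) (th : R) (i : 'I_N) (s : rstate) (t : cfg) (l u v : 'I_8).
Local Notation cav := (cav beta h D p q Q X).
Local Notation Dop := (Dop beta p q).
Local Notation Qm := (Qm p q).
Local Notation Qc := (Qc p q).
Local Notation sumQ := (sumQ p q).
Local Notation expgrowth := (@expgrowth R S).

Definition o0 : 'I_8 := ord0.
Definition o1 : 'I_8 := Ordinal (isT : (1 < 8)%N).

Definition nu1 f : R := Rintegral Q setT (fun w =>
    rep (@Ham R S N beta h D (fun ij => X (Some ij) w)) f).

Lemma nu1E i f : cav i (pi / 2) f = nu1 f.
Proof. exact: cav_pihalf. Qed.

(** By symmetry among replicas, one self-overlap and one overlap control all pairs. The last term
    pays for the removal of site i, so that the same quantity bounds [Qc] and [Qm]. *)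
Definition mom (k : nat) : R :=
  nu1 (fun s => `|Qc o0 o0 s| ^+ k) + nu1 (fun s => `|Qc o0 o1 s| ^+ k) + (a / N%:R) ^+ k.

Let pi0 : 0 <= pi / 2 :> R. Proof. by rewrite divr_ge0 ?pi_ge0. Qed.
Let pihalf_in : 0 <= (pi / 2 : R) <= pi / 2. Proof. by rewrite lexx pi0. Qed.
Let aN0 : 0 <= a / N%:R :> R. Proof. by rewrite divr_ge0// spin2_ge0. Qed.
Let i0 : 'I_N := Ordinal N_gt0.

Lemma nu1_ge0 f : (forall s, 0 <= f s) -> 0 <= nu1 f.
Proof. by rewrite -(nu1E i0); exact: cav_ge0. Qed.

Lemma perm_pair u v : u != v -> {pm : {perm 'I_8} | pm o0 = u & pm o1 = v}.
Proof.
move=> uv; pose p1 := tperm o0 u.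
have p1u : p1 o0 = u by rewrite tpermL.
have xu : p1 o1 != u by rewrite -p1u (inj_eq perm_inj).
exists (p1 * tperm (p1 o1) v)%g; rewrite permM.
  by rewrite p1u tpermD// eq_sym.
by rewrite tpermL.
Qed.

Lemma cav_Qc_perm i th (F : R -> R) l l' (l1 := if l == l' then o0 else o1) :
  cav i th (fun s => F (Qc l l' s)) = cav i th (fun s => F (Qc o0 l1 s)).
Proof.
rewrite /l1; case: eqP => [<-|/eqP ll'].
  rewrite -(cav_perm _ _ _ _ _ _ _ _ _ (fun s => F (Qc o0 o0 s)) (tperm o0 l)).
  by apply: eq_cav => s; rewrite /Qc /ov !ffunE tpermL !eqxx.
have [pm p0 p1] := perm_pair ll'.
rewrite -(cav_perm _ _ _ _ _ _ _ _ _ (fun s => F (Qc o0 o1 s)) pm).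
by apply: eq_cav => s; rewrite /Qc /ov !ffunE p0 p1 (negbTE ll').
Qed.

Lemma cav_Qm_perm i th (F : R -> R) l l' (l1 := if l == l' then o0 else o1) :
  cav i th (fun s => F (Qm i l l' s)) = cav i th (fun s => F (Qm i o0 l1 s)).
Proof.
rewrite /l1; case: eqP => [<-|/eqP ll'].
  rewrite -(cav_perm _ _ _ _ _ _ _ _ _ (fun s => F (Qm i o0 o0 s)) (tperm o0 l)).
  by apply: eq_cav => s; rewrite /Qm /Qc /ov !ffunE tpermL !eqxx.
have [pm p0 p1] := perm_pair ll'.
rewrite -(cav_perm _ _ _ _ _ _ _ _ _ (fun s => F (Qm i o0 o1 s)) pm).
by apply: eq_cav => s; rewrite /Qm /Qc /ov !ffunE p0 p1 (negbTE ll').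
Qed.

Lemma nu1_Qc_le l l' k : nu1 (fun s => `|Qc l l' s| ^+ k) <= mom k.
Proof.
rewrite -(nu1E i0) (cav_Qc_perm _ _ (fun x => `|x| ^+ k)) nu1E /mom.
have ge0 u v : 0 <= nu1 (fun s => `|Qc u v s| ^+ k) by apply: nu1_ge0 => s; rewrite exprn_ge0.
have := ge0 o0 o0; have := ge0 o0 o1; have : 0 <= (a / N%:R) ^+ k by rewrite exprn_ge0.
by case: ifP => _; lra.
Qed.

Lemma mom_ge0 k : 0 <= mom k.
Proof. by apply: le_trans (nu1_Qc_le o0 o0 k); apply: nu1_ge0 => s; rewrite exprn_ge0. Qed.

(** [cav_gronwall] moves the estimate to pi/2, where the law is the original one; there [Qm] differs
    from [Qc] by at most a/N. *)
Lemma cav_Qm_le i th l l' k : 0 <= th <= pi / 2 ->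
  cav i th (fun s => `|Qm i l l' s| ^+ k) <= expgrowth * 2 ^+ k * mom k.
Proof.
move=> thI; rewrite (cav_Qm_perm _ _ (fun x => `|x| ^+ k)); set l1 := (if _ then _ else _).
have l1lt : (l1 < 2)%N by rewrite /l1; case: ifP.
apply: (@le_trans _ _ (expgrowth * cav i (pi / 2) (fun s => `|Qm i o0 l1 s| ^+ k))).
  apply: (cav_gronwall h D iX beta_ge0 beta_le1 N_gt0 q_ge0 q_le p_ge0 p_le i (m := 2)) => //.
  by move=> s s' E; rewrite /Qm /Qc /ov !E.
rewrite -mulrA ler_wpM2l ?expR_ge0//.
have cavC (c : R) : cav i (pi / 2) (fun=> c) = c by exact: cav_cst.
apply: (@le_trans _ _ (cav i (pi / 2) (fun s => 2 ^+ k * (`|Qc o0 l1 s| ^+ k + (a / N%:R) ^+ k)))).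
  apply: le_cav => // s; apply: le_trans (exprD_le k (normr_ge0 _) aN0).
  rewrite lerXn2r ?nnegrE ?addr_ge0// -lerBlDl.
  by apply: (le_trans (lerB_dist _ _)); exact: Qm_Qc.
rewrite cavZ// ler_wpM2l ?exprn_ge0// cavD// cavC nu1E /mom lerD2r.
have ge0 u v : 0 <= nu1 (fun s => `|Qc u v s| ^+ k) by apply: nu1_ge0 => s; rewrite exprn_ge0.
by have := ge0 o0 o0; have := ge0 o0 o1; rewrite /l1; case: ifP => _; lra.
Qed.

Definition sumQ_const (k : nat) : R := 64 ^+ k * (64 * (expgrowth * 2 ^+ k)).

Lemma cav_sumQ_le i th k : 0 <= th <= pi / 2 ->
  cav i th (fun s => sumQ i s ^+ k.+1) <= sumQ_const k.+1 * mom k.+1.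
Proof.
move=> thI.
apply: (@le_trans _ _ (cav i th (fun s => 64 ^+ k.+1 * \sum_(ll : 'I_8 * 'I_8) `|Qm i ll.1 ll.2 s| ^+ k.+1))).
  apply: le_cav => // s; rewrite /sumQ pair_big /=.
  have := @expr_sum_le R ('I_8 * 'I_8)%type (fun ll => `|Qm i ll.1 ll.2 s|) k (fun _ => normr_ge0 _).
  by rewrite card_prod card_ord.
rewrite cavZ// /sumQ_const -[leRHS]mulrA ler_wpM2l ?exprn_ge0// cav_sum//.
apply: (le_trans (ler_sum _ (fun ll _ => cav_Qm_le i ll.1 ll.2 k.+1 thI))).
by rewrite sumr_const card_prod card_ord (_ : (8 * 8)%N = 64%N)// -[leLHS]mulr_natl -!mulrA.
Qed.

Lemma Qm_le_sumQ i l l' s : `|Qm i l l' s| <= sumQ i s.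
Proof.
rewrite /sumQ (bigD1 l)//= (bigD1 l')//= -addrA lerDl.
by rewrite addr_ge0// ?sumr_ge0// => *; rewrite sumr_ge0.
Qed.

Lemma QmE i l l' s : Qm i l l' s =
  N%:R^-1 * (\sum_(j | j != i) sg (s l) j * sg (s l') j) - (if l == l' then p else q).
Proof. by rewrite /Qm /Qc /ov (bigD1 i)//= mulrDr; ring. Qed.

Lemma off_site_Qm i l l' : @off_site R S N i (Qm i l l').
Proof.
move=> s s'; rewrite !QmE; congr (_ * _ - _); apply: eq_bigr => j /negbTE ji.
by rewrite !ffunE !sv_site_mix ji.
Qed.

(** At angle 0 the spins at [i] follow the mean-field weight, so these second moments are the
    right-hand sides of the fixed-point equations. This is what makes [p] and [q] the right
    centering. *)
Lemma cav0_spin2 i u v :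
  cav i 0 (fun s => sg (s u) i * sg (s v) i) = if u == v then p else q.
Proof.
have [Eq Ep] := fix_pq.
pose e (l : 'I_8) := ((l == u) + (l == v))%N.
transitivity (cav i 0 (fun s => \prod_l sg (s l) i ^+ e l)).
  apply: eq_cav => s; under eq_bigr do rewrite exprD.
  rewrite big_split/=; congr (_ * _).
    by rewrite (bigD1 u)//= eqxx expr1 big1 ?mulr1// => l /negbTE ->.
  by rewrite (bigD1 v)//= eqxx expr1 big1 ?mulr1// => l /negbTE ->.
rewrite cav0_monomial//; case: eqP => [uv|/eqP uv].
  rewrite [RHS]Ep; apply: eq_Rintegral => x _.
  rewrite (bigD1 u)//= big1 => [|l lu]; last by rewrite /e -uv (negbTE lu) mj0.
  by rewrite /e -uv eqxx mulr1.
rewrite [RHS]Eq; apply: eq_Rintegral => x _.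
rewrite (bigD1 u)//= (bigD1 v)//= 1?eq_sym// big1 => [|l /andP[lu lv]].
  by rewrite /e eqxx (negbTE uv) eq_sym (negbTE uv) eqxx mulr1 expr2.
by rewrite /e (negbTE lu) (negbTE lv) mj0.
Qed.

Lemma nu1D f g : nu1 (fun s => f s + g s) = nu1 f + nu1 g.
Proof. by rewrite -!(nu1E i0); exact: cavD. Qed.

Lemma nu1Z (c : R) f : nu1 (fun s => c * f s) = c * nu1 f.
Proof. by rewrite -!(nu1E i0); exact: cavZ. Qed.

Lemma nu1_sum (I : Type) (r : seq I) (P : pred I) (F : I -> rstate -> R) :
  nu1 (fun s => \sum_(k <- r | P k) F k s) = \sum_(k <- r | P k) nu1 (F k).
Proof.
rewrite -(nu1E i0) cav_sum//; apply: eq_bigr => k _; exact: nu1E.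
Qed.

Lemma le_nu1 f g : (forall s, f s <= g s) -> nu1 f <= nu1 g.
Proof. by rewrite -!(nu1E i0); exact: le_cav. Qed.

Lemma eq_nu1 f g : f =1 g -> nu1 f = nu1 g.
Proof. by move=> /funext ->. Qed.

Lemma nu1_cst (c : R) : nu1 (fun=> c) = c.
Proof. by rewrite -(nu1E i0); exact: cav_cst. Qed.

Lemma norm_nu1 f : `|nu1 f| <= nu1 (fun s => `|f s|).
Proof. by rewrite -!(nu1E i0); exact: norm_cav. Qed.

Lemma nu1B f g : nu1 (fun s => f s - g s) = nu1 f - nu1 g.
Proof.
by rewrite -mulN1r -nu1Z -nu1D; apply: eq_nu1 => s; rewrite mulN1r.
Qed.

Let tau u v : R := if u == v then p else q.

Lemma norm_spin2_sub i u v s : `|sg (s u) i * sg (s v) i - tau u v| <= 2 * a.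
Proof.
have := @norm_sv2 R S N (s u) i (s v) i; rewrite !ler_norml => /andP[h1 h2].
move: p_ge0 q_ge0 p_le q_le => p0 q0 pa qa.
by rewrite /tau; case: ifP => _; apply/andP; split; lra.
Qed.

(* The condition making the recursions on the moments contractive is
   [(stab_const 1 + stab_const 3) * beta ^+ 2 <= 1 / 4]. *)
Definition stab_const (k : nat) : R := 256 * a ^+ 2 * sumQ_const k.+1.

(** At angle 0 the factor at site [i] is centered and independent of [Qm], so the mean vanishes.
    What remains is a derivative, which costs beta^2 and raises the power of the overlaps by one. *)
Lemma cav_stab i u v k : (u < 2)%N -> (v < 2)%N ->
  `|nu1 (fun s => (sg (s u) i * sg (s v) i - tau u v) * Qm i u v s ^+ k)|
    <= stab_const k * beta ^+ 2 * mom k.+1.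
Proof.
move=> u2 v2; pose f s := (sg (s u) i * sg (s v) i - tau u v) * Qm i u v s ^+ k.
have f2 : depends_on (fun l => (l < 2)%N) f.
  by move=> s s' E; rewrite /f /Qm /Qc /ov !E.
have f00 : cav i 0 f = 0.
  transitivity (cav i 0 (fun s => Qm i u v s ^+ k * (sg (s u) i * sg (s v) i - tau u v))).
    by apply: eq_cav => s; rewrite mulrC.
  rewrite cav0_indep//; last 2 first.
  - by move=> s s'; rewrite off_site_Qm.
  - by move=> s s'; rewrite !ffunE !sv_site_mix eqxx.
  rewrite (_ : cav i 0 (fun s => _ - _) = 0) ?mulr0//.
  transitivity (cav i 0 (fun s => sg (s u) i * sg (s v) i) + (-1) * cav i 0 (fun _ : rstate => tau u v)).
    by rewrite -cavZ// -cavD//; apply: eq_cav => s; rewrite mulN1r.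
  by rewrite cav0_spin2 (@cav_cst R S N) mulN1r subrr.
pose M := 64 * a ^+ 2 * beta ^+ 2 * (sumQ_const k.+1 * mom k.+1).
suff : `|cav i (pi / 2) f - cav i 0 f| <= 4 * M.
  rewrite f00 subr0 nu1E => /le_trans; apply.
  by rewrite le_eqVlt; apply/orP; left; apply/eqP; rewrite /M /stab_const; ring.
apply: (cav_first_order iX N_gt0 q_ge0 (isT : (3 < 8)%N) f2 pihalf_in).
move=> x xI.
apply: (@le_trans _ _ (cav i x (fun s => 64 * a ^+ 2 * beta ^+ 2 * sumQ i s ^+ k.+1))).
  apply: le_cav => // s; apply: (le_trans (norm_Dop _ _ _ _ _ _ _)) => //.
  have -> : 64 * a ^+ 2 * beta ^+ 2 * sumQ i s ^+ k.+1 =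
     32 * a * beta ^+ 2 * ((2 * a * sumQ i s ^+ k) * sumQ i s).
    by rewrite (exprSr (sumQ i s)); ring.
  apply: ler_wpM2l; first by rewrite !mulr_ge0 ?spin2_ge0 ?sqr_ge0.
  apply: ler_wpM2r; first exact: sumQ_ge0.
  rewrite /f normrM normrX; apply: ler_pM => //; first exact: norm_spin2_sub.
  by rewrite lerXn2r ?nnegrE ?sumQ_ge0// Qm_le_sumQ.
rewrite cavZ// ler_wpM2l ?mulr_ge0 ?sqr_ge0//.
exact: cav_sumQ_le.
Qed.

Lemma QcE u v s : Qc u v s = N%:R^-1 * \sum_i (sg (s u) i * sg (s v) i - tau u v).
Proof.
rewrite /Qc /ov sumrB mulrBr; congr (_ - _).
by rewrite sumr_const card_ord -[X in _ * X]mulr_natl mulKf// pnatr_eq0 -lt0n.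
Qed.

Lemma norm_avg_le (F : 'I_N -> R) (c : R) : (forall i, `|F i| <= c) ->
  `|N%:R^-1 * \sum_i F i| <= c.
Proof.
move=> Fc; rewrite normrM ger0_norm ?invr_ge0//.
rewrite -[leRHS](@mulKf _ N%:R) ?pnatr_eq0 -?lt0n//.
rewrite ler_wpM2l ?invr_ge0//; apply: (le_trans (ler_norm_sum _ _ _)).
apply: (le_trans (ler_sum _ (fun i _ => Fc i))).
by rewrite sumr_const card_ord mulr_natl.
Qed.

(** One factor of [Qc] is written as an average over sites, each handled by its own interpolation.
    Replacing [Qc] by [Qm] in the other factors costs [c], times the bound 2a on the centered spin
    product. *)
Lemma nu1_Qc_pow u v k (c : R) : (u < 2)%N -> (v < 2)%N ->
  (forall i, nu1 (fun s => `|Qc u v s ^+ k - Qm i u v s ^+ k|) <= c) ->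
  `|nu1 (fun s => Qc u v s ^+ k.+1)| <=
    stab_const k * beta ^+ 2 * mom k.+1 + 2 * a * c.
Proof.
move=> u2 v2 Hc.
have -> : nu1 (fun s => Qc u v s ^+ k.+1) =
   N%:R^-1 * \sum_i nu1 (fun s => (sg (s u) i * sg (s v) i - tau u v) * Qc u v s ^+ k).
  rewrite -nu1_sum -nu1Z; apply: eq_nu1 => s.
  by rewrite exprS {1}QcE -mulrA mulr_suml.
apply: norm_avg_le => i.
have -> : nu1 (fun s => (sg (s u) i * sg (s v) i - tau u v) * Qc u v s ^+ k) =
   nu1 (fun s => (sg (s u) i * sg (s v) i - tau u v) * Qm i u v s ^+ k) +
   nu1 (fun s => (sg (s u) i * sg (s v) i - tau u v) * (Qc u v s ^+ k - Qm i u v s ^+ k)).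
  by rewrite -nu1D; apply: eq_nu1 => s; ring.
apply: (le_trans (ler_normD _ _)); apply: lerD; first exact: cav_stab.
apply: (le_trans (norm_nu1 _)).
apply: (@le_trans _ _ (2 * a * nu1 (fun s => `|Qc u v s ^+ k - Qm i u v s ^+ k|))).
  rewrite -nu1Z; apply: le_nu1 => s; rewrite normrM ler_wpM2r//.
  exact: norm_spin2_sub.
by rewrite ler_wpM2l// mulr_ge0 ?spin2_ge0.
Qed.

Hypothesis small_beta : (stab_const 1 + stab_const 3) * beta ^+ 2 <= 1 / 4.

Let r : R := (Num.sqrt N%:R)^-1.

Let r_gt0 : 0 < r. Proof. by rewrite invr_gt0 sqrtr_gt0 ltr0n. Qed.

Let r2 : r ^+ 2 = N%:R^-1. Proof. by rewrite exprVn sqr_sqrtr. Qed.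

Let r_le1 : r <= 1.
Proof.
by rewrite invf_le1 ?sqrtr_gt0 ?ltr0n// -[X in X <= _]sqrtr1 ler_sqrt ?ler1n.
Qed.

Lemma sumQ_const_ge0 k : 0 <= sumQ_const k.
Proof. by rewrite /sumQ_const !mulr_ge0 ?exprn_ge0 ?expR_ge0. Qed.

Lemma stab_const_ge0 k : 0 <= stab_const k.
Proof. by rewrite /stab_const mulr_ge0 ?sumQ_const_ge0// mulr_ge0 ?sqr_ge0. Qed.

Lemma small_beta1 : stab_const 1 * beta ^+ 2 <= 1 / 4.
Proof.
apply: le_trans small_beta; rewrite ler_wpM2r ?sqr_ge0// lerDl; exact: stab_const_ge0.
Qed.

Lemma small_beta3 : stab_const 3 * beta ^+ 2 <= 1 / 4.
Proof.
apply: le_trans small_beta; rewrite ler_wpM2r ?sqr_ge0// lerDr; exact: stab_const_ge0.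
Qed.

(** Each of the two moments is at most mom/4 + 2a^2/N, hence mom <= mom/2 + 5a^2/N. *)
Definition K2 : R := 10 * a ^+ 2.

Lemma mom2_le : mom 2 <= K2 * r ^+ 2.
Proof.
have H u v (u2 : (u < 2)%N) (v2 : (v < 2)%N) :
    nu1 (fun s => `|Qc u v s| ^+ 2) <= 1 / 4 * mom 2 + 2 * a * (a / N%:R).
  rewrite (eq_nu1 (g := fun s => Qc u v s ^+ 2)); last first.
    by move=> s; rewrite real_normK// num_real.
  apply: (le_trans (ler_norm _)); apply: (le_trans (nu1_Qc_pow (c := a / N%:R) u2 v2 _)).
    move=> i; rewrite -[leRHS]nu1_cst; apply: le_nu1 => s.
    by rewrite !expr1 distrC Qm_Qc.
  by rewrite lerD2r ler_wpM2r ?mom_ge0// small_beta1.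
have := H o0 o0 isT isT; have := H o0 o1 isT isT.
have E : mom 2 = nu1 (fun s => `|Qc o0 o0 s| ^+ 2) + nu1 (fun s => `|Qc o0 o1 s| ^+ 2) + (a / N%:R) ^+ 2 by [].
have -> : a / N%:R = a * r ^+ 2 by rewrite r2.
have E2 : (a / N%:R) ^+ 2 <= a ^+ 2 * r ^+ 2.
  rewrite exprMn ler_wpM2l ?sqr_ge0// -r2 -exprM (_ : (2 * 2)%N = (2 + 2)%N)// exprD.
  by rewrite ler_piMl ?sqr_ge0// expr_le1// ltW.
move: E E2; rewrite /K2; move: (mom 2) (nu1 _) (nu1 _) => m x y; move: ((a / N%:R) ^+ 2) => z.
rewrite (_ : 2 * a * (a * r ^+ 2) = 2 * (a ^+ 2 * r ^+ 2)); last by ring.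
rewrite -(mulrA 10); move: (a ^+ 2 * r ^+ 2) => w *; lra.
Qed.

Definition K4 : R := 12 * a ^+ 2 * (1 + 4 * expgrowth) * K2 + 2 * a ^+ 4.

Lemma mom4_le : mom 4 <= K4 * r ^+ 4.
Proof.
(* From x^3 - y^3 = (x - y)(x^2 + xy + y^2) and |x^2 + xy + y^2| <= (3/2)(x^2 + y^2); the last
   factor bounds the second moments of [Qc] and [Qm] together. *)
pose c : R := (a / N%:R) * (3 / 2) * ((1 + 4 * expgrowth) * (K2 * r ^+ 2)).
have H u v (u2 : (u < 2)%N) (v2 : (v < 2)%N) :
    nu1 (fun s => `|Qc u v s| ^+ 4) <= 1 / 4 * mom 4 + 2 * a * c.
  rewrite (eq_nu1 (g := fun s => Qc u v s ^+ 4)); last first.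
    by move=> s; rewrite (_ : 4%N = (2 * 2)%N)// !exprM real_normK// num_real.
  apply: (le_trans (ler_norm _)); apply: (le_trans (nu1_Qc_pow (c := c) u2 v2 _)); last first.
    by rewrite lerD2r ler_wpM2r ?mom_ge0// small_beta3.
  move=> i.
  apply: (@le_trans _ _ ((a / N%:R) * (3 / 2) *
     (nu1 (fun s => `|Qc u v s| ^+ 2) + nu1 (fun s => `|Qm i u v s| ^+ 2)))).
    rewrite -nu1D -nu1Z; apply: le_nu1 => s.
    rewrite !real_normK ?num_real//.
    rewrite (_ : _ - _ = (Qc u v s - Qm i u v s) * (Qc u v s ^+ 2 + Qc u v s * Qm i u v s + Qm i u v s ^+ 2)); last by ring.
    rewrite normrM -mulrA; apply: ler_pM => //; first by rewrite distrC Qm_Qc.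
    move: (Qc u v s) (Qm i u v s) => x y.
    by have := sqr_ge0 (x - y); have := sqr_ge0 (x + y) => h1 h2; rewrite ger0_norm; lra.
  rewrite /c ler_wpM2l ?mulr_ge0//.
  have h1 : nu1 (fun s => `|Qc u v s| ^+ 2) <= mom 2 by exact: nu1_Qc_le.
  have h2 : nu1 (fun s => `|Qm i u v s| ^+ 2) <= expgrowth * 2 ^+ 2 * mom 2.
    by rewrite -(nu1E i); apply: cav_Qm_le.
  apply: (le_trans (lerD h1 h2)).
  rewrite (_ : mom 2 + _ = (1 + 4 * expgrowth) * mom 2); last by ring.
  by apply: ler_wpM2l mom2_le; rewrite addr_ge0// mulr_ge0 ?expR_ge0.
have := H o0 o0 isT isT; have := H o0 o1 isT isT.
have E : mom 4 = nu1 (fun s => `|Qc o0 o0 s| ^+ 4) + nu1 (fun s => `|Qc o0 o1 s| ^+ 4) + (a / N%:R) ^+ 4 by [].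
have E2 : (a / N%:R) ^+ 4 <= a ^+ 4 * r ^+ 4.
  rewrite exprMn ler_wpM2l ?exprn_ge0 ?spin2_ge0// -r2 -exprM (_ : (2 * 4)%N = (4 + 4)%N)// exprD.
  by rewrite ler_piMl ?exprn_ge0 ?expr_le1// ltW.
have -> : 2 * a * c = 3 * a ^+ 2 * (1 + 4 * expgrowth) * K2 * r ^+ 4.
  by rewrite /c -r2; field.
move: E E2; rewrite /K4; move: (mom 4) (nu1 _) (nu1 _) => m x y; move: ((a / N%:R) ^+ 4) => z.
rewrite (_ : (12 * _ * _ * _ + _) * _ = 4 * (3 * a ^+ 2 * (1 + 4 * expgrowth) * K2 * r ^+ 4) + 2 * (a ^+ 4 * r ^+ 4)); last by ring.
move: (3 * a ^+ 2 * (1 + 4 * expgrowth) * K2 * r ^+ 4) (a ^+ 4 * r ^+ 4) => w w' *; lra.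
Qed.

(** This is x <= r/2 + x^2/(2r) multiplied by x^k, with [r] the typical size of an overlap: an odd
    absolute moment inherits the expected order from its even neighbours. *)
Lemma nu1_amgm u v k : nu1 (fun s => `|Qc u v s| ^+ k.+1) <=
  r / 2 * nu1 (fun s => `|Qc u v s| ^+ k) + (2 * r)^-1 * nu1 (fun s => `|Qc u v s| ^+ k.+2).
Proof.
rewrite -!nu1Z -nu1D; apply: le_nu1 => s; move: (normr_ge0 (Qc u v s)); move: (`|_|) => x x0.
have -> : r / 2 * x ^+ k + (2 * r)^-1 * x ^+ k.+2 = x ^+ k * ((r ^+ 2 + x ^+ 2) / (2 * r)).
  by rewrite !exprS; field; exact: lt0r_neq0.
rewrite exprSr ler_wpM2l ?exprn_ge0// ler_pdivlMr ?mulr_gt0//.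
by have := sqr_ge0 (r - x); lra.
Qed.

Let powN k : (a / N%:R) ^+ k <= a ^+ k * r ^+ k.
Proof.
rewrite -exprMn lerXn2r ?nnegrE ?mulr_ge0 ?spin2_ge0 ?(ltW r_gt0)//.
by rewrite ler_wpM2l ?spin2_ge0// -r2 expr2 ler_piMl// ltW.
Qed.

Definition K1 : R := 1 + K2 / 2 + a.

Lemma mom1_le : mom 1 <= K1 * r ^+ 1.
Proof.
have H u v : nu1 (fun s => `|Qc u v s| ^+ 1) <= r / 2 + (2 * r)^-1 * nu1 (fun s => `|Qc u v s| ^+ 2).
  apply: (le_trans (nu1_amgm u v 0)); rewrite (eq_nu1 (g := fun=> 1)) => [|s]; last by rewrite expr0.
  by rewrite nu1_cst mulr1.
have h2 : (2 * r)^-1 * mom 2 <= K2 / 2 * r.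
  rewrite (_ : K2 / 2 * r = (2 * r)^-1 * (K2 * r ^+ 2)); last by field; exact: lt0r_neq0.
  by rewrite ler_wpM2l ?mom2_le// invr_ge0 mulr_ge0// ltW.
have := H o0 o0; have := H o0 o1; have := powN 1; move: h2.
have r20 : 0 <= (2 * r)^-1 * (a / N%:R) ^+ 2.
  by rewrite mulr_ge0 ?exprn_ge0// invr_ge0 mulr_ge0// ltW.
rewrite /K1 /mom; move: r20; rewrite !expr1.
move: (nu1 _) (nu1 _) (nu1 _) (nu1 _) ((a / N%:R) ^+ 2) (a / N%:R) (2 * r)^-1.
by move=> A2 B2 B1 A1 w2 w1 c *; lra.
Qed.

Definition K3 : R := K2 / 2 + K4 / 2 + a ^+ 3.

Lemma mom3_le : mom 3 <= K3 * r ^+ 3.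
Proof.
have h2 : r / 2 * mom 2 <= K2 / 2 * r ^+ 3.
  rewrite (_ : K2 / 2 * r ^+ 3 = r / 2 * (K2 * r ^+ 2)); last by field.
  by rewrite ler_wpM2l ?mom2_le// mulr_ge0// ltW.
have h4 : (2 * r)^-1 * mom 4 <= K4 / 2 * r ^+ 3.
  rewrite (_ : K4 / 2 * r ^+ 3 = (2 * r)^-1 * (K4 * r ^+ 4)); last by field; exact: lt0r_neq0.
  by rewrite ler_wpM2l ?mom4_le// invr_ge0 mulr_ge0// ltW.
have := nu1_amgm o0 o0 2; have := nu1_amgm o0 o1 2; have := powN 3; move: h2 h4.
have r20 : 0 <= r / 2 * (a / N%:R) ^+ 2.
  by rewrite mulr_ge0 ?exprn_ge0// mulr_ge0// ltW.
have r40 : 0 <= (2 * r)^-1 * (a / N%:R) ^+ 4.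
  by rewrite mulr_ge0 ?exprn_ge0// invr_ge0 mulr_ge0// ltW.
rewrite /K3 /mom; move: r20 r40.
move: (nu1 _) (nu1 _) (nu1 _) (nu1 _) (nu1 _) (nu1 _) ((a / N%:R) ^+ 2) ((a / N%:R) ^+ 4) ((a / N%:R) ^+ 3) (2 * r)^-1.
by move=> *; lra.
Qed.

Definition L1 : R := sumQ_const 1 * K1.
Definition L3 : R := sumQ_const 3 * K3.

Lemma cav_sumQ1 i th : 0 <= th <= pi / 2 -> cav i th (fun s => sumQ i s) <= L1 * r.
Proof.
move=> thI; rewrite (eq_cav _ _ _ _ _ _ _ _ _ (g := fun s => sumQ i s ^+ 1)) => [|s]; last by rewrite expr1.
apply: (le_trans (cav_sumQ_le _ _ thI)); rewrite /L1 -mulrA ler_wpM2l ?sumQ_const_ge0//.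
exact: mom1_le.
Qed.

Lemma cav_sumQ3 i th : 0 <= th <= pi / 2 -> cav i th (fun s => sumQ i s ^+ 3) <= L3 * r ^+ 3.
Proof.
move=> thI; apply: (le_trans (cav_sumQ_le _ _ thI)).
by rewrite /L3 -mulrA ler_wpM2l ?sumQ_const_ge0// mom3_le.
Qed.

Lemma norm_Dop1 i m f s : (m.+1 <= 8)%N ->
  `|Dop i m f s| <= 32 * a * (`|f s| * sumQ i s).
Proof.
move=> m8; apply: (le_trans (norm_Dop _ _ _ _ _ _ m8)).
apply: ler_wpM2r; first by rewrite mulr_ge0 ?sumQ_ge0.
by rewrite ler_piMr ?mulr_ge0 ?spin2_ge0// expr_le1.
Qed.

Definition Qpair_const : R := 128 * a * L3 + a * (L1 + K1).

(** Going from angle 0 to pi/2 costs a third moment, and restoring site [i] costs 1/N times a first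
    moment; both are of order N^(-3/2). Indices stay below 6 because the derivative of a function of
    6 replicas fills the eight available. *)
Lemma cav0_Qpair i l l' u v : (l < 6)%N -> (l' < 6)%N -> (u < 6)%N -> (v < 6)%N ->
  `|cav i 0 (fun s => Qm i l l' s * Qm i u v s) - nu1 (fun s => Qc l l' s * Qc u v s)|
    <= Qpair_const * r ^+ 3.
Proof.
move=> l6 l6' u6 v6; pose f s := Qm i l l' s * Qm i u v s.
have f6 : depends_on (fun l => (l < 6)%N) f.
  by move=> s s' E; rewrite /f /Qm /Qc /ov !E.
have H1 : `|cav i (pi / 2) f - cav i 0 f| <= 4 * (32 * a * (L3 * r ^+ 3)).
  apply: (cav_first_order iX N_gt0 q_ge0 (isT : (7 < 8)%N) f6 pihalf_in) => x xI.
  apply: (@le_trans _ _ (cav i x (fun s => 32 * a * sumQ i s ^+ 3))).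
    apply: le_cav => // s; apply: (le_trans (@norm_Dop1 _ _ _ _ _)) => //.
    apply: ler_wpM2l; first by rewrite mulr_ge0 ?spin2_ge0.
    rewrite exprSr; apply: ler_wpM2r; first exact: sumQ_ge0.
    by rewrite /f normrM expr2 ler_pM// Qm_le_sumQ.
  by rewrite cavZ// ler_wpM2l ?mulr_ge0 ?spin2_ge0// cav_sumQ3.
have H2 : `|nu1 f - nu1 (fun s => Qc l l' s * Qc u v s)| <= a * r ^+ 2 * (L1 * r + K1 * r).
  rewrite -nu1B; apply: (le_trans (norm_nu1 _)).
  apply: (@le_trans _ _ (nu1 (fun s => a * r ^+ 2 * (sumQ i s + `|Qc l l' s| ^+ 1)))).
    apply: le_nu1 => s; rewrite /f.
    rewrite (_ : _ - _ = (Qm i l l' s - Qc l l' s) * Qm i u v s +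
       Qc l l' s * (Qm i u v s - Qc u v s)); last by ring.
    apply: (le_trans (ler_normD _ _)); rewrite !normrM mulrDr; apply: lerD.
      by apply: ler_pM => //; rewrite ?r2 ?Qm_Qc// Qm_le_sumQ.
    by rewrite mulrC expr1 ler_wpM2r// r2 Qm_Qc.
  rewrite nu1Z; apply: ler_wpM2l; first by rewrite mulr_ge0 ?spin2_ge0 ?sqr_ge0.
  apply: (@le_trans _ _ (nu1 (fun s => sumQ i s) + nu1 (fun s => `|Qc l l' s| ^+ 1))).
by rewrite -nu1D.
  apply: lerD.
    by rewrite -(nu1E i); apply: cav_sumQ1.
  by apply: (le_trans (nu1_Qc_le _ _ _)); rewrite -[X in _ * X]expr1 mom1_le.
rewrite nu1E in H1; rewrite -/f.
have -> : cav i 0 f - nu1 (fun s => Qc l l' s * Qc u v s) =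
   - (nu1 f - cav i 0 f) + (nu1 f - nu1 (fun s => Qc l l' s * Qc u v s)) by ring.
apply: (le_trans (ler_normD _ _)); rewrite normrN.
apply: (le_trans (lerD H1 H2)); rewrite /Qpair_const.
by rewrite le_eqVlt; apply/orP; left; apply/eqP; ring.
Qed.

(** Three sources, in order: the diagonal term moved to angle 0, the second-order remainder, and the
    replacement of pairs of [Qm] by pairs of [Qc], where 2048 = 64 * 64 / 2. *)
Definition CE_const (b : R) : R := 128 * a ^+ 2 * b * L1 +
  16 * (32 * a) ^+ 2 * b * L3 + 2048 * b * a * Qpair_const.

Lemma Qpair_const_ge0 : 0 <= Qpair_const.
Proof.
(* The sign is read off from an instance of the bound itself, r^3 being positive. *)
rewrite -(@pmulr_lge0 _ (r ^+ 3)) ?exprn_gt0//.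
exact: le_trans (normr_ge0 _) (@cav0_Qpair i0 o0 o0 o0 o0 isT isT isT isT).
Qed.

(** [Qc] is [Qm] plus the contribution of site [i]. The latter gives the 1/N term. For the former
    the value at angle 0 vanishes, [F] being centered and independent of [Qm], and the slope at 0
    factors into a one-site mean and the mean of a pair of [Qm], which [cav0_Qpair] replaces by its
    value in the original model. *)
Lemma cavity_expansion i m (phi : ('I_8 -> R) -> R) (b : R) u v
    (F := fun s => phi (fun l => sg (s l) i)) : (m <= 4)%N ->
  (forall x y, (forall l, (l < m)%N -> x l = y l) -> phi x = phi y) ->
  (forall x, (forall l, `|x l| <= S%:R) -> `|phi x| <= b) ->
  (u < m)%N -> (v < m)%N -> cav i 0 F = 0 ->
  `|nu1 (fun s => F s * Qc u v s) -
    (N%:R^-1 * cav i 0 (fun s => F s * (sg (s u) i * sg (s v) i)) +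
     beta ^+ 2 / 2 * \sum_l \sum_l' kap m l * kap m.+1 l' *
       (cav i 0 (fun s => F s * (sg (s l) i * sg (s l') i)) *
        nu1 (fun s => Qc l l' s * Qc u v s)))| <= CE_const b * r ^+ 3.
Proof.
move=> m4 phim phib um vm F0.
have Fb s : `|F s| <= b by apply: phib => l; exact: norm_sv.
have b0 : 0 <= b := le_trans (normr_ge0 _) (Fb [ffun=> cfg0]).
have Fm : depends_on (fun l => (l < m)%N) F by move=> s s' E; apply: phim => l lm; rewrite E.
have Fon : on_site i F.
  move=> s s'; rewrite /F; congr phi; apply/funext => l.
  by rewrite ffunE sv_site_mix eqxx.
pose e l l' s := sg (s l) i * sg (s l') i.
have Feb l l' s : `|F s * e l l' s| <= b * a.
  by rewrite normrM ler_pM// norm_sv2.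
have Feon l l' : on_site i (fun s => F s * e l l' s).
  by move=> s s'; rewrite Fon /e !ffunE !sv_site_mix eqxx.
pose G s := F s * Qm i u v s.
have Gm : depends_on (fun l => (l < m)%N) G.
  by move=> s s' E; rewrite /G (Fm s s' E) /Qm /Qc /ov !E.
have split : nu1 (fun s => F s * Qc u v s) = nu1 G + N%:R^-1 * nu1 (fun s => F s * e u v s).
  rewrite -nu1Z -nu1D; apply: eq_nu1 => s; rewrite /G /Qm /e; ring.
have H1 : `|nu1 (fun s => F s * e u v s) - cav i 0 (fun s => F s * e u v s)|
    <= 4 * (32 * a * (b * a * (L1 * r))).
  have Hm : depends_on (fun l => (l < m)%N) (fun s => F s * e u v s).
    by move=> s s' E; rewrite (Fm s s' E) /e !E.
  have m8 : (m.+1 < 8)%N by rewrite (@leq_ltn_trans 5).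
  rewrite -(nu1E i); apply: (cav_first_order iX N_gt0 q_ge0 m8 Hm pihalf_in) => x xI.
  apply: (@le_trans _ _ (cav i x (fun s => 32 * a * (b * a * sumQ i s)))).
    apply: le_cav => // s; apply: (le_trans (@norm_Dop1 _ _ _ _ _)); first by rewrite (@leq_trans 5).
    apply: ler_wpM2l; first by rewrite mulr_ge0 ?spin2_ge0.
    by apply: ler_wpM2r; [exact: sumQ_ge0|exact: Feb].
  rewrite cavZ// ler_wpM2l ?mulr_ge0 ?spin2_ge0// cavZ// ler_wpM2l ?mulr_ge0 ?spin2_ge0//.
  exact: cav_sumQ1.
have H2 : `|cav i (pi / 2) G - cav i 0 G - cav i 0 (Dop i m G)|
    <= 16 * ((32 * a) ^+ 2 * b * (L3 * r ^+ 3)).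
  have m8 : (m.+3 < 8)%N by rewrite (@leq_ltn_trans 7).
  apply: (cav_second_order iX N_gt0 q_ge0 m8 Gm) => x xI.
  apply: (@le_trans _ _ (cav i x (fun s => (32 * a) ^+ 2 * b * sumQ i s ^+ 3))).
    apply: le_cav => // s; apply: (le_trans (@norm_Dop1 _ _ _ _ _)); first by rewrite (@leq_trans 7).
    have -> : (32 * a) ^+ 2 * b * sumQ i s ^+ 3 =
       32 * a * ((32 * a * (b * sumQ i s * sumQ i s)) * sumQ i s) by ring.
    apply: ler_wpM2l; first by rewrite mulr_ge0 ?spin2_ge0.
    apply: ler_wpM2r; first exact: sumQ_ge0.
    apply: (le_trans (@norm_Dop1 _ _ _ _ _)); first by rewrite (@leq_trans 5).
    apply: ler_wpM2l; first by rewrite mulr_ge0 ?spin2_ge0.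
    apply: ler_wpM2r; first exact: sumQ_ge0.
    by rewrite /G normrM ler_pM// Qm_le_sumQ.
  rewrite cavZ// ler_wpM2l//; last exact: cav_sumQ3.
  by rewrite mulr_ge0 ?sqr_ge0.
have G0 : cav i 0 G = 0.
  transitivity (cav i 0 (fun s => Qm i u v s * F s)); first by apply: eq_cav => s; rewrite mulrC.
  by rewrite cav0_indep ?F0 ?mulr0//; exact: off_site_Qm.
have QF l l' : cav i 0 (fun s => (Qm i l l' s * Qm i u v s) * (F s * e l l' s)) =
    cav i 0 (fun s => F s * e l l' s) * cav i 0 (fun s => Qm i l l' s * Qm i u v s).
  have QQ : @off_site R S N i (fun s => Qm i l l' s * Qm i u v s).
    by move=> s s'; rewrite !off_site_Qm.
  by apply: (etrans (cav0_indep beta h D p q iX QQ (Feon l l'))); exact: mulrC.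
have DG : cav i 0 (Dop i m G) = beta ^+ 2 / 2 * \sum_l \sum_l' kap m l * kap m.+1 l' *
    (cav i 0 (fun s => F s * e l l' s) * cav i 0 (fun s => Qm i l l' s * Qm i u v s)).
  transitivity (cav i 0 (fun s => beta ^+ 2 / 2 * \sum_l \sum_l' kap m l * kap m.+1 l' *
     ((Qm i l l' s * Qm i u v s) * (F s * e l l' s)))).
    apply: eq_cav => s; rewrite /Dop -mulrA; congr (_ * _).
    rewrite mulr_sumr; apply: eq_bigr => l _; rewrite mulr_sumr; apply: eq_bigr => l' _.
    by rewrite /G /e; ring.
  rewrite cavZ// cav_sum//; congr (_ * _); apply: eq_bigr => l _.
  rewrite cav_sum//; apply: eq_bigr => l' _.
  by apply: (etrans (cavZ beta h D p q iX i 0 _ _)); rewrite QF.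
pose A := \sum_l \sum_l' kap m l * kap m.+1 l' *
    (cav i 0 (fun s => F s * e l l' s) * cav i 0 (fun s => Qm i l l' s * Qm i u v s)).
pose B := \sum_l \sum_l' kap m l * kap m.+1 l' *
    (cav i 0 (fun s => F s * e l l' s) * nu1 (fun s => Qc l l' s * Qc u v s)).
have AB : `|A - B| <= 64 * (64 * (b * a * (Qpair_const * r ^+ 3))).
  rewrite /A /B -sumrB; apply: (le_trans (ler_norm_sum _ _ _)).
  have -> : 64 * (64 * (b * a * (Qpair_const * r ^+ 3))) =
     \sum_(l < 8) \sum_(l' < 8) 64 * (b * a * (Qpair_const * r ^+ 3)).
    by rewrite !sumr_const !card_ord -mulrnA -[RHS]mulr_natl.
  apply: ler_sum => l _; rewrite -sumrB; apply: (le_trans (ler_norm_sum _ _ _)).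
  apply: ler_sum => l' _; rewrite -mulrBr -mulrBr.
  have rhs0 : 0 <= 64 * (b * a * (Qpair_const * r ^+ 3)).
    by rewrite !mulr_ge0 ?spin2_ge0 ?Qpair_const_ge0 ?exprn_ge0// ltW.
  (* Terms with l > m or l' > m.+1 have weight 0; as m <= 4 the others stay below 6, the range of
     [cav0_Qpair]. *)
  have [lm|ml] := leqP l m; last first.
    by rewrite {1}/kap ltnNge (ltnW ml) /= gtn_eqF// !mul0r normr0.
  have [lm'|ml'] := leqP l' m.+1; last first.
    by rewrite {2}/kap ltnNge (ltnW ml') /= gtn_eqF// mulr0 !mul0r normr0.
  rewrite normrM; apply: ler_pM => //.
    rewrite normrM (_ : 64 = 8 * 8 :> R); last by ring.
    by apply: ler_pM => //; apply: norm_kap; rewrite (leq_trans _ (_ : 5 <= 8)%N)// ltnW.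
  rewrite normrM; apply: ler_pM => //.
    apply: (le_trans (norm_cav _ _ _ _ _ _ _ _ _)) => //.
    by rewrite -[leRHS](@cav_cst R S N beta h D p q _ _ Q X i 0); apply: le_cav.
  have m6 : (m.+1 < 6)%N by rewrite ltnS (leq_trans _ (_ : 5 <= 5)%N).
  apply: cav0_Qpair.
  - exact: leq_ltn_trans lm (ltnW m6).
  - exact: leq_ltn_trans lm' m6.
  - exact: ltn_trans um (ltnW m6).
  - exact: ltn_trans vm (ltnW m6).
rewrite split -/(e u v) -/B.
have -> : nu1 G + N%:R^-1 * nu1 (fun s => F s * e u v s) -
   (N%:R^-1 * cav i 0 (fun s => F s * (sg (s u) i * sg (s v) i)) + beta ^+ 2 / 2 * B) =
   (cav i (pi / 2) G - cav i 0 G - cav i 0 (Dop i m G)) +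
   (r ^+ 2 * (nu1 (fun s => F s * e u v s) - cav i 0 (fun s => F s * e u v s)) +
   beta ^+ 2 / 2 * (A - B)).
  by rewrite nu1E G0 DG -/A r2 /e; ring.
apply: (le_trans (ler_normD _ _)).
have -> : CE_const b * r ^+ 3 = 16 * ((32 * a) ^+ 2 * b * (L3 * r ^+ 3)) +
   (r ^+ 2 * (4 * (32 * a * (b * a * (L1 * r)))) +
    2^-1 * (64 * (64 * (b * a * (Qpair_const * r ^+ 3))))).
  by rewrite /CE_const; field.
apply: lerD => //; apply: (le_trans (ler_normD _ _)); apply: lerD.
  by rewrite normrM (ger0_norm (sqr_ge0 r)) ler_wpM2l ?sqr_ge0.
rewrite normrM; apply: ler_pM => //.
rewrite ger0_norm ?divr_ge0 ?sqr_ge0// ler_piMl// ?invr_ge0// expr_le1//.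
Qed.

End Moments.

(** * Replica equations *)

Section Words.
Context {R : realType} {S N : nat}.
Variables (beta h D p q : R).
Local Notation rstate := {ffun 'I_8 -> config S N}.
Local Notation sg := (@sv R S N).
Context {d} {Omega : measurableType d} (Q : probability Omega R)
  (X : @disorder_index N -> Omega -> R).
Hypothesis iX : iid_gauss active Q X.
Local Notation cav := (cav beta h D p q Q X).
Local Notation m := (mj S beta h D p q).
Implicit Types (i : 'I_N) (s : rstate).

Definition o2 : 'I_8 := Ordinal (isT : (2 < 8)%N).
Definition o3 : 'I_8 := Ordinal (isT : (3 < 8)%N).
Definition o4 : 'I_8 := Ordinal (isT : (4 < 8)%N).
Definition o5 : 'I_8 := Ordinal (isT : (5 < 8)%N).
Definition o6 : 'I_8 := Ordinal (isT : (6 < 8)%N).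
Definition o7 : 'I_8 := Ordinal (isT : (7 < 8)%N).

Lemma big_ord8 (G : 'I_8 -> R) :
  \sum_l G l = G o0 + G o1 + G o2 + G o3 + G o4 + G o5 + G o6 + G o7.
Proof.
rewrite !big_ord_recl big_ord0 addr0 !addrA.
by do 8?[congr (_ + _)]; congr G; apply: val_inj.
Qed.

Definition eqpairs (a b c e : nat) : nat :=
  ((a == b) + (a == c) + (a == e) + (b == c) + (b == e) + (c == e))%N.

(* Four replicas fall into a pattern (4), (3,1), (2,2), (2,1,1) or (1,1,1,1),
   told apart by the number 6, 3, 2, 1 or 0 of coinciding pairs. *)
Definition pattern_moment (n : nat) (x : R) : R :=
  match n with
  | 6 => m 4 x
  | 3 => m 3 x * m 1 x
  | 2 => m 2 x ^+ 2
  | 1 => m 2 x * m 1 x ^+ 2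
  | _ => m 1 x ^+ 4
  end.

Lemma prod_count4 (a b c e : 'I_8) x :
  \prod_(l < 8) m (count_mem l [:: a; b; c; e]) x = pattern_moment (eqpairs a b c e) x.
Proof.
pose w := [:: a; b; c; e].
transitivity (\prod_(l <- undup w) m (count_mem l w) x).
  rewrite -/w (bigID (mem w)) -[RHS]mulr1; congr (_ * _); last first.
    by apply: big1 => l /count_memPn ->; rewrite mj0.
  rewrite big_uniq ?undup_uniq//; apply: eq_bigl => l.
  by rewrite mem_undup.
(* [undup] keeps the last occurrence of each letter: a letter is dropped if it recurs later, and the
   exponent of a kept one is one plus the number of its earlier copies. *)
transitivity ((if [|| a == b, a == c | a == e] then 1 else m 1 x) *
  ((if (b == c) || (b == e) then 1 else m (a == b).+1 x) *
  ((if c == e then 1 else m ((a == c) + (b == c)).+1 x) *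
   m ((a == e) + (b == e) + (c == e)).+1 x))).
  rewrite /w /= !inE.
  have H (t : 'I_8) (bb : bool) (r : seq 'I_8) : \prod_(l <- if bb then r else t :: r) m (count_mem l w) x =
     (if bb then 1 else m (count_mem t w) x) * \prod_(l <- r) m (count_mem l w) x.
    by case: bb; rewrite ?mul1r ?big_cons.
  rewrite -/(count_mem _ w) !H big_seq1; congr (_ * (_ * (_ * _))).
  - case: ifPn => // /norP[/negbTE ab /norP[/negbTE ac /negbTE ae]].
    by rewrite /w /= eqxx ![_ == a]eq_sym ab ac ae.
  - case: ifPn => // /norP[/negbTE bc /negbTE be].
    by rewrite /w /= eqxx [c == _]eq_sym [e == _]eq_sym bc be addn1.
  - case: ifPn => // /negbTE ce.
    by rewrite /w /= eqxx [e == _]eq_sym ce !addn0 addnA addn1.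
  - by rewrite /w /= eqxx addn0 !addnA addn1.
rewrite /eqpairs -!val_eqE /=.
(* Transitivity of equality discards the truth assignments of the six comparisons that no four
   replicas realize. *)
have tr (u v z : nat) : ((u == v) && (u == z) ==> (v == z)) && ((u == v) && (v == z) ==> (u == z)) && ((u == z) && (v == z) ==> (u == v)).
  by do ![case: eqP => [->|]]; rewrite ?eqxx// => *; do ?[case: eqP => //=]; congruence.
have := tr a b c; have := tr a b e; have := tr a c e; have := tr b c e.
do 6![case: (_ == _ :> nat)] => //= _ _ _ _; rewrite /pattern_moment; try ring.
Qed.

Definition pattern_mean (n : nat) : R := Eeta (pattern_moment n).

Definition word i (a b c e : 'I_8) s : R := sg (s a) i * sg (s b) i * (sg (s c) i * sg (s e) i).

Lemma cav0_word i a b c e : cav i 0 (word i a b c e) = pattern_mean (eqpairs a b c e).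
Proof.
have := @cav0_words R S N beta h D p q _ _ Q X iX i [:: (1, [:: a; b; c; e])].
rewrite (_ : (fun s => _) = word i a b c e); last first.
  by apply/funext => s; rewrite /word !big_cons !big_nil /=; ring.
move=> ->; apply: eq_Rintegral => x _.
by apply: (etrans _ (prod_count4 a b c e x)); rewrite big_seq1 mul1r.
Qed.

(** Linearity of the expectation over eta is borrowed from [cav] at angle 0, with site [i] realizing
    the moments as cavity averages. *)
Lemma Eeta_patternB i (a b c e a' b' c' e' : 'I_8) :
  Eeta (fun x => pattern_moment (eqpairs a b c e) x - pattern_moment (eqpairs a' b' c' e') x) =
  cav i 0 (word i a b c e) - cav i 0 (word i a' b' c' e').
Proof.
have := @cav0_words R S N beta h D p q _ _ Q X iX i [:: (1, [:: a; b; c; e]); (-1, [:: a'; b'; c'; e'])].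
rewrite (_ : (fun s => _) = (fun s => word i a b c e s + -1 * word i a' b' c' e' s)); last first.
  by apply/funext => s; rewrite /word !big_cons !big_nil /=; ring.
rewrite cavD// cavZ// mulN1r => ->; apply: eq_Rintegral => x _.
by rewrite big_cons big_seq1 /= -!prod_count4 /=; ring.
Qed.

Lemma cD_pattern i : cD S beta h D p q = pattern_mean 6 - pattern_mean 2.
Proof.
by rewrite -(cav0_word i o0 o0 o0 o0) -(cav0_word i o0 o0 o1 o1) -Eeta_patternB.
Qed.

Lemma cF_pattern i : cF S beta h D p q = pattern_mean 2 - pattern_mean 1.
Proof.
rewrite -(cav0_word i o0 o0 o1 o1) -(cav0_word i o0 o0 o1 o2) -Eeta_patternB.
by apply: eq_Rintegral => x _ /=; ring.
Qed.

Lemma cG_pattern i : cG S beta h D p q = pattern_mean 1 - pattern_mean 0.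
Proof.
rewrite -(cav0_word i o0 o0 o1 o2) -(cav0_word i o0 o1 o2 o3) -Eeta_patternB.
by apply: eq_Rintegral => x _ /=; ring.
Qed.

Lemma cE_pattern i : cE S beta h D p q = pattern_mean 3 - pattern_mean 1.
Proof.
rewrite -(cav0_word i o0 o0 o0 o1) -(cav0_word i o0 o0 o1 o2) -Eeta_patternB.
by apply: eq_Rintegral => x _ /=; ring.
Qed.

End Words.

Ltac eval_eqpairs := repeat match goal with
  |- context [eqpairs ?a ?b ?c ?e] =>
    let n := eval vm_compute in (eqpairs a b c e) in
    change (eqpairs a b c e) with n end.

Section ReplicaSums.
Context {R : realType}.
Implicit Types (G : 'I_8 -> R) (V : nat -> R) (M : 'I_8 -> 'I_8 -> R).

Lemma kap2_sum G : \sum_l kap 2 l * G l = G o0 + G o1 - 2 * G o2.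
Proof. by rewrite big_ord8 /kap /=; ring. Qed.

Lemma kap3_sum G : \sum_l kap 3 l * G l = G o0 + G o1 + G o2 - 3 * G o3.
Proof. by rewrite big_ord8 /kap /=; ring. Qed.

Lemma kap4_sum G : \sum_l kap 4 l * G l = G o0 + G o1 + G o2 + G o3 - 4 * G o4.
Proof. by rewrite big_ord8 /kap /=; ring. Qed.

Lemma kap5_sum G : \sum_l kap 5 l * G l =
  G o0 + G o1 + G o2 + G o3 + G o4 - 5 * G o5.
Proof. by rewrite big_ord8 /kap /=; ring. Qed.

Lemma kap_double_sum m m' (Y : 'I_8 -> 'I_8 -> R) :
  \sum_l \sum_l' kap m l * kap m' l' * Y l l' =
  \sum_l kap m l * \sum_l' kap m' l' * Y l l'.
Proof.
by apply: eq_bigr => l _; rewrite mulr_sumr; apply: eq_bigr => l' _; rewrite mulrA.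
Qed.

(** In this sum and the next two the coefficient is antisymmetric in replicas 0 and 1, so only pairs
    (l, l') meeting {0, 1} in exactly one replica survive. [V] stands for the pattern means and [M]
    for covariances with a fixed overlap, which do not distinguish fresh replicas. *)
Lemma replica_sum_S V M :
  M o0 o3 = M o0 o2 -> M o1 o3 = M o1 o2 -> M o2 o0 = M o0 o2 -> M o2 o1 = M o1 o2 ->
  \sum_l \sum_l' kap 2 l * kap 3 l' *
    ((V (eqpairs o0 o0 l l') - V (eqpairs o1 o1 l l')) * M l l') =
  (V 6 - V 2) * (M o0 o0 - M o1 o1) - 4 * (V 3 - V 1) * (M o0 o2 - M o1 o2).
Proof.
move=> h1 h2 h3 h4; rewrite kap_double_sum kap2_sum !kap3_sum; eval_eqpairs.
rewrite h1 h2 h3 h4; ring.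
Qed.

Lemma replica_sum_ST V M :
  (forall j : 'I_8, (1 < j)%N -> M o0 j = M o0 o2) -> (forall j : 'I_8, (1 < j)%N -> M o1 j = M o1 o2) ->
  (forall l l', M l l' = M l' l) ->
  \sum_l \sum_l' kap 3 l * kap 4 l' *
    ((V (eqpairs o0 o2 l l') - V (eqpairs o1 o2 l l')) * M l l') =
  (V 3 - V 1) * (M o0 o0 - M o1 o1) +
  (2 * (V 2 - V 1) - 6 * (V 1 - V 0)) * (M o0 o2 - M o1 o2).
Proof.
move=> h0 h1 sym; rewrite kap_double_sum kap3_sum !kap4_sum; eval_eqpairs.
rewrite (sym o2 o0) (sym o2 o1) (sym o3 o0) (sym o3 o1).
rewrite (h0 o3 isT) (h0 o4 isT) (h1 o3 isT) (h1 o4 isT); ring.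
Qed.

Lemma replica_sum_T V M :
  (forall j : 'I_8, (1 < j)%N -> j != o3 -> M o0 j = M o0 o2) ->
  (forall j : 'I_8, (1 < j)%N -> j != o3 -> M o1 j = M o1 o2) ->
  (forall l l', M l l' = M l' l) ->
  \sum_l \sum_l' kap 4 l * kap 5 l' *
    ((V (eqpairs o0 o2 l l') - V (eqpairs o1 o2 l l')) * M l l') =
  (V 3 - V 1) * (M o0 o0 - M o1 o1) +
  (2 * (V 2 - V 1) - 8 * (V 1 - V 0)) * (M o0 o2 - M o1 o2) +
  2 * (V 1 - V 0) * (M o0 o3 - M o1 o3).
Proof.
move=> h0 h1 sym; rewrite kap_double_sum kap4_sum !kap5_sum; eval_eqpairs.
rewrite (sym o2 o0) (sym o2 o1) (sym o3 o0) (sym o3 o1) (sym o4 o0) (sym o4 o1).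
rewrite (h0 o4 isT isT) (h0 o5 isT isT) (h1 o4 isT isT) (h1 o5 isT isT); ring.
Qed.

(** The coefficient is antisymmetric in {0, 1} and in {2, 3}: only pairs joining one set to the
    other survive, and the sum is a multiple of a single unknown. *)
Lemma replica_sum_TT V M :
  (forall l l', M l l' = M l' l) ->
  \sum_l \sum_l' kap 4 l * kap 5 l' *
    ((V (eqpairs o0 o2 l l') - V (eqpairs o0 o3 l l') -
      (V (eqpairs o1 o2 l l') - V (eqpairs o1 o3 l l'))) * M l l') =
  2 * ((V 2 - V 1) - (V 1 - V 0)) * (M o0 o2 - M o1 o2 - (M o0 o3 - M o1 o3)).
Proof.
move=> sym; rewrite kap_double_sum kap4_sum !kap5_sum; eval_eqpairs.
rewrite (sym o2 o0) (sym o2 o1) (sym o3 o0) (sym o3 o1); ring.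
Qed.

End ReplicaSums.

(** * The four instances of the expansion *)

Section Instances.
Context {R : realType} {S N : nat}.
Variables (beta h D p q : R).
Local Notation cfg := (config S N).
Local Notation sg := (@sv R S N).
Local Notation rstate := {ffun 'I_8 -> cfg}.
Context {d} {Omega : measurableType d} (Q : probability Omega R)
  (X : @disorder_index N -> Omega -> R).
Hypothesis iX : iid_gauss active Q X.
Local Notation a := (@spin2 R S).
Hypotheses (beta_ge0 : 0 <= beta) (beta_le1 : beta <= 1) (N_gt0 : (0 < N)%N).
Hypotheses (q_ge0 : 0 <= q) (q_le : q <= a) (p_ge0 : 0 <= p) (p_le : p <= a).
Hypothesis fix_pq : fixed_point S beta h D p q.
Hypothesis small_beta : (@stab_const R S 1 + @stab_const R S 3) * beta ^+ 2 <= 1 / 4.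
Implicit Types (f g : rstate -> R) (i : 'I_N) (s : rstate) (l u v : 'I_8).
Local Notation cav := (cav beta h D p q Q X).
Local Notation Qc := (Qc p q).
Local Notation nu1 := (nu1 beta h D Q X).
Local Notation word := (@word R S N).
Local Notation pm := (@pattern_mean R S beta h D p q).
Local Notation cDD := (cD S beta h D p q).
Local Notation cFF := (cF S beta h D p q).
Local Notation cGG := (cG S beta h D p q).
Local Notation cEE := (cE S beta h D p q).

Let r : R := (Num.sqrt N%:R)^-1.

Definition Qcov u v l l' : R := nu1 (fun s => Qc l l' s * Qc u v s).

Lemma Qcov_perm (pp : {perm 'I_8}) u v l l' :
  Qcov (pp u) (pp v) (pp l) (pp l') = Qcov u v l l'.
Proof.
pose i0 : 'I_N := Ordinal N_gt0.
rewrite /Qcov -!(nu1E beta h D p q Q X i0) -(cav_perm _ _ _ _ _ _ _ _ _ (fun s => Qc l l' s * Qc u v s) pp).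
by apply: eq_cav => s; rewrite /Qc /ov !ffunE !(inj_eq perm_inj).
Qed.

Lemma QcovC u v l l' : Qcov u v l' l = Qcov u v l l'.
Proof.
apply: eq_nu1 => s; congr (_ * _); rewrite /Qc /ov eq_sym; congr (_ * _ - _).
by apply: eq_bigr => j _; rewrite mulrC.
Qed.

Lemma Qcov_sym u v l l' : Qcov l l' u v = Qcov u v l l'.
Proof. by apply: eq_nu1 => s; rewrite mulrC. Qed.

Lemma Qcov_tperm u v l j k : j != u -> j != v -> j != l -> k != u -> k != v -> k != l ->
  Qcov u v l k = Qcov u v l j.
Proof.
move=> ju jv jl ku kv kl; rewrite -(Qcov_perm (tperm j k) u v l j) tpermL.
by rewrite !tpermD// eq_sym.
Qed.

Lemma nu1_QcovB u v l l' w w' :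
  nu1 (fun s => (Qc l l' s - Qc w w' s) * Qc u v s) = Qcov u v l l' - Qcov u v w w'.
Proof.
rewrite /Qcov -(nu1B beta h D p q iX N_gt0); apply: eq_nu1 => s; ring.
Qed.

Lemma cavB i th f g : cav i th (fun s => f s - g s) = cav i th f - cav i th g.
Proof.
rewrite -mulN1r -(cavZ beta h D p q iX) -(cavD beta h D p q iX).
by apply: eq_cav => s; rewrite mulN1r.
Qed.

(** The coefficients [c] are the same at every site, so averaging the expansions keeps both the main
    term and the error bound. *)
Lemma cavity_expansion_avg m (phi : ('I_8 -> R) -> R) (b : R) u v
    (c : 'I_8 -> 'I_8 -> R) (Phi : rstate -> R) : (m <= 4)%N ->
  (forall x y, (forall l, (l < m)%N -> x l = y l) -> phi x = phi y) ->
  (forall x, (forall l, `|x l| <= S%:R) -> `|phi x| <= b) ->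
  (u < m)%N -> (v < m)%N ->
  (forall i, cav i 0 (fun s => phi (fun l => sg (s l) i)) = 0) ->
  (forall i l l', cav i 0 (fun s => phi (fun l => sg (s l) i) * (sg (s l) i * sg (s l') i)) = c l l') ->
  (forall s, Phi s = N%:R^-1 * \sum_i phi (fun l => sg (s l) i)) ->
  `|nu1 (fun s => Phi s * Qc u v s) -
    (N%:R^-1 * c u v + beta ^+ 2 / 2 * \sum_l \sum_l' kap m l * kap m.+1 l' *
       (c l l' * Qcov u v l l'))| <= @CE_const R S b * r ^+ 3.
Proof.
move=> m4 phim phib um vm phi0 phic PhiE.
set rhs := (_ * c u v + _).
have -> : nu1 (fun s => Phi s * Qc u v s) =
    N%:R^-1 * \sum_i nu1 (fun s => phi (fun l => sg (s l) i) * Qc u v s).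
  rewrite -(nu1_sum beta h D p q iX N_gt0) -(nu1Z beta h D p q iX N_gt0).
  by apply: eq_nu1 => s; rewrite PhiE -mulrA mulr_suml.
rewrite (_ : rhs = N%:R^-1 * \sum_(i < N) rhs); last first.
  by rewrite sumr_const card_ord -[X in _ * X]mulr_natl mulKf// pnatr_eq0 -lt0n.
rewrite -mulrBr -sumrB; apply: norm_avg_le => // i.
have := cavity_expansion iX beta_ge0 beta_le1 N_gt0 q_ge0 q_le p_ge0 p_le fix_pq small_beta
  m4 phim phib um vm (phi0 i).
rewrite phic.
under eq_bigr do under eq_bigr do rewrite phic.
exact.
Qed.

Lemma norm_mul_le (x y c c' : R) : `|x| <= c -> `|y| <= c' -> `|x * y| <= c * c'.
Proof. by move=> xc yc; rewrite normrM ler_pM. Qed.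

Definition nuS : R := Qcov o0 o0 o0 o0 - Qcov o0 o0 o1 o1.
Definition nuST : R := Qcov o0 o0 o0 o2 - Qcov o0 o0 o1 o2.
Definition nuT : R := Qcov o0 o3 o0 o2 - Qcov o0 o3 o1 o2.
(** The overlap (sigma^0 - sigma^1).(sigma^2 - sigma^3)/N tested against Q_02: the second moment of
    the overlap of two replicas centered by their Gibbs means. It enters the equation for [nuT] and
    solves an equation of its own. *)
Definition nuTT : R := Qcov o0 o2 o0 o2 - Qcov o0 o2 o1 o2 - (Qcov o0 o2 o0 o3 - Qcov o0 o2 o1 o3).

Let i0 : 'I_N := Ordinal N_gt0.

Lemma ov_sub s l l' w w' : (l == l') = (w == w') ->
  Qc l l' s - Qc w w' s =
  N%:R^-1 * \sum_i (sg (s l) i * sg (s l') i - sg (s w) i * sg (s w') i).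
Proof.
by move=> e; rewrite /Qc e /ov sumrB mulrBr; ring.
Qed.

Lemma expansion_S :
  `|nuS - (N%:R^-1 * cDD + beta ^+ 2 / 2 * (cDD * nuS - 4 * cEE * nuST))|
    <= @CE_const R S (2 * a) * r ^+ 3.
Proof.
pose phi (x : 'I_8 -> R) := x o0 * x o0 - x o1 * x o1.
pose c l l' := pm (eqpairs o0 o0 l l') - pm (eqpairs o1 o1 l l').
have := @cavity_expansion_avg 2 phi (2 * a) o0 o0 c (fun s => Qc o0 o0 s - Qc o1 o1 s).
rewrite nu1_QcovB.
have -> : c o0 o0 = cDD by rewrite /c (cD_pattern beta h D p q iX i0); eval_eqpairs.
rewrite replica_sum_S; first last.
- exact: QcovC.
- exact: QcovC.
- exact: Qcov_tperm.
- exact: Qcov_tperm.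
rewrite -(cD_pattern beta h D p q iX i0) -(cE_pattern beta h D p q iX i0) -/nuS -/nuST.
apply=> //.
- by move=> x y E; rewrite /phi !E.
- move=> x xS; apply: (le_trans (ler_normB _ _)).
  by rewrite mulrDl mul1r /spin2 expr2 lerD ?norm_mul_le.
- by move=> i; rewrite cavB !(cav0_spin2 iX fix_pq) subrr.
- move=> i l l'; rewrite /c -!(cav0_word beta h D p q iX i) -cavB.
  by apply: eq_cav => s; rewrite /phi /word mulrBl.
- by move=> s; rewrite ov_sub.
Qed.

Let phiT (x : 'I_8 -> R) := x o0 * x o2 - x o1 * x o2.
Let cT (l l' : 'I_8) := pm (eqpairs o0 o2 l l') - pm (eqpairs o1 o2 l l').

Let phiT_dep m (x y : 'I_8 -> R) : (2 < m)%N ->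
  (forall l, (l < m)%N -> x l = y l) -> phiT x = phiT y.
Proof. by move=> m2 E; rewrite /phiT !E// (ltn_trans _ m2). Qed.

Let phiT_le (x : 'I_8 -> R) : (forall l, `|x l| <= S%:R) -> `|phiT x| <= 2 * a.
Proof.
move=> xS; apply: (le_trans (ler_normB _ _)).
by rewrite mulrDl mul1r /spin2 expr2 lerD ?norm_mul_le.
Qed.

Let phiT_mean i : cav i 0 (fun s => phiT (fun l => sg (s l) i)) = 0.
Proof. by rewrite cavB !(cav0_spin2 iX fix_pq) subrr. Qed.

Let phiT_word i l l' :
  cav i 0 (fun s => phiT (fun l => sg (s l) i) * (sg (s l) i * sg (s l') i)) = cT l l'.
Proof.
rewrite /cT -!(cav0_word beta h D p q iX i) -cavB.
by apply: eq_cav => s; rewrite /phiT /word mulrBl.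
Qed.

Lemma expansion_ST :
  `|nuST - (N%:R^-1 * cEE + beta ^+ 2 / 2 * (cEE * nuS + (2 * cFF - 6 * cGG) * nuST))|
    <= @CE_const R S (2 * a) * r ^+ 3.
Proof.
have := @cavity_expansion_avg 3 phiT (2 * a) o0 o0 cT (fun s => Qc o0 o2 s - Qc o1 o2 s).
rewrite nu1_QcovB.
have -> : cT o0 o0 = cEE by rewrite /cT (cE_pattern beta h D p q iX i0); eval_eqpairs.
rewrite replica_sum_ST; last first.
- by move=> *; exact: QcovC.
- by move=> j j1; apply: Qcov_tperm => //; rewrite -val_eqE /= gtn_eqF// ltnW.
- by move=> j j1; apply: Qcov_tperm => //; rewrite -val_eqE /= gtn_eqF// ltnW.
rewrite -(cE_pattern beta h D p q iX i0) -(cF_pattern beta h D p q iX i0).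
rewrite -(cG_pattern beta h D p q iX i0) -/nuS -/nuST.
apply=> //.
- by move=> x y; exact: phiT_dep.
- by move=> s; rewrite ov_sub.
Qed.

Lemma expansion_T :
  `|nuT - (N%:R^-1 * cGG + beta ^+ 2 / 2 * (cEE * nuST +
      (2 * cFF - 8 * cGG) * nuT + 2 * cGG * (nuTT + nuT)))|
    <= @CE_const R S (2 * a) * r ^+ 3.
Proof.
have := @cavity_expansion_avg 4 phiT (2 * a) o0 o3 cT (fun s => Qc o0 o2 s - Qc o1 o2 s).
rewrite nu1_QcovB.
have -> : cT o0 o3 = cGG by rewrite /cT (cG_pattern beta h D p q iX i0); eval_eqpairs.
rewrite replica_sum_T; last first.
- by move=> *; exact: QcovC.
- by move=> j j1 j3; apply: Qcov_tperm => //; rewrite -val_eqE /= gtn_eqF// ltnW.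
- by move=> j j1 j3; apply: Qcov_tperm => //; rewrite -val_eqE /= gtn_eqF// ltnW.
rewrite -(cE_pattern beta h D p q iX i0) -(cF_pattern beta h D p q iX i0).
rewrite -(cG_pattern beta h D p q iX i0).
(* Symmetry of the covariance, exchange of replicas 0 and 1, and renaming of replica 3. *)
have -> : Qcov o0 o3 o0 o0 - Qcov o0 o3 o1 o1 = nuST.
  rewrite -!(Qcov_sym o0 o3) (@Qcov_tperm o0 o0 o0 o2 o3)//; congr (_ - _).
  rewrite -(Qcov_perm (tperm o0 o1) o1 o1 o0 o3) tpermL tpermR [tperm _ _ o3]tpermD//.
  exact: Qcov_tperm.
(* Here replica 3 already sits in the fixed overlap, so it is not fresh; exchanging 2 and 3 in
   [nuTT] exhibits the difference as [nuTT] plus [nuT]. *)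
have -> : Qcov o0 o3 o0 o3 - Qcov o0 o3 o1 o3 = nuTT + nuT.
  have /= e1 := Qcov_perm (tperm o2 o3) o0 o3 o0 o3.
  have /= e2 := Qcov_perm (tperm o2 o3) o0 o3 o1 o3.
  have /= e3 := Qcov_perm (tperm o2 o3) o0 o3 o1 o2.
  have /= e4 := Qcov_perm (tperm o2 o3) o0 o3 o0 o2.
  have t0 : tperm o2 o3 o0 = o0 by rewrite tpermD.
  have t1 : tperm o2 o3 o1 = o1 by rewrite tpermD.
  rewrite !(tpermL, tpermR, t0, t1) in e1 e2 e3 e4.
  by rewrite /nuTT /nuT e1 e2 e3 e4; ring.
rewrite -/nuT.
apply=> //.
- by move=> x y; exact: phiT_dep.
- by move=> s; rewrite ov_sub.
Qed.

Lemma expansion_TT :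
  `|nuTT - (N%:R^-1 * (cFF - cGG) + beta ^+ 2 / 2 * (2 * (cFF - cGG) * nuTT))|
    <= @CE_const R S (4 * a) * r ^+ 3.
Proof.
pose phi (x : 'I_8 -> R) := x o0 * x o2 - x o0 * x o3 - (x o1 * x o2 - x o1 * x o3).
pose c (l l' : 'I_8) := pm (eqpairs o0 o2 l l') - pm (eqpairs o0 o3 l l') -
  (pm (eqpairs o1 o2 l l') - pm (eqpairs o1 o3 l l')).
have := @cavity_expansion_avg 4 phi (4 * a) o0 o2 c
  (fun s => Qc o0 o2 s - Qc o0 o3 s - (Qc o1 o2 s - Qc o1 o3 s)).
have -> : nu1 (fun s => (Qc o0 o2 s - Qc o0 o3 s - (Qc o1 o2 s - Qc o1 o3 s)) * Qc o0 o2 s) = nuTT.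
  transitivity (Qcov o0 o2 o0 o2 - Qcov o0 o2 o0 o3 - (Qcov o0 o2 o1 o2 - Qcov o0 o2 o1 o3)).
    rewrite -!nu1_QcovB -(nu1B beta h D p q iX N_gt0); apply: eq_nu1 => s; ring.
  by rewrite /nuTT; ring.
have -> : c o0 o2 = cFF - cGG.
  rewrite /c (cF_pattern beta h D p q iX i0) (cG_pattern beta h D p q iX i0).
  by eval_eqpairs; ring.
rewrite replica_sum_TT; last by move=> *; exact: QcovC.
rewrite -(cF_pattern beta h D p q iX i0) -(cG_pattern beta h D p q iX i0) -/nuTT.
apply=> //.
- by move=> x y E; rewrite /phi !E.
- move=> x xS; apply: (le_trans (ler_normB _ _)).
  rewrite (_ : 4 * a = (a + a) + (a + a)); last by ring.
  by apply: lerD; apply: (le_trans (ler_normB _ _)); rewrite /spin2 expr2 lerD ?norm_mul_le.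
- by move=> i; rewrite !cavB !(cav0_spin2 iX fix_pq) !subrr.
- move=> i l l'; rewrite /c -!(cav0_word beta h D p q iX i) -!cavB.
  by apply: eq_cav => s; rewrite /phi /word !mulrBl.
- move=> s; rewrite !ov_sub// -mulrBr -sumrB.
  by congr (_ * _); apply: eq_bigr => i _; rewrite /phi; ring.
Qed.

End Instances.

(** * The linear system and its solution *)

Section LinearSystem.
Context {R : realFieldType}.

Lemma norm_le_of_mul (m x e c : R) : 0 < c -> c <= m -> `|m * x| <= e -> `|x| <= e / c.
Proof.
move=> c0 cm; rewrite normrM (ger0_norm (le_trans (ltW c0) cm)) ler_pdivlMr// => H.
by apply: le_trans H; rewrite mulrC ler_wpM2r.
Qed.

(** The first two relations are a 2 x 2 system in (s, c) with determinant [M]; the fourth determines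
    y through [M3]; the third then gives t through [M1]. The bounds 1/8 keep the pivots away from 0:
    M1, M2, M3 >= 1/2 and M >= 1/4. *)
Lemma overlap_system (b n D F G E s c t y e : R) : 0 <= b -> n != 0 ->
  `|b * D| <= 8^-1 -> `|b * F| <= 8^-1 -> `|b * G| <= 8^-1 -> `|b * E| <= 8^-1 ->
  `|s - (n^-1 * D + b / 2 * (D * s - 4 * E * c))| <= e ->
  `|c - (n^-1 * E + b / 2 * (E * s + (2 * F - 6 * G) * c))| <= e ->
  `|t - (n^-1 * G + b / 2 * (E * c + (2 * F - 8 * G) * t + 2 * G * (y + t)))| <= e ->
  `|y - (n^-1 * (F - G) + b / 2 * (2 * (F - G) * y))| <= e ->
  let M1 := 1 - b * (F - 3 * G) in
  let M2 := 1 - b / 2 * D in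
  let M3 := 1 - b * (F - G) in
  let M := M1 * M2 + b ^+ 2 * E ^+ 2 in
  [/\ `|t - (G * M2 + b / 2 * E ^+ 2) / (n * M * M3)| <= 8 * e,
      `|s - (D * M1 - 2 * b * E ^+ 2) / (n * M)| <= 8 * e &
      `|c - E / (n * M)| <= 8 * e].
Proof.
move=> b0 n0 bD bF bG bE.
set e1 := s - _; set e2 := c - _; set e3 := t - _; set e4 := y - _ => he1 he2 he3 he4.
move=> M1 M2 M3 M.
have [D1 D2] : - 8^-1 <= b * D /\ b * D <= 8^-1 by apply/andP; rewrite -ler_norml.
have [F1 F2] : - 8^-1 <= b * F /\ b * F <= 8^-1 by apply/andP; rewrite -ler_norml.
have [G1 G2] : - 8^-1 <= b * G /\ b * G <= 8^-1 by apply/andP; rewrite -ler_norml.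
have M1E : M1 = 1 - b * F + 3 * (b * G) by rewrite /M1; ring.
have M2E : M2 = 1 - 2^-1 * (b * D) by rewrite /M2; field.
have M3E : M3 = 1 - b * F + b * G by rewrite /M3; ring.
have M1l : 2^-1 <= M1 by lra.
have M1u : `|M1| <= 3 / 2 by rewrite ler_norml; lra.
have M2l : 2^-1 <= M2 by lra.
have M2u : `|M2| <= 3 / 2 by rewrite ler_norml; lra.
have M3l : 2^-1 <= M3 by lra.
have Ml : 4^-1 <= M.
  have : 0 <= b ^+ 2 * E ^+ 2 by rewrite mulr_ge0// sqr_ge0.
  have : 2^-1 * 2^-1 <= M1 * M2 by rewrite ler_pM// invr_ge0.
  rewrite /M; lra.
have M1n : M1 != 0 by rewrite gt_eqF//; lra.
have M3n : M3 != 0 by rewrite gt_eqF//; lra.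
have Mn : M != 0 by rewrite gt_eqF//; lra.
(* Twice the determinant, in the shape in which [field] asks for it. *)
have M2n : (1 - b * (F - 3 * G)) * (2 - b * D) + (b * E) ^+ 2 * 2 != 0.
  rewrite (_ : _ + _ = 2 * M) ?mulf_neq0//; last by rewrite /M /M1 /M2; field.
have he (x u k : R) : `|x| <= k -> `|u| <= e -> `|x * u| <= k * e.
  by move=> xk ue; rewrite normrM ler_pM.
have e0 : 0 <= e := le_trans (normr_ge0 _) he1.
have q4 : 0 < 4^-1 :> R by rewrite invr_gt0.
have q2 : 0 < 2^-1 :> R by rewrite invr_gt0.
have sB : `|s - (D * M1 - 2 * b * E ^+ 2) / (n * M)| <= 8 * e.
  (* Cramer's rule for s: the errors combine with the cofactors, and 2e divided by the lower bound
     1/4 of [M] is 8e. *)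
  have : `|M1 * e1 - 2 * (b * E) * e2| <= 2 * e.
    apply: (le_trans (ler_normB _ _)).
    have := he _ _ _ M1u he1.
    have := he (2 * (b * E)) e2 (2 * 8^-1) _ he2.
    rewrite normrM ger0_norm// ler_pM2l// => /(_ bE); lra.
  rewrite (_ : _ - _ = M * (s - (D * M1 - 2 * b * E ^+ 2) / (n * M))).
    by move/(norm_le_of_mul q4 Ml); rewrite invrK; lra.
  by rewrite /e1 /e2 /e4 /M /M1 /M2 /M3; field; rewrite ?M2n ?n0 ?M3n.
have cC : `|c - E / (n * M)| <= 8 * e.
  have : `|M2 * e2 + 2^-1 * (b * E) * e1| <= 2 * e.
    apply: (le_trans (ler_normD _ _)).
    have := he _ _ _ M2u he2.
    have := he (2^-1 * (b * E)) e1 (2^-1 * 8^-1) _ he1.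
    rewrite normrM ger0_norm ?invr_ge0// ler_pM2l// => /(_ bE); lra.
  rewrite (_ : _ + _ = M * (c - E / (n * M))).
    by move/(norm_le_of_mul q4 Ml); rewrite invrK; lra.
  by rewrite /e1 /e2 /e4 /M /M1 /M2 /M3; field; rewrite ?M2n ?n0 ?M3n.
have yY : `|y - (F - G) / (n * M3)| <= 2 * e.
  move: he4; rewrite (_ : e4 = M3 * (y - (F - G) / (n * M3))).
    by move/(norm_le_of_mul q2 M3l); rewrite invrK; lra.
  by rewrite /e1 /e2 /e4 /M /M1 /M2 /M3; field; rewrite ?M2n ?n0 ?M3n.
split=> //.
(* The third relation once c and y are compared with their limiting values: the combination is [M1]
   times the error on t, and 4e over 1/2 is 8e. *)
have : `|2^-1 * (b * E) * (c - E / (n * M)) + b * G * (y - (F - G) / (n * M3)) + e3| <= 4 * e.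
  apply: (le_trans (ler_normD _ _)); rewrite (_ : 4 * e = 2 * e + 2 * e); last by ring.
  apply: lerD; last by lra.
  apply: (le_trans (ler_normD _ _)).
  have : `|2^-1 * (b * E) * (c - E / (n * M))| <= 2^-1 * 8^-1 * (8 * e).
    by rewrite normrM ler_pM// normrM ger0_norm ?invr_ge0// ler_pM2l.
  have : `|b * G * (y - (F - G) / (n * M3))| <= 8^-1 * (2 * e).
    by rewrite normrM ler_pM.
  lra.
rewrite (_ : _ + e3 = M1 * (t - (G * M2 + b / 2 * E ^+ 2) / (n * M * M3))).
  by move/(norm_le_of_mul q2 M1l); rewrite invrK; lra.
by rewrite /e3 /M /M1 /M2 /M3; field; rewrite ?M2n ?n0 ?M3n.
Qed.
End LinearSystem.

Section Solution.
Context {R : realType} {S N : nat}.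
Variables (beta h D p q : R).
Context {d} {Omega : measurableType d} (Q : probability Omega R)
  (X : @disorder_index N -> Omega -> R).
Hypothesis iX : iid_gauss active Q X.
Local Notation a := (@spin2 R S).
Hypotheses (beta_ge0 : 0 <= beta) (beta_le1 : beta <= 1) (N_gt0 : (0 < N)%N).
Hypotheses (q_ge0 : 0 <= q) (q_le : q <= a) (p_ge0 : 0 <= p) (p_le : p <= a).
Hypothesis fix_pq : fixed_point S beta h D p q.
Hypothesis small_beta : (@stab_const R S 1 + @stab_const R S 3) * beta ^+ 2 <= 1 / 4.
Hypothesis small_beta' : 16 * a ^+ 2 * beta ^+ 2 <= 1.
Local Notation cav := (cav beta h D p q Q X).
Local Notation word := (@word R S N).
Let i0 : 'I_N := Ordinal N_gt0.

Lemma norm_cav_word i u v l l' : `|cav i 0 (word i u v l l')| <= a ^+ 2.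
Proof.
apply: (le_trans (norm_cav beta h D p q iX _ _ _)).
rewrite -[leRHS](@cav_cst R S N beta h D p q _ _ Q X i 0); apply: (le_cav beta h D p q iX) => s.
by rewrite /word /spin2 [_ ^+ 2 ^+ 2]expr2 [_ ^+ 2]expr2 !norm_mul_le ?norm_sv.
Qed.

(** Each of [cD], [cF], [cG], [cE] is such a difference of words, at most 2a^2 in size; the
    condition 16 a^2 beta^2 <= 1 is made for the bound 1/8 of [overlap_system]. *)
Lemma norm_cav_wordB u v l l' u' v' w w' :
  `|beta ^+ 2 * (cav i0 0 (word i0 u v l l') - cav i0 0 (word i0 u' v' w w'))| <= 8^-1.
Proof.
rewrite normrM (ger0_norm (sqr_ge0 _)).
apply: (@le_trans _ _ (beta ^+ 2 * (2 * a ^+ 2))); last by move: small_beta'; lra.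
rewrite ler_wpM2l ?sqr_ge0//; apply: (le_trans (ler_normB _ _)).
by rewrite mulrDl mul1r lerD ?norm_cav_word.
Qed.

(** The factor 8 comes from [overlap_system]; the sum dominates the errors of all four
    expansions. *)
Definition moment_const : R := 8 * (@CE_const R S (2 * a) + @CE_const R S (4 * a)).

Lemma replica_moments :
  [/\ `|@nuT R S N beta h D p q _ _ Q X - A1sq S beta h D p q N| <= moment_const * (Num.sqrt N%:R)^-1 ^+ 3,
      `|@nuS R S N beta h D p q _ _ Q X - B1sq S beta h D p q N| <= moment_const * (Num.sqrt N%:R)^-1 ^+ 3 &
      `|@nuST R S N beta h D p q _ _ Q X - C1sq S beta h D p q N| <= moment_const * (Num.sqrt N%:R)^-1 ^+ 3].
Proof.
have HS := expansion_S iX beta_ge0 beta_le1 N_gt0 q_ge0 q_le p_ge0 p_le fix_pq small_beta.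
have HST := expansion_ST iX beta_ge0 beta_le1 N_gt0 q_ge0 q_le p_ge0 p_le fix_pq small_beta.
have HT := expansion_T iX beta_ge0 beta_le1 N_gt0 q_ge0 q_le p_ge0 p_le fix_pq small_beta.
have HTT := expansion_TT iX beta_ge0 beta_le1 N_gt0 q_ge0 q_le p_ge0 p_le fix_pq small_beta.
have le1 := le_trans (normr_ge0 _) HS.
have le2 := le_trans (normr_ge0 _) HTT.
rewrite /moment_const -mulrA /A1sq /B1sq /C1sq /cM /cM1 /cM2 /cM3.
rewrite (_ : beta ^+ 4 = beta ^+ 2 ^+ 2); last by rewrite -exprM.
apply: (overlap_system (y := @nuTT R S N beta h D p q _ _ Q X)); first exact: sqr_ge0.
- by rewrite pnatr_eq0 -lt0n.
- rewrite (cD_pattern beta h D p q iX i0).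
  rewrite -(cav0_word beta h D p q iX i0 o0 o0 o0 o0) -(cav0_word beta h D p q iX i0 o0 o0 o1 o1).
  exact: norm_cav_wordB.
- rewrite (cF_pattern beta h D p q iX i0).
  rewrite -(cav0_word beta h D p q iX i0 o0 o0 o1 o1) -(cav0_word beta h D p q iX i0 o0 o0 o1 o2).
  exact: norm_cav_wordB.
- rewrite (cG_pattern beta h D p q iX i0).
  rewrite -(cav0_word beta h D p q iX i0 o0 o0 o1 o2) -(cav0_word beta h D p q iX i0 o0 o1 o2 o3).
  exact: norm_cav_wordB.
- rewrite (cE_pattern beta h D p q iX i0).
  rewrite -(cav0_word beta h D p q iX i0 o0 o0 o0 o1) -(cav0_word beta h D p q iX i0 o0 o0 o1 o2).
  exact: norm_cav_wordB.
- by apply: (le_trans HS); rewrite [leRHS]mulrDl lerDl.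
- by apply: (le_trans HST); rewrite [leRHS]mulrDl lerDl.
- by apply: (le_trans HT); rewrite [leRHS]mulrDl lerDl.
- by apply: (le_trans HTT); rewrite [leRHS]mulrDl lerDr.
Qed.
End Solution.

(** * Transfer to the original model *)

Section Linking.
Context {R : realType} {N : nat}.
Local Notation gam := (normal_prob (0 : R) 1).
Context {d} {Omega : measurableType d} (P : probability Omega R)
  (g : 'I_N * 'I_N -> Omega -> R).

(** The value 0 at the auxiliary index is a placeholder, overwritten by [upd] in
    [extended_disorder]. *)
Definition disorder_family (k : @disorder_index N) (w : Omega) : R :=
  if k is Some ij then g ij w else 0.

Definition extended_disorder (k : @disorder_index N) (z : Omega * R) : R :=
  upd None (disorder_family^~ z.1) z.2 k.

Hypothesis iid_g : iid_gaussian_disorder P g.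

Lemma iid_disorder_family : iid_gauss (predD1 active None) P disorder_family.
Proof.
have [gG gP] := iid_g; split=> [[ij|]|A mA].
- by move=> /andP[_ ijP]; exact: (gG ij ijP).1.
- by [] .
- have := gP (fun ij => A (Some ij)) (fun ij => mA _).
  rewrite [RHS](eq_bigr (fun ij => gam (A (Some ij)))); last first.
    by move=> ij ijP; rewrite (gG ij ijP).2.
  rewrite (reindex_omap Some id)/=; last by case.
  have -> : (\prod_(ij : 'I_N * 'I_N | (ij.1 < ij.2)%N && (Some ij == Some ij)) gam (A (Some ij)) =
             \prod_(ij : 'I_N * 'I_N | (ij.1 < ij.2)%N) gam (A (Some ij)))%E.
    by apply: eq_bigl => ij; rewrite eqxx andbT.
  move=> <-; congr (P _); apply/seteqP; split => w /=.
    move=> hw; elim/big_rec: _ => // ij B ijP wB; split=> //.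
    exact: (hw (Some ij)).
  move=> hw [ij|]; last by [].
  move=> /andP[_ ijP]; move: hw; rewrite (bigD1 ij)//=; exact: proj1.
Qed.

Lemma iid_extended_disorder : iid_gauss active (P \x gam)%E extended_disorder.
Proof. by apply: iid_gauss_upd => //; exact: iid_disorder_family. Qed.

(** The original energy does not involve the auxiliary Gaussian, which Fubini integrates out. *)
Lemma nu1_extended_disorder {S} (beta h D : R) (f : {ffun 'I_8 -> config S N} -> R) :
  (0 < N)%N ->
  nu1 beta h D (P \x gam)%E extended_disorder f =
  Rintegral P setT (fun w => rep (@Ham R S N beta h D (g^~ w)) f).
Proof.
move=> N_gt0; pose i0 : 'I_N := Ordinal N_gt0.
have int : (P \x gam)%E.-integrable setT
    (EFin \o (fun z : Omega * R => rep (@Ham R S N beta h D (g^~ z.1)) f)).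
  (* The mean-field terms vanish at pi/2, so the values p = q = 0 serve here. *)
  have := integrable_rep cfg0 (cav_coef beta 0 i0) (cav_alpha i0)
    (cav_field beta h D 0 0 i0) iid_extended_disorder (pi / 2) f.
  apply: eq_integrable => // z _ /=.
  by rewrite -/(cav_energy _ _ _ _ _ _ _ _) (cav_energy_pihalf beta h D 0 0 i0).
rewrite /nu1 /Rintegral; congr fine.
apply: (etrans (esym (integral12_prod_meas1 int))).
apply: eq_integral => w _; rewrite /fubini_F /=.
rewrite integral_cst// [X in (_ * X)%E](_ : _ = 1%E) ?mule1//.
exact: (@probability_setT _ _ R gam).
Qed.

End Linking.

(** * Gibbs averages as replica averages *)

Section GibbsReplicas.
Context {R : realType} {S N : nat}.
Variables (beta h D p q : R) (gv : 'I_N * 'I_N -> R).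
Local Notation cfg := (config S N).
Local Notation sg := (@sv R S N).
Local Notation rstate := {ffun 'I_8 -> cfg}.
Local Notation u := (@Ham R S N beta h D gv).
Local Notation ga := (@gavg R S N beta h D gv).
Local Notation Qc := (Qc p q).
Implicit Types (f g : cfg -> R) (s : rstate).

Lemma gavg1 : ga (fun=> 1) = 1.
Proof.
rewrite /gavg; under eq_bigr do rewrite mul1r.
rewrite divff// gt_eqF// (bigD1 (@cfg0 S N))//= ltr_wpDr ?expR_gt0//.
by apply: sumr_ge0 => t _; rewrite expR_ge0.
Qed.

Lemma rep_prod4 (F0 F1 F2 F3 : cfg -> R) :
  rep u (fun s => F0 (s o0) * F1 (s o1) * F2 (s o2) * F3 (s o3)) =
  ga F0 * ga F1 * ga F2 * ga F3.
Proof.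
pose F (l : 'I_8) := nth (fun=> 1) [:: F0; F1; F2; F3] l.
transitivity (rep u (fun s => \prod_l F l (s l))).
  apply: eq_rep => s; rewrite !big_ord_recl big_ord0 /F /= !mulr1 !mulrA.
  by congr (F0 (s _) * F1 (s _) * F2 (s _) * F3 (s _)); apply: val_inj.
rewrite rep_prod !big_ord_recl big_ord0 /F /= -/(ga F0) -/(ga F1) -/(ga F2) -/(ga F3).
by rewrite -/(ga (fun=> 1)) gavg1 !mulr1 !mulrA.
Qed.

Lemma eq_gavg f g : f =1 g -> ga f = ga g.
Proof. by move=> /funext ->. Qed.

Lemma gavgE f : ga f = rep u (fun s => f (s o0)).
Proof.
have := rep_prod4 f (fun=> 1) (fun=> 1) (fun=> 1).
by rewrite gavg1 !mulr1 => <-; apply: eq_rep => s; rewrite !mulr1.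
Qed.

Lemma gavgD f g : ga (fun t => f t + g t) = ga f + ga g.
Proof. by rewrite !gavgE repD. Qed.

Lemma gavgZ c f : ga (fun t => c * f t) = c * ga f.
Proof. by rewrite !gavgE repZ. Qed.

Lemma gavg_sum (F : 'I_N -> cfg -> R) : ga (fun t => \sum_i F i t) = \sum_i ga (F i).
Proof. by rewrite gavgE rep_sum; apply: eq_bigr => i _; rewrite gavgE. Qed.

Lemma gavg_centered f c : ga (fun t => (f t - ga f) * c) = 0.
Proof.
transitivity (ga (fun t => c * f t + (- (c * ga f)) * 1)).
  by apply: eq_gavg => t; ring.
by rewrite gavgD !gavgZ gavg1; ring.
Qed.

Lemma gavg_center f g c : ga (fun t => (f t - ga f) * (g t - c)) = ga (fun t => (f t - ga f) * g t).
Proof.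
rewrite -[RHS]addr0 -(gavg_centered f (- c)) -gavgD.
by apply: eq_gavg => t; ring.
Qed.

(** Replica 1 supplies the subtracted mean of [f]; replicas 2 and 3 supply further Gibbs means, so
    that a product of averages under one disorder becomes a single replica average. *)
Lemma rep_cov f g (F2 F3 : cfg -> R) :
  rep u (fun s => (f (s o0) - f (s o1)) * g (s o0) * F2 (s o2) * F3 (s o3)) =
  ga (fun t => (f t - ga f) * g t) * ga F2 * ga F3.
Proof.
transitivity (rep u (fun s => (f (s o0) * g (s o0)) * 1 * F2 (s o2) * F3 (s o3) +
  -1 * (g (s o0) * f (s o1) * F2 (s o2) * F3 (s o3)))).
  by apply: eq_rep => s; ring.
rewrite repD repZ (rep_prod4 (fun t => f t * g t) (fun=> 1)) (rep_prod4 g f) gavg1.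
have -> : ga (fun t => (f t - ga f) * g t) = ga (fun t => f t * g t) + - ga f * ga g.
  by rewrite -gavgZ -gavgD; apply: eq_gavg => t; ring.
by ring.
Qed.

Let A (t : cfg) : R := N%:R^-1 * \sum_i sg t i ^+ 2.
Let b := @bb R S N beta h D gv.

Let S1E t : S1 beta h D gv t = A t - ga A.
Proof. by rewrite /S1 sumrB mulrBr /A gavgZ gavg_sum. Qed.

Let ovE s l l' : Qc l l' s = N%:R^-1 * (\sum_i sg (s l) i * sg (s l') i) - (if l == l' then p else q).
Proof. by []. Qed.

Let Qc00 s : Qc o0 o0 s = A (s o0) - p.
Proof. by rewrite ovE /A; under eq_bigr do rewrite -expr2. Qed.

Let Qc11 s : Qc o1 o1 s = A (s o1) - p.
Proof. by rewrite ovE /A; under eq_bigr do rewrite -expr2. Qed.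

Lemma gavg_S1S1 : ga (fun t => S1 beta h D gv t ^+ 2) =
  rep u (fun s => (Qc o0 o0 s - Qc o1 o1 s) * Qc o0 o0 s).
Proof.
transitivity (ga (fun t => (A t - ga A) * (A t - p)) * ga (fun=> 1) * ga (fun=> 1)).
  rewrite gavg1 !mulr1 gavg_center -(gavg_center A A (ga A)).
  by apply: eq_gavg => t; rewrite S1E expr2.
by rewrite -rep_cov; apply: eq_rep => s; rewrite Qc00 Qc11; ring.
Qed.

(** The mean b_i in [T1] is read on replica 2. Against the centered factor [S1], both the centering
    of [T1] and the constant [q] average to 0. *)
Lemma gavg_S1T1 : ga (fun t => S1 beta h D gv t * T1 beta h D gv t) =
  rep u (fun s => (Qc o0 o0 s - Qc o1 o1 s) * Qc o0 o2 s).
Proof.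
transitivity (N%:R^-1 * \sum_i ga (fun t => (A t - ga A) * sg t i) * b i).
  transitivity (ga (fun t => N%:R^-1 * \sum_i b i * ((A t - ga A) * (sg t i - b i)))).
    apply: eq_gavg => t; rewrite S1E /T1 mulrCA mulr_sumr; congr (_ * _).
    by apply: eq_bigr => i _; rewrite /b; ring.
  rewrite gavgZ gavg_sum; congr (_ * _); apply: eq_bigr => i _.
  by rewrite gavgZ gavg_center mulrC.
transitivity (rep u (fun s => N%:R^-1 * \sum_i (A (s o0) - A (s o1)) * sg (s o0) i * sg (s o2) i * 1 +
    (A (s o0) - A (s o1)) * - q * 1 * 1)); last first.
  apply: eq_rep => s; rewrite Qc00 Qc11 ovE /=.
  rewrite (eq_bigr (fun i => (A (s o0) - A (s o1)) * (sg (s o0) i * sg (s o2) i))); last first.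
    move=> i _; ring.
  by rewrite -mulr_sumr; ring.
rewrite repD repZ rep_sum (rep_cov A (fun=> - q) (fun=> 1) (fun=> 1)) gavg_centered !mul0r addr0.
congr (_ * _); apply: eq_bigr => i _.
by rewrite (rep_cov A (fun t => sg t i) (fun t => sg t i) (fun=> 1)) gavg1 mulr1.
Qed.

(** The means b_i and b_j are read on the distinct replicas 2 and 3, and replica 1 centers the first
    spin. The centering of the second spin and the constant [q] average to 0 against that centered
    factor. *)
Lemma gavg_T1T1 : ga (fun t => T1 beta h D gv t ^+ 2) =
  rep u (fun s => (Qc o0 o2 s - Qc o1 o2 s) * Qc o0 o3 s).
Proof.
pose x i t := sg t i - b i.
transitivity (N%:R^-1 ^+ 2 * \sum_i \sum_j ga (fun t => x i t * sg t j) * b i * b j).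
  transitivity (ga (fun t => N%:R^-1 ^+ 2 * \sum_i \sum_j b i * b j * (x i t * (sg t j - b j)))).
    apply: eq_gavg => t; rewrite /T1 exprMn [in LHS](expr2 (\sum_i _)) big_distrlr /=; congr (_ * _).
    by apply: eq_bigr => i _; apply: eq_bigr => j _; rewrite /x /b; ring.
  rewrite gavgZ gavg_sum; congr (_ * _); apply: eq_bigr => i _.
  rewrite gavg_sum; apply: eq_bigr => j _.
  by rewrite gavgZ gavg_center; ring.
transitivity (rep u (fun s => N%:R^-1 ^+ 2 *
     (\sum_i \sum_j (sg (s o0) i - sg (s o1) i) * sg (s o0) j * sg (s o2) i * sg (s o3) j) +
    N%:R^-1 * \sum_i (sg (s o0) i - sg (s o1) i) * - q * sg (s o2) i * 1)); last first.
  apply: eq_rep => s; rewrite !ovE /=.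
  rewrite [X in _ = X * _](_ : _ = N%:R^-1 * \sum_i (sg (s o0) i - sg (s o1) i) * sg (s o2) i); last first.
    rewrite [in RHS](eq_bigr (fun i => sg (s o0) i * sg (s o2) i - sg (s o1) i * sg (s o2) i)); last first.
      by move=> i _; ring.
    by rewrite sumrB; ring.
  rewrite mulrBr mulrACA -expr2 big_distrlr /=; congr (_ * _ + _).
    by apply: eq_bigr => i _; apply: eq_bigr => j _; ring.
  rewrite -[in RHS]mulrA [in RHS]mulr_suml -[in RHS]mulrN -[in RHS]sumrN; congr (_ * _); apply: eq_bigr => i _; ring.
rewrite repD !repZ !rep_sum [X in _ = _ + _ * X]big1 ?mulr0 ?addr0; last first.
  move=> i _; rewrite (rep_cov (fun t => sg t i) (fun=> - q) (fun t => sg t i) (fun=> 1)).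
  by rewrite gavg_centered !mul0r.
congr (_ * _); apply: eq_bigr => i _; rewrite rep_sum; apply: eq_bigr => j _.
by rewrite (rep_cov (fun t => sg t i) (fun t => sg t j) (fun t => sg t i) (fun t => sg t j)).
Qed.

End GibbsReplicas.

Section NuReplicas.
Context {R : realType} {S N : nat}.
Variables (beta h D p q : R).
Context {d} {Omega : measurableType d} (P : probability Omega R)
  (g : 'I_N * 'I_N -> Omega -> R).
Hypothesis iid_g : iid_gaussian_disorder P g.
Hypothesis N_gt0 : (0 < N)%N.
Hypothesis fix_pq : fixed_point S beta h D p q.
Local Notation a := (@spin2 R S).
Local Notation Q := (P \x normal_prob (0 : R) 1)%E.
Local Notation X := (extended_disorder g).
Let i0 : 'I_N := Ordinal N_gt0.
Let iX : iid_gauss active Q X := iid_extended_disorder iid_g.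

Lemma nu_nu1 (f : ('I_N * 'I_N -> R) -> config S N -> R) (phi : {ffun 'I_8 -> config S N} -> R) :
  (forall gv, gavg beta h D gv (f gv) = rep (@Ham R S N beta h D gv) phi) ->
  nu P beta h D g f = nu1 beta h D Q X phi.
Proof.
move=> E; rewrite (nu1_extended_disorder iid_g)//.
by apply: eq_Rintegral => w _; exact: E.
Qed.

Lemma nu_T1T1 : nu P beta h D g (fun gv sigma => @T1 R S N beta h D gv sigma ^+ 2) =
  @nuT R S N beta h D p q _ _ Q X.
Proof.
rewrite (nu_nu1 (gavg_T1T1 beta h D p q)).
by rewrite (nu1_QcovB beta h D p q iX N_gt0).
Qed.

Lemma nu_S1S1 : nu P beta h D g (fun gv sigma => @S1 R S N beta h D gv sigma ^+ 2) =
  @nuS R S N beta h D p q _ _ Q X.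
Proof.
rewrite (nu_nu1 (gavg_S1S1 beta h D p q)).
by rewrite (nu1_QcovB beta h D p q iX N_gt0).
Qed.

Lemma nu_S1T1 : nu P beta h D g (fun gv sigma => @S1 R S N beta h D gv sigma * @T1 R S N beta h D gv sigma) =
  @nuST R S N beta h D p q _ _ Q X.
Proof.
rewrite (nu_nu1 (gavg_S1T1 beta h D p q)) (nu1_QcovB beta h D p q iX N_gt0).
(* The two overlaps come in exchanged roles: symmetry of the covariance and the swap of replicas 0
   and 1 restore the form of [nuST]. *)
rewrite -!(Qcov_sym _ _ _ _ _ _ _ o0 o2) /nuST; congr (_ - _).
by rewrite -(Qcov_perm beta h D p q Q X N_gt0 (tperm o0 o1) o1 o1 o0 o2) tpermL tpermR [tperm _ _ o2]tpermD.
Qed.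

(** By [cav0_spin2], [p] and [q] are cavity averages of spin products at angle 0, so the bounds on
    spins pass to them. *)
Lemma fixed_point_bounds : [/\ 0 <= q, q <= a, 0 <= p & p <= a].
Proof.
have le u v : cav beta h D p q Q X i0 0 (fun s => @sv R S N (s u) i0 * @sv R S N (s v) i0) <= a.
  rewrite -[leRHS](@cav_cst R S N beta h D p q _ _ Q X i0 0); apply: (le_cav beta h D p q iX) => s.
  by rewrite (le_trans (ler_norm _))// /spin2 expr2 norm_mul_le ?norm_sv.
have := le o0 o0; rewrite (cav0_spin2 iX fix_pq) /= => pa.
have := le o0 o1; rewrite (cav0_spin2 iX fix_pq) /= => qa.
split=> //.
  by rewrite fix_pq.1; apply: Rintegral_ge0 => x _; exact: sqr_ge0.
have <- : cav beta h D p q Q X i0 0 (fun s => @sv R S N (s o0) i0 * @sv R S N (s o0) i0) = p.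
  by rewrite (cav0_spin2 iX fix_pq).
by apply: (cav_ge0 beta h D p q iX) => s; rewrite -expr2 sqr_ge0.
Qed.
End NuReplicas.

Lemma small_beta_exists {R : realType} (k a : R) : 0 <= a ->
  exists beta0 : R, 0 < beta0 /\ forall beta, 0 < beta < beta0 ->
    [/\ beta <= 1, k * beta ^+ 2 <= 1 / 4 & 16 * a ^+ 2 * beta ^+ 2 <= 1].
Proof.
(* One summand of [L] for each constraint: beta < 1/L and beta <= 1 give beta^2 * L <= beta * L <=
   1. *)
move=> a0; pose L := 4 * `|k| + 16 * a ^+ 2 + 1.
have k0 : 0 <= `|k| := normr_ge0 k.
have a2 : 0 <= a ^+ 2 := sqr_ge0 a.
have L1 : 1 <= L by rewrite /L; lra.
exists L^-1; split=> [|beta /andP[b0 bL]]; first by rewrite invr_gt0; lra.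
have bL1 : beta * L <= 1 by rewrite -ler_pdivlMr ?div1r ?ltW//; lra.
have b1 : beta <= 1 by apply: le_trans bL1; rewrite ler_peMr// ltW.
have b2 : beta ^+ 2 <= beta by rewrite expr2 ler_piMr// ltW.
have b2L : beta ^+ 2 * L <= 1.
  by apply: le_trans bL1; rewrite ler_wpM2r//; lra.
have b20 := sqr_ge0 beta.
have kb : k * beta ^+ 2 <= `|k| * beta ^+ 2 by rewrite ler_wpM2r ?ler_norm.
have kb0 : 0 <= `|k| * beta ^+ 2 by rewrite mulr_ge0.
have ab0 : 0 <= a ^+ 2 * beta ^+ 2 by rewrite mulr_ge0.
have : beta ^+ 2 * L = 4 * (`|k| * beta ^+ 2) + 16 * (a ^+ 2 * beta ^+ 2) + beta ^+ 2.
  by rewrite /L; ring.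
by move=> LE; split=> //; lra.
Qed.

Theorem theorem3p15 (R : realType) (S : nat) (h D : R) :
  (1 <= S)%N -> 0 <= h ->
  exists beta0 : R, 0 < beta0 /\
  forall beta : R, 0 < beta < beta0 ->
  forall p q : R, fixed_point S beta h D p q ->
  exists C : R,
  forall (N : nat) (d : measure_display) (Omega : measurableType d)
         (P : probability Omega R) (g : 'I_N * 'I_N -> Omega -> R),
  (2 <= N)%N -> iid_gaussian_disorder P g ->
  let err := C * (N%:R * Num.sqrt N%:R)^-1 in
  `| nu P beta h D g (fun gv sigma => (@T1 R S N beta h D gv sigma) ^+ 2)
     - A1sq S beta h D p q N | <= err /\
  `| nu P beta h D g (fun gv sigma => (@S1 R S N beta h D gv sigma) ^+ 2)
     - B1sq S beta h D p q N | <= err /\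
  `| nu P beta h D g (fun gv sigma => @S1 R S N beta h D gv sigma
                                       * @T1 R S N beta h D gv sigma)
     - C1sq S beta h D p q N | <= err.
Proof.
move=> _ _; have a0 : 0 <= @spin2 R S by exact: sqr_ge0.
have [beta0 [beta0_gt0 small]] :=
  small_beta_exists (@stab_const R S 1 + @stab_const R S 3) a0.
exists beta0; split=> // beta bb; have [b1 sb sb'] := small _ bb.
have b_ge0 : 0 <= beta by case/andP: bb => /ltW.
move=> p q fix_pq; exists (@moment_const R S) => N d Omega P g N2 iid_g err.
have N_gt0 : (0 < N)%N by exact: ltnW.
have [q0 qa p0 pa] := fixed_point_bounds iid_g N_gt0 fix_pq.
rewrite (nu_T1T1 beta h D p q iid_g N_gt0) (nu_S1S1 beta h D p q iid_g N_gt0).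
rewrite (nu_S1T1 beta h D p q iid_g N_gt0).
(* N * sqrt N is the cube of sqrt N, the scale of the errors in the expansions. *)
have -> : err = @moment_const R S * (Num.sqrt N%:R)^-1 ^+ 3.
  by rewrite /err exprVn exprS sqr_sqrtr ?ler0n// [_ * N%:R]mulrC.
by have [] := replica_moments (iid_extended_disorder iid_g) b_ge0 b1 N_gt0 q0 qa p0 pa fix_pq sb sb'.
Qed.
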